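(* Let $(\mathcal{E},\otimes)$ be a locally subcartesian closed category with finite limits. Then the bicategory of polynomials $\mathbf{Poly}(\mathcal{E},\otimes)$ is biequivalent, via the canonical assignment $I\mapsto \mathcal{E}/I$, $(s,p,t)\mapsto \Sigma_t\boxtimes_p\Delta_s$, to the 2-category $\mathbf{PolyFun}(\mathcal{E},\otimes)$ of subcartesian polynomial functors and cartesian strong natural transformations. Moreover, under this biequivalence subcartesian 2-cells correspond to cartesian natural transformations (those whose naturality squares are all pullbacks).
   Context: **Locally subcartesian categories.** A commuting square $fg'=gf'$ on a cospan $f\colon A\to X$, $g\colon B\to X$ is subcartesian if the pair $(g',f')$ is jointly monic. A locally subcartesian category $(\mathcal{E},\otimes)$ is a category $\mathcal{E}$ with, for each cospan $f\colon A\to X$, $g\colon B\to X$, a chosen subcartesian square with apex $A\otimes_X B$ and projections $g'\colon A\otimes_X B\to A$, $f'\colon A\otimes_X B\to B$, subject to: (symmetry) there are isomorphisms $A\otimes_X B\cong B\otimes_X A$ commuting with the projections; (nullary) if $g$ is an identity then so is $g'$; (binary) for $p\colon W\to Y$, $q\colon Y\to Z$, $g\colon B\to Z$, with $g'\colon Y\otimes_Z B\to Y$, pasting the chosen square of $(p,g')$ with the chosen square of $(q,g)$ gives a square isomorphic, compatibly with the projections to $W$ and $B$, to the chosen square of $(qp,g)$. A commuting square is called a subpullback if it is isomorphic, compatibly with projections, to the chosen square of its cospan. **Base change.** For $f\colon X\to Y$: $\Sigma_f\colon\mathcal{E}/X\to\mathcal{E}/Y$ is composition with $f$; $\Delta_f$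 is pullback along $f$; $\nabla_f\colon\mathcal{E}/Y\to\mathcal{E}/X$ sends $h\colon H\to Y$ to the projection $X\otimes_Y H\to X$ and sends a morphism $u\colon h\to h_1$ to the unique morphism $X\otimes_Y H\to X\otimes_Y H_1$ over $X$ compatible with $u$ and the projections to $H,H_1$. There is a canonical inclusion $\nabla_f\Rightarrow\Delta_f$. Each slice $\mathcal{E}/X$ is monoidal with $g\otimes_X f=\Sigma_f\nabla_f(g)$ and unit $\mathrm{id}_X$. $(\mathcal{E},\otimes)$ is locally subcartesian closed if $\mathcal{E}$ has pullbacks and each of these monoidal structures is right closed (every $(-)\otimes_X f$ has a right adjoint); equivalently every $\nabla_p$ has a right adjoint, denoted $\boxtimes_p$. For a subpullback square $f'\colon C\to B$, $g'\colon C\to A$, $g\colon B\to T$, $f\colon A\to T$ there is a canonical isomorphism $\Delta_g\boxtimes_f\cong\boxtimes_{f'}\Delta_{g'}$, the mate of the isomorphism $\Sigma_{g'}\nabla_{f'}\cong\nabla_f\Sigma_g$ whose components commute with projections. **Distributivity subpullbacks.** For $f\colon A\to E$ and $p\colon E\to B$, a distributivity subpullback of $f$ along $p$ is a triple $(e\colon R\to A,\ p'\colon R\to D,\ d\colon D\to B)$ such that the square $p\circ(fe)=d\circ p'$ is a subpullback, and which is terminal among such triples: given $(h\colon L\to A, s\colon L\to M, v\colon M\to B)$ with $p\circ(fh)=v\circ s$ a subpullback, there are unique $x\colon L\to R$, $y\colon M\to D$ with $ex=h$, $dy=v$, $p'x=ys$. One has $d=\boxtimes_p(f)$. **$\mathbf{Poly}(\mathcal{E},\otimes)$.**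 Objects are those of $\mathcal{E}$. A 1-cell $I\to J$ is a diagram $(s,p,t)=(I\xleftarrow{s}E\xrightarrow{p}B\xrightarrow{t}J)$. A 2-cell $(s,p,t)\Rightarrow(u,q,v)$, where $I\xleftarrow{u}M\xrightarrow{q}N\xrightarrow{v}J$, is an isomorphism class (isomorphisms of the object $P$) of data $(P,\ j\colon P\to E,\ h\colon P\to M,\ k\colon B\to N)$ with $sj=uh$, $vk=t$, and such that $q\circ h=k\circ(pj)$ is a subpullback. It is a *subcartesian 2-cell* if $j$ is invertible. The vertical composite of $(P,j,h,k)$ followed by $(P_1,j_1,h_1,k_1)$ is $(P\otimes_M P_1,\ j\pi_1,\ h_1\pi_2,\ k_1k)$, using the chosen subpullback of $h$ and $j_1$. The composite of $(s,p,t)\colon I\to J$ with $(m,w,n)=(J\xleftarrow{m}X\xrightarrow{w}Y\xrightarrow{n}K)$ is formed as follows: let $S$ be the pullback of $t$ and $m$ with projections $m'\colon S\to B$, $t'\colon S\to X$; let $(e\colon T\to S,\ w'\colon T\to R,\ b\colon R\to Y)$ be the distributivity subpullback of $t'$ along $w$; let $A$ be the chosen subpullback of $p$ and $m'e$ with projections $a\colon A\to E$, $p'\colon A\to T$; the composite is $(sa,\,w'p',\,nb)$. Horizontal composition of 2-cells and coherence data are induced by the universal properties. Explicitly, write $R_2,T_2,A_2$ for the objects $R,T,A$ in the target composite. (i) Whiskering $(P,j,h,k)\colon(s,p,t)\Rightarrow(u,q,v)$ with $(m,w,n)$: $k$ induces $B\times_J X\to N\times_J X$ over $X$, hence by applying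 $\boxtimes_w$ a map $R\to R_2$; the new apex is $R\otimes_{R_2}A_2\cong T\otimes_B P$, with map $T\otimes_B j$ to $A=T\otimes_B E$ and projection to $A_2$. (ii) Whiskering $(s,p,t)$ with $(P,j,h,k)\colon(m,w,n)\Rightarrow(m_2,w_2,n_2)$, where $wj\colon P\to Y$ is the subpullback of $w_2$ along $k$: the map $R\to R_2$ over $k$ is the one corresponding to $\boxtimes_w\Delta_m(t)\to\boxtimes_{wj}\Delta_{mj}(t)=\boxtimes_{wj}\Delta_{m_2h}(t)\cong\Delta_k\boxtimes_{w_2}\Delta_{m_2}(t)$, whose first map is induced by the unit $1\Rightarrow\boxtimes_j\nabla_j$ and the inclusion $\nabla_j\Rightarrow\Delta_j$; the new apex is $R\otimes_{R_2}A_2\cong(R\otimes_Y P)\otimes_B E$, mapping to $A=T\otimes_B E$ via $R\otimes_Y P\to R\otimes_Y X\cong T$, and projecting to $A_2$. **Canonical pseudofunctor on 2-cells.** A 2-cell $(P,j,h,k)\colon(s,p,t)\Rightarrow(u,q,v)$, with $w=pj$, is sent to $$\Sigma_t\boxtimes_p\Delta_s\Rightarrow\Sigma_t\boxtimes_p\boxtimes_j\nabla_j\Delta_s\Rightarrow\Sigma_t\boxtimes_p\boxtimes_j\Delta_j\Delta_s\cong\Sigma_t\boxtimes_w\Delta_h\Delta_u\cong\Sigma_v\Sigma_k\Delta_k\boxtimes_q\Delta_u\Rightarrow\Sigma_v\boxtimes_q\Delta_u,$$ using the unit of $\nabla_j\dashv\boxtimes_j$, the inclusion, the isomorphism $\boxtimes_w\Delta_h\cong\Delta_k\boxtimes_q$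 for the subpullback, and the counit of $\Sigma_k\dashv\Delta_k$. **Strengths.** For $K\in\mathcal{E}$ and $a\colon A\to X$, let $K\times a:=(K\times A\to A\xrightarrow{a}X)$ and $K\circledast a:=(K\otimes_{\mathbf 1}A\to A\xrightarrow{a}X)$ in $\mathcal{E}/X$. A cartesian (respectively subcartesian) strength on $F\colon\mathcal{E}/X\to\mathcal{E}/Y$ is a family $K\times F(a)\to F(K\times a)$ (respectively $K\circledast F(a)\to F(K\circledast a)$), natural in $K$ and $a$ and respecting the left unitor and associator of $(\mathcal{E},\times,\mathbf 1)$ (respectively $(\mathcal{E},\otimes_{\mathbf 1},\mathbf 1)$). A transformation $\alpha\colon F\Rightarrow G$ is *cartesian strong* if it commutes with the cartesian strengths, i.e. $\alpha_{K\times a}\circ \mathrm{st}^F_{K,a}=\mathrm{st}^G_{K,a}\circ(K\times\alpha_a)$ for all $K,a$. (This is different from being a cartesian natural transformation.) A functor is *bunched strong* when it carries both strengths. The canonical strengths of $\Sigma_p$ and the cartesian strength of $\Delta_p$ are the canonical isomorphisms; the subcartesian strength of $\Delta_p$ ($p\colon E\to B$) at $c\colon C\to B$ is the map $K\otimes_{\mathbf 1}(E\times_B C)\to E\times_B(K\otimes_{\mathbf 1}C)$ induced by the projections; the cartesian strength of $\boxtimes_p$ at $f$ is the adjunct of $\nabla_p(K\times\boxtimes_p f)\to K\times\nabla_p\boxtimes_p f\to K\times f$ (projections, then counit), and the subcartesian strength is the adjunct of $\nabla_p(K\circledast\boxtimes_p f)\cong K\circledast\nabla_p\boxtimes_p f\to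 K\circledast f$. Composites $\Sigma_t\boxtimes_p\Delta_s$ carry the composite strengths. **$\mathbf{PolyFun}(\mathcal{E},\otimes)$.** A *subcartesian polynomial functor* is a functor $\mathcal{E}/I\to\mathcal{E}/J$ which is bunched strong and isomorphic, via a cartesian strong transformation, to a functor $\Sigma_t\boxtimes_p\Delta_s$ for some $I\xleftarrow{s}E\xrightarrow{p}B\xrightarrow{t}J$. $\mathbf{PolyFun}(\mathcal{E},\otimes)$ is the 2-category whose objects are the slice categories $\mathcal{E}/I$ ($I\in\mathcal{E}$), whose 1-cells are subcartesian polynomial functors, and whose 2-cells are cartesian strong natural transformations. *)

(* Defs.v *)
From Stdlib Require Import ssreflect ssrfun ProofIrrelevance IndefiniteDescription.
Set Implicit Arguments.
Unset Strict Implicit.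
Unset Printing Implicit Defensive.

Declare Scope cat_scope.
Open Scope cat_scope.

Record Category := {
  Ob :> Type;
  Hom : Ob -> Ob -> Type;
  idm : forall A, Hom A A;
  comp : forall A B C, Hom B C -> Hom A B -> Hom A C;
  compA : forall A B C D (h : Hom C D) (g : Hom B C) (f : Hom A B),
    comp h (comp g f) = comp (comp h g) f;
  comp1m : forall A B (f : Hom A B), comp (idm B) f = f;
  compm1 : forall A B (f : Hom A B), comp f (idm A) = f }.

Arguments idm {c} A.
Notation "A ~> B" := (Hom A B) (at level 90, right associativity) : cat_scope.
Notation "g ∘ f" := (comp g f) (at level 40, left associativity) : cat_scope.

Definition is_iso (C : Category) (A B : C) (f : A ~> B) : Prop :=
  exists g : B ~> A, g ∘ f = idm A /\ f ∘ g = idm B.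

(* [is_identity f] also asserts that source and target are the same object. *)
Inductive is_identity (C : Category) : forall A B : C, (A ~> B) -> Prop :=
  IsIdentity (A : C) : is_identity (idm A).

Definition is_pullback (C : Category) (P A B X : C)
    (a : P ~> A) (b : P ~> B) (f : A ~> X) (g : B ~> X) : Prop :=
  f ∘ a = g ∘ b /\
  forall (Z : C) (z1 : Z ~> A) (z2 : Z ~> B), f ∘ z1 = g ∘ z2 ->
    exists! u : Z ~> P, a ∘ u = z1 /\ b ∘ u = z2.

Record Functor (C D : Category) := {
  fobj :> C -> D;
  fmap : forall A B : C, (A ~> B) -> (fobj A ~> fobj B);
  fmap_id : forall A : C, fmap (idm A) = idm (fobj A);
  fmap_comp : forall (A B X : C) (g : B ~> X) (f : A ~> B),
    fmap (g ∘ f) = fmap g ∘ fmap f }.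

Arguments fmap {C D} _ {A B} _.

Program Definition id_functor (C : Category) : Functor C C :=
  {| fobj := fun A => A; fmap := fun A B f => f |}.

Program Definition comp_functor (C D K : Category)
    (G : Functor D K) (F : Functor C D) : Functor C K :=
  {| fobj := fun A => G (F A); fmap := fun A B f => fmap G (fmap F f) |}.
Next Obligation. by rewrite !fmap_id. Qed.
Next Obligation. by rewrite !fmap_comp. Qed.

Record RightAdjoint (C D : Category) (F : Functor C D) := {
  radj :> Functor D C;
  aunit : forall c : C, c ~> radj (F c);
  acounit : forall d : D, F (radj d) ~> d;
  aunit_nat : forall (c c' : C) (h : c ~> c'),
    fmap radj (fmap F h) ∘ aunit c = aunit c' ∘ h;
  acounit_nat : forall (d d' : D) (h : d ~> d'),
    acounit d' ∘ fmap F (fmap radj h) = h ∘ acounit d;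
  adj_tri1 : forall c : C, acounit (F c) ∘ fmap F (aunit c) = idm (F c);
  adj_tri2 : forall d : D, fmap radj (acounit d) ∘ aunit (radj d) = idm (radj d) }.

Definition adjunct (C D : Category) (F : Functor C D) (R : RightAdjoint F)
    (c : C) (d : D) (h : F c ~> d) : c ~> R d :=
  fmap R h ∘ aunit R c.

Lemma counit_adjunct (C D : Category) (F : Functor C D) (R : RightAdjoint F)
    (c : C) (d : D) (h : F c ~> d) :
  acounit R d ∘ fmap F (adjunct R h) = h.
Proof.
by rewrite /adjunct fmap_comp compA acounit_nat -compA adj_tri1 compm1.
Qed.

Lemma adjunct_counit (C D : Category) (F : Functor C D) (R : RightAdjoint F)
    (c : C) (d : D) (v : c ~> R d) :
  adjunct R (acounit R d ∘ fmap F v) = v.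
Proof.
by rewrite /adjunct fmap_comp -compA aunit_nat compA adj_tri2 comp1m.
Qed.

Lemma radj_ext (C D : Category) (F : Functor C D) (R : RightAdjoint F)
    (c : C) (d : D) (v w : c ~> R d) :
  acounit R d ∘ fmap F v = acounit R d ∘ fmap F w -> v = w.
Proof. by move=> e; rewrite -(adjunct_counit v) e adjunct_counit. Qed.

Lemma right_adjoint_of_universal (C D : Category) (F : Functor C D)
    (G : D -> C) (eps : forall d, F (G d) ~> d)
    (univ : forall (d : D) (c : C) (h : F c ~> d),
      exists! v : c ~> G d, eps d ∘ fmap F v = h) :
  inhabited (RightAdjoint F).
Proof.
have adj d c (h : F c ~> d) : {v : c ~> G d | eps d ∘ fmap F v = h}.
  apply: constructive_indefinite_description.
  by have [v [ev _]] := univ d c h; exists v.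
have ext d c (v w : c ~> G d) : eps d ∘ fmap F v = eps d ∘ fmap F w -> v = w.
  move=> e; have [x [_ ux]] := univ d c (eps d ∘ fmap F w).
  by rewrite -(ux v e) -(ux w erefl).
pose gm d d' (h : d ~> d') := sval (adj d' (G d) (h ∘ eps d)).
have gmE d d' (h : d ~> d') : eps d' ∘ fmap F (gm d d' h) = h ∘ eps d.
  by rewrite /gm; case: (adj _ _ _).
have gid d : gm d d (idm d) = idm (G d).
  by apply: ext; rewrite gmE fmap_id comp1m compm1.
have gco d d' d'' (h : d' ~> d'') (k : d ~> d') :
    gm d d'' (h ∘ k) = gm d' d'' h ∘ gm d d' k.
  by apply: ext; rewrite gmE fmap_comp compA gmE -!compA gmE.
pose eta c := sval (adj (F c) c (idm _)).
have etaE c : eps (F c) ∘ fmap F (eta c) = idm _.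
  by rewrite /eta; case: (adj _ _ _).
constructor.
apply: (@Build_RightAdjoint C D F (Build_Functor gid gco) eta eps) => /=.
- move=> c c' h; apply: ext.
  by rewrite !fmap_comp !compA gmE etaE -compA etaE comp1m compm1.
- by [].
- by [].
- move=> d; apply: ext.
  by rewrite fmap_comp compA gmE -compA etaE fmap_id.
Qed.

Record Pullbacks (C : Category) := {
  pb : forall A B X : C, (A ~> X) -> (B ~> X) -> C;
  pb1 : forall (A B X : C) (f : A ~> X) (g : B ~> X), pb f g ~> A;
  pb2 : forall (A B X : C) (f : A ~> X) (g : B ~> X), pb f g ~> B;
  pb_is_pullback : forall (A B X : C) (f : A ~> X) (g : B ~> X),
    is_pullback (pb1 f g) (pb2 f g) f g }.

Record Terminal (C : Category) := {
  one : C;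
  bang : forall A : C, A ~> one;
  bang_unique : forall (A : C) (f : A ~> one), f = bang A }.

Record SliceOb (C : Category) (X : C) := MkSlice { dom : C; arr : dom ~> X }.

Record SliceHom (C : Category) (X : C) (a b : SliceOb X) := MkSliceHom {
  shom : dom a ~> dom b;
  shom_arr : arr b ∘ shom = arr a }.

Lemma slice_hom_eq (C : Category) (X : C) (a b : SliceOb X) (u v : SliceHom a b) :
  shom u = shom v -> u = v.
Proof.
by case: u v => [u eu] [v ev] /= e; subst v; congr MkSliceHom; apply: proof_irrelevance.
Qed.

Program Canonical slice (C : Category) (X : C) : Category := {|
  Ob := SliceOb X;
  Hom := @SliceHom C X;
  idm := fun a => @MkSliceHom C X a a (idm (dom a)) _;
  comp := fun a b c (v : SliceHom b c) (u : SliceHom a b) =>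
    @MkSliceHom C X a c (shom v ∘ shom u) _ |}.
Next Obligation. by rewrite compm1. Qed.
Next Obligation. by rewrite compA !shom_arr. Qed.
Next Obligation. by apply: slice_hom_eq; rewrite /= compA. Qed.
Next Obligation. by apply: slice_hom_eq; rewrite /= comp1m. Qed.
Next Obligation. by apply: slice_hom_eq; rewrite /= compm1. Qed.

Program Definition Sigma (C : Category) (X Y : C) (f : X ~> Y) :
    Functor (slice X) (slice Y) := {|
  fobj := fun a => MkSlice (f ∘ arr a);
  fmap := fun a b (u : SliceHom a b) =>
    @MkSliceHom C Y (MkSlice (f ∘ arr a)) (MkSlice (f ∘ arr b)) (shom u) _ |}.
Next Obligation. by rewrite -compA shom_arr. Qed.
Next Obligation. exact: slice_hom_eq. Qed.
Next Obligation. exact: slice_hom_eq. Qed.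

Section PullbackFunctor.
Variables (C : Category) (PB : Pullbacks C).

Lemma pb_comm (A B X : C) (f : A ~> X) (g : B ~> X) :
  f ∘ pb1 PB f g = g ∘ pb2 PB f g.
Proof. by case: (pb_is_pullback PB f g). Qed.

Definition pb_lift_sig (A B X : C) (f : A ~> X) (g : B ~> X)
    (Z : C) (z1 : Z ~> A) (z2 : Z ~> B) (e : f ∘ z1 = g ∘ z2) :
  {u : Z ~> pb PB f g | pb1 PB f g ∘ u = z1 /\ pb2 PB f g ∘ u = z2}.
Proof.
apply: constructive_indefinite_description.
by case: (pb_is_pullback PB f g) => _ /(_ Z z1 z2 e) [u [eu _]]; exists u.
Qed.

Definition pb_lift (A B X : C) (f : A ~> X) (g : B ~> X)
    (Z : C) (z1 : Z ~> A) (z2 : Z ~> B) (e : f ∘ z1 = g ∘ z2) : Z ~> pb PB f g :=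
  sval (pb_lift_sig e).

Lemma pb_lift1 (A B X : C) (f : A ~> X) (g : B ~> X)
    (Z : C) (z1 : Z ~> A) (z2 : Z ~> B) (e : f ∘ z1 = g ∘ z2) :
  pb1 PB f g ∘ pb_lift e = z1.
Proof. by rewrite /pb_lift; case: (pb_lift_sig e) => u []. Qed.

Lemma pb_lift2 (A B X : C) (f : A ~> X) (g : B ~> X)
    (Z : C) (z1 : Z ~> A) (z2 : Z ~> B) (e : f ∘ z1 = g ∘ z2) :
  pb2 PB f g ∘ pb_lift e = z2.
Proof. by rewrite /pb_lift; case: (pb_lift_sig e) => u []. Qed.

Lemma pb_ext (A B X : C) (f : A ~> X) (g : B ~> X) (Z : C) (u v : Z ~> pb PB f g) :
  pb1 PB f g ∘ u = pb1 PB f g ∘ v -> pb2 PB f g ∘ u = pb2 PB f g ∘ v -> u = v.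
Proof.
move=> e1 e2; have [c /(_ Z (pb1 PB f g ∘ v) (pb2 PB f g ∘ v))] := pb_is_pullback PB f g.
case; first by rewrite !compA c.
by move=> w [_ uw]; rewrite -(uw u) ?(uw v).
Qed.

Program Definition Delta (X Y : C) (f : X ~> Y) : Functor (slice Y) (slice X) := {|
  fobj := fun h => MkSlice (pb1 PB f (arr h));
  fmap := fun h k (u : SliceHom h k) =>
    @MkSliceHom C X (MkSlice (pb1 PB f (arr h))) (MkSlice (pb1 PB f (arr k)))
      (@pb_lift _ _ _ f (arr k) _ (pb1 PB f (arr h)) (shom u ∘ pb2 PB f (arr h)) _) _ |}.
Next Obligation. by rewrite compA shom_arr pb_comm. Qed.
Next Obligation. by rewrite pb_lift1. Qed.
Next Obligation.
by apply: slice_hom_eq; apply: pb_ext => /=; rewrite ?pb_lift1 ?pb_lift2 ?compm1 ?comp1m.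
Qed.
Next Obligation.
by apply: slice_hom_eq; apply: pb_ext => /=; rewrite ?compA ?pb_lift1 ?pb_lift2 -?compA ?pb_lift2.
Qed.

End PullbackFunctor.

(* [ten f g] is the apex of the chosen square of the cospan (f, g).  In
   [ten_binary], [ten1 q g] is the projection along which the chosen squares are
   pasted. *)
Record LocallySubcartesian (C : Category) := {
  ten : forall A B X : C, (A ~> X) -> (B ~> X) -> C;
  ten1 : forall (A B X : C) (f : A ~> X) (g : B ~> X), ten f g ~> A;
  ten2 : forall (A B X : C) (f : A ~> X) (g : B ~> X), ten f g ~> B;
  ten_comm : forall (A B X : C) (f : A ~> X) (g : B ~> X),
    f ∘ ten1 f g = g ∘ ten2 f g;
  ten_monic : forall (A B X : C) (f : A ~> X) (g : B ~> X) (Z : C) (u v : Z ~> ten f g),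
    ten1 f g ∘ u = ten1 f g ∘ v -> ten2 f g ∘ u = ten2 f g ∘ v -> u = v;
  ten_symmetry : forall (A B X : C) (f : A ~> X) (g : B ~> X),
    exists i : ten f g ~> ten g f,
      is_iso i /\ ten2 g f ∘ i = ten1 f g /\ ten1 g f ∘ i = ten2 f g;
  ten_nullary : forall (A B X : C) (f : A ~> X) (g : B ~> X),
    is_identity g -> is_identity (ten1 f g);
  ten_binary : forall (W Y Z B : C) (p : W ~> Y) (q : Y ~> Z) (g : B ~> Z),
    exists i : ten p (ten1 q g) ~> ten (q ∘ p) g,
      is_iso i /\
      ten1 (q ∘ p) g ∘ i = ten1 p (ten1 q g) /\
      ten2 (q ∘ p) g ∘ i = ten2 q g ∘ ten2 p (ten1 q g) }.

Section Subcartesian.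
Variables (C : Category) (L : LocallySubcartesian C).

(* The square f ∘ a = g ∘ b is a subpullback. *)
Definition is_subpullback (P A B X : C)
    (f : A ~> X) (g : B ~> X) (a : P ~> A) (b : P ~> B) : Prop :=
  exists i : P ~> ten L f g, is_iso i /\ ten1 L f g ∘ i = a /\ ten2 L f g ∘ i = b.

(* The pair (z1, z2) factors, necessarily uniquely, through the chosen square. *)
Definition sep (A B X : C) (f : A ~> X) (g : B ~> X)
    (Z : C) (z1 : Z ~> A) (z2 : Z ~> B) : Prop :=
  exists u : Z ~> ten L f g, ten1 L f g ∘ u = z1 /\ ten2 L f g ∘ u = z2.

Definition ten_lift_sig (A B X : C) (f : A ~> X) (g : B ~> X)
    (Z : C) (z1 : Z ~> A) (z2 : Z ~> B) (H : sep f g z1 z2) :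
  {u : Z ~> ten L f g | ten1 L f g ∘ u = z1 /\ ten2 L f g ∘ u = z2}.
Proof. exact: constructive_indefinite_description. Qed.

Definition ten_lift (A B X : C) (f : A ~> X) (g : B ~> X)
    (Z : C) (z1 : Z ~> A) (z2 : Z ~> B) (H : sep f g z1 z2) : Z ~> ten L f g :=
  sval (ten_lift_sig H).

Lemma ten_lift1 (A B X : C) (f : A ~> X) (g : B ~> X)
    (Z : C) (z1 : Z ~> A) (z2 : Z ~> B) (H : sep f g z1 z2) :
  ten1 L f g ∘ ten_lift H = z1.
Proof. by rewrite /ten_lift; case: (ten_lift_sig H) => u []. Qed.

Lemma ten_lift2 (A B X : C) (f : A ~> X) (g : B ~> X)
    (Z : C) (z1 : Z ~> A) (z2 : Z ~> B) (H : sep f g z1 z2) :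
  ten2 L f g ∘ ten_lift H = z2.
Proof. by rewrite /ten_lift; case: (ten_lift_sig H) => u []. Qed.

Lemma sep_ten (A B X : C) (f : A ~> X) (g : B ~> X) (Z : C) (u : Z ~> ten L f g) :
  sep f g (ten1 L f g ∘ u) (ten2 L f g ∘ u).
Proof. by exists u. Qed.

Lemma sep_ten0 (A B X : C) (f : A ~> X) (g : B ~> X) :
  sep f g (ten1 L f g) (ten2 L f g).
Proof. by exists (idm _); rewrite !compm1. Qed.

Lemma sep_eq (A B X : C) (f : A ~> X) (g : B ~> X) (Z : C) (z1 : Z ~> A) (z2 : Z ~> B) :
  sep f g z1 z2 -> f ∘ z1 = g ∘ z2.
Proof. by case=> u [<- <-]; rewrite !compA ten_comm. Qed.

Lemma sep_pre (A B X : C) (f : A ~> X) (g : B ~> X) (Z W : C)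
    (z1 : Z ~> A) (z2 : Z ~> B) (w : W ~> Z) :
  sep f g z1 z2 -> sep f g (z1 ∘ w) (z2 ∘ w).
Proof. by case=> u [<- <-]; exists (u ∘ w); rewrite !compA. Qed.

Lemma sep_sym (A B X : C) (f : A ~> X) (g : B ~> X) (Z : C) (z1 : Z ~> A) (z2 : Z ~> B) :
  sep f g z1 z2 -> sep g f z2 z1.
Proof.
case=> u [<- <-]; have [i [_ [e1 e2]]] := ten_symmetry L f g.
by exists (i ∘ u); rewrite !compA e1 e2.
Qed.

Lemma identity_iso (A B : C) (f : A ~> B) : is_identity f -> is_iso f.
Proof. by case=> D; exists (idm D); rewrite comp1m. Qed.

Lemma sep_id (A X : C) (f : A ~> X) (Z : C) (z : Z ~> A) :
  sep f (idm X) z (f ∘ z).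
Proof.
have /identity_iso [i [_ e]] := ten_nullary L f (IsIdentity X).
exists (i ∘ z); rewrite !compA e comp1m; split=> //.
by rewrite -(comp1m (ten2 _ _ _)) -ten_comm -(compA _ _ i) e compm1.
Qed.

Lemma sep_bin (W Y X B : C) (p : W ~> Y) (q : Y ~> X) (g : B ~> X)
    (Z : C) (w : Z ~> W) (b : Z ~> B) :
  sep (q ∘ p) g w b ->
  exists u : Z ~> ten L q g,
    ten1 L q g ∘ u = p ∘ w /\ ten2 L q g ∘ u = b /\ sep p (ten1 L q g) w u.
Proof.
case=> v [<- <-]; have [i [[j [ji ij]] [e1 e2]]] := ten_binary L p q g.
exists (ten2 L p (ten1 L q g) ∘ (j ∘ v)); split; [|split].
- by rewrite compA -ten_comm -compA (compA _ j) -e1 -(compA _ i j) ij compm1.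
- by rewrite !compA -e2 -(compA _ i j) ij compm1.
- exists (j ∘ v); split=> //.
  by rewrite !compA -e1 -(compA _ i j) ij compm1.
Qed.

Lemma sep_bin_inv (W Y X B : C) (p : W ~> Y) (q : Y ~> X) (g : B ~> X)
    (Z : C) (w : Z ~> W) (u : Z ~> ten L q g) :
  sep p (ten1 L q g) w u -> sep (q ∘ p) g w (ten2 L q g ∘ u).
Proof.
case=> v [<- <-]; have [i [_ [e1 e2]]] := ten_binary L p q g.
by exists (i ∘ v); rewrite !compA e1 e2.
Qed.

Lemma sep_post1 (W Y X B : C) (p : W ~> Y) (q : Y ~> X) (g : B ~> X)
    (Z : C) (w : Z ~> W) (b : Z ~> B) :
  sep (q ∘ p) g w b -> sep q g (p ∘ w) b.
Proof. by move=> /sep_bin [u [<- [<- _]]]; apply: sep_ten. Qed.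

Lemma sep_post2 (W Y X B : C) (p : W ~> Y) (q : Y ~> X) (g : B ~> X)
    (Z : C) (b : Z ~> B) (w : Z ~> W) :
  sep g (q ∘ p) b w -> sep g q b (p ∘ w).
Proof. by move=> /sep_sym /sep_post1 /sep_sym. Qed.

(* The functor ∇_f; its action on u is the unique morphism over X compatible
   with u and the second projections. *)
Lemma nabla_map_sep (X Y : C) (f : X ~> Y) (h k : SliceOb Y) (u : SliceHom h k) :
  sep f (arr k) (ten1 L f (arr h)) (shom u ∘ ten2 L f (arr h)).
Proof. by apply: sep_post2; rewrite shom_arr; apply: sep_ten0. Qed.

Program Definition nabla (X Y : C) (f : X ~> Y) : Functor (slice Y) (slice X) := {|
  fobj := fun h => MkSlice (ten1 L f (arr h));
  fmap := fun h k (u : SliceHom h k) =>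
    @MkSliceHom C X (MkSlice (ten1 L f (arr h))) (MkSlice (ten1 L f (arr k)))
      (ten_lift (nabla_map_sep f u)) _ |}.
Next Obligation. by rewrite ten_lift1. Qed.
Next Obligation.
by apply: slice_hom_eq; apply: (@ten_monic _ L) => /=; rewrite ?ten_lift1 ?ten_lift2 ?compm1 ?comp1m.
Qed.
Next Obligation.
by apply: slice_hom_eq; apply: (@ten_monic _ L) => /=; rewrite ?compA ?ten_lift1 ?ten_lift2 -?compA ?ten_lift2.
Qed.

Definition tensor_right (X : C) (f : SliceOb X) : Functor (slice X) (slice X) :=
  comp_functor (Sigma (arr f)) (nabla (arr f)).

Definition right_closed : Prop :=
  forall (X : C) (f : SliceOb X), inhabited (RightAdjoint (tensor_right f)).

(* The inclusion of ∇_f in Δ_f. *)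
Program Definition nabla_delta (PB : Pullbacks C) (X Y : C) (f : X ~> Y) (h : SliceOb Y) :
    nabla f h ~> Delta PB f h :=
  @MkSliceHom C X (MkSlice (ten1 L f (arr h))) (MkSlice (pb1 PB f (arr h)))
    (pb_lift PB (ten_comm L f (arr h))) _.
Next Obligation. by rewrite pb_lift1. Qed.

End Subcartesian.

(* Right closedness yields the right adjoints of all the functors ∇_f. *)
Lemma nabla_right_adjoint (C : Category) (PB : Pullbacks C) (L : LocallySubcartesian C) :
  right_closed L ->
  forall (X Y : C) (f : X ~> Y), inhabited (RightAdjoint (nabla L f)).
Proof.
move=> cl Y X f; have [R] := cl X (MkSlice f).
pose fs : slice X := MkSlice f.
pose pr (y : SliceOb X) : tensor_right L fs y ~> fs :=
  @MkSliceHom C X (tensor_right L fs y) fs (ten1 L f (arr y)) erefl.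
pose tX : slice X := MkSlice (idm X).
pose n : tX ~> R fs := adjunct R (pr tX).
pose toX (y : SliceOb X) : y ~> tX := @MkSliceHom C X y tX (arr y) (comp1m _).
have prn (y : SliceOb X) : acounit R fs ∘ fmap (tensor_right L fs) (n ∘ toX y) = pr y.
  rewrite fmap_comp compA counit_adjunct; apply: slice_hom_eq => /=.
  by rewrite ten_lift1.
pose ov (a : SliceOb Y) : (Sigma f a : slice X) ~> fs :=
  @MkSliceHom C X (Sigma f a) fs (arr a) erefl.
pose G (a : slice Y) : slice X :=
  MkSlice (arr (R (Sigma f a)) ∘ pb1 PB (shom (fmap R (ov a))) (shom n)).
pose pG (a : slice Y) : G a ~> R (Sigma f a) :=
  @MkSliceHom C X (G a) (R (Sigma f a)) (pb1 PB _ _) erefl.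
have pGe (a : slice Y) : fmap R (ov a) ∘ pG a = n ∘ toX (G a).
  apply: slice_hom_eq; rewrite /= pb_comm; congr comp.
  rewrite -(shom_arr (fmap R (ov a))) -compA pb_comm compA (shom_arr n).
  by rewrite /= comp1m.
have key (a : slice Y) (y : slice X) (v : y ~> R (Sigma f a)) :
   fmap R (ov a) ∘ v = n ∘ toX y <->
   arr a ∘ shom (acounit R (Sigma f a) ∘ fmap (tensor_right L fs) v) = ten1 L f (arr y).
  split=> [e | e].
    have := acounit_nat R (ov a) => /(f_equal (fun z => shom (z ∘ fmap (tensor_right L fs) v))).
    have := prn y; rewrite -e fmap_comp compA => /(f_equal (@shom _ _ _ _)) /=.
    by move=> -> e2; rewrite compA.
  apply: (@radj_ext _ _ _ R); rewrite prn fmap_comp compA acounit_nat.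
  by apply: slice_hom_eq => /=; rewrite -compA.
have epsP (a : slice Y) :
    arr a ∘ shom (acounit R (Sigma f a) ∘ fmap (tensor_right L fs) (pG a)) =
    arr (nabla L f (G a)) by apply/key.
pose eps (a : slice Y) : nabla L f (G a) ~> a := @MkSliceHom C Y (nabla L f (G a)) a _ (epsP a).
apply: (right_adjoint_of_universal (G := G) (eps := eps)) => a y h.
pose h' : tensor_right L fs y ~> Sigma f a := fmap (Sigma f) h.
pose v := adjunct R h'.
have ve : fmap R (ov a) ∘ v = n ∘ toX y.
  by apply/key; rewrite counit_adjunct /=; apply: (shom_arr h).
have ve' : shom (fmap R (ov a)) ∘ shom v = shom n ∘ arr y := f_equal (@shom _ _ _ _) ve.
have uP : arr (G a) ∘ pb_lift PB ve' = arr y.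
  by rewrite /= -compA pb_lift1 (shom_arr v).
pose u : y ~> G a := @MkSliceHom C X y (G a) _ uP.
have pu : pG a ∘ u = v by apply: slice_hom_eq; rewrite /= pb_lift1.
exists u; split.
  apply: slice_hom_eq => /=; have := counit_adjunct R h'.
  by rewrite -/v -pu fmap_comp compA => /(f_equal (@shom _ _ _ _)).
move=> u' eu'.
have e1 : pG a ∘ u = pG a ∘ u'.
  apply: (@radj_ext _ _ _ R); rewrite pu counit_adjunct fmap_comp compA.
  by apply: slice_hom_eq; rewrite /= -eu'.
apply: slice_hom_eq; apply: pb_ext; first exact: (f_equal (@shom _ _ _ _) e1).
have := f_equal (fun z => toX (G a) ∘ z) (erefl u).
have t2 (z : y ~> G a) : pb2 PB (shom (fmap R (ov a))) (shom n) ∘ shom z = arr y.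
  have := shom_arr z => /= <-; rewrite -(shom_arr (fmap R (ov a))) -!compA; rewrite (compA _ (pb1 _ _ _)).
  by rewrite pb_comm -compA compA (shom_arr n) /= comp1m.
by rewrite !t2.
Qed.

Section Comparison.
Variables (C : Category) (PB : Pullbacks C) (L : LocallySubcartesian C).
Variable box : forall (X Y : C) (f : X ~> Y), RightAdjoint (nabla L f).

Lemma sep_subpullback (P A B X : C) (f : A ~> X) (g : B ~> X) (a : P ~> A) (b : P ~> B) :
  is_subpullback L f g a b ->
  forall (Z : C) (z1 : Z ~> A) (z2 : Z ~> B), sep L f g z1 z2 ->
  exists v : Z ~> P, a ∘ v = z1 /\ b ∘ v = z2.
Proof.
move=> [i [[j [ji ij]] [<- <-]]] Z z1 z2 [u [<- <-]].
by exists (j ∘ u); rewrite -!compA !(compA i j) ij !comp1m.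
Qed.

Lemma is_subpullback_ten (A B X : C) (f : A ~> X) (g : B ~> X) :
  is_subpullback L f g (ten1 L f g) (ten2 L f g).
Proof.
by exists (idm _); rewrite !compm1; split=> //; exists (idm _); rewrite comp1m.
Qed.

(* For a subpullback square g ∘ f' = f ∘ g', the isomorphism
   ∇_f Σ_g ≅ Σ_g' ∇_f' whose components commute with the projections. *)
Lemma nabla_sigma_sep (T A B K : C) (f : A ~> T) (g : B ~> T) (g' : K ~> A) (f' : K ~> B)
    (H : is_subpullback L f g g' f') (y : SliceOb B) :
  {u : ten L f (g ∘ arr y) ~> ten L f' (arr y) |
    g' ∘ (ten1 L f' (arr y) ∘ u) = ten1 L f (g ∘ arr y) /\
    ten2 L f' (arr y) ∘ u = ten2 L f (g ∘ arr y)}.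
Proof.
apply: constructive_indefinite_description.
have /sep_sym /sep_bin [u [u1 [u2 us]]] := sep_ten0 L f (g ∘ arr y).
have [i [[j [ji ij]] [e1 e2]]] := H.
have [s [[s' [ss' s's]] [es1 es2]]] := ten_symmetry L g f.
have /sep_sym s1 := us.
have e : ten1 L g f = f' ∘ (j ∘ s).
  by rewrite -e2 -compA (compA i) ij comp1m es1.
rewrite e in s1; have /sep_post1 s2 := s1.
exists (ten_lift s2); rewrite ten_lift1 ten_lift2; split=> //.
by rewrite -e1 -!compA (compA i j) ij comp1m compA es2 u2.
Qed.

Program Definition nabla_sigma (T A B K : C)
    (f : A ~> T) (g : B ~> T) (g' : K ~> A) (f' : K ~> B)
    (H : is_subpullback L f g g' f') (y : SliceOb B) :
    nabla L f (Sigma g y) ~> Sigma g' (nabla L f' y) :=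
  @MkSliceHom C A (MkSlice (ten1 L f (g ∘ arr y))) (MkSlice (g' ∘ ten1 L f' (arr y)))
    (sval (nabla_sigma_sep H y)) _.
Next Obligation. by case: (nabla_sigma_sep H y) => u [] /= <- _; rewrite compA. Qed.

(* The transposition and the counit of Σ_g ⊣ Δ_g. *)
Program Definition sigma_delta_adjunct (A B : C) (g : A ~> B) (y : SliceOb A) (z : SliceOb B)
    (u : SliceHom (Sigma g y) z) : y ~> Delta PB g z :=
  @MkSliceHom C A y (MkSlice (pb1 PB g (arr z))) (@pb_lift _ PB _ _ _ g (arr z) _ (arr y) (shom u) _) _.
Next Obligation. by have := shom_arr u => /= ->. Qed.
Next Obligation. by rewrite pb_lift1. Qed.

Program Definition sigma_delta_counit (A B : C) (g : A ~> B) (z : SliceOb B) :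
    Sigma g (Delta PB g z) ~> z :=
  @MkSliceHom C B (MkSlice (g ∘ pb1 PB g (arr z))) z (pb2 PB g (arr z)) _.
Next Obligation. by rewrite pb_comm. Qed.

(* For a subpullback square, the isomorphism ⊠_f' Δ_g' ≅ Δ_g ⊠_f: the mate of
   [nabla_sigma], hence the inverse of the mate of Σ_g' ∇_f' ≅ ∇_f Σ_g. *)
Definition box_delta (T A B K : C)
    (f : A ~> T) (g : B ~> T) (g' : K ~> A) (f' : K ~> B)
    (H : is_subpullback L f g g' f') (x : slice A) :
    box f' (Delta PB g' x) ~> Delta PB g (box f x) :=
  sigma_delta_adjunct
    (adjunct (box f)
      (sigma_delta_counit g' x
       ∘ fmap (Sigma g') (acounit (box f') (Delta PB g' x))
       ∘ nabla_sigma H (box f' (Delta PB g' x)))).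

(* ∇_w ≅ ∇_j ∇_p for w = p ∘ j, in both directions. *)
Lemma nabla_comp_sep (X E B : C) (j : X ~> E) (p : E ~> B) (w : X ~> B) (e : w = p ∘ j)
    (y : SliceOb B) :
  {u : ten L w (arr y) ~> ten L j (ten1 L p (arr y)) |
    ten1 L j (ten1 L p (arr y)) ∘ u = ten1 L w (arr y) /\
    ten2 L p (arr y) ∘ (ten2 L j (ten1 L p (arr y)) ∘ u) = ten2 L w (arr y)}.
Proof.
apply: constructive_indefinite_description; subst w.
have /sep_bin [u [u1 [u2 us]]] := sep_ten0 L (p ∘ j) (arr y).
by exists (ten_lift us); rewrite ten_lift1 ten_lift2.
Qed.

Program Definition nabla_comp (X E B : C) (j : X ~> E) (p : E ~> B) (w : X ~> B)
    (e : w = p ∘ j) (y : SliceOb B) : nabla L w y ~> nabla L j (nabla L p y) :=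
  @MkSliceHom C X (MkSlice (ten1 L w (arr y))) (MkSlice (ten1 L j (ten1 L p (arr y))))
    (sval (nabla_comp_sep e y)) _.
Next Obligation. by case: (nabla_comp_sep _ y) => u []. Qed.

Lemma nabla_decomp_sep (X E B : C) (j : X ~> E) (p : E ~> B) (w : X ~> B) (e : w = p ∘ j)
    (y : SliceOb B) :
  sep L w (arr y) (ten1 L j (ten1 L p (arr y)))
    (ten2 L p (arr y) ∘ ten2 L j (ten1 L p (arr y))).
Proof. by subst w; apply: sep_bin_inv; apply: sep_ten0. Qed.

Program Definition nabla_decomp (X E B : C) (j : X ~> E) (p : E ~> B) (w : X ~> B)
    (e : w = p ∘ j) (y : SliceOb B) : nabla L j (nabla L p y) ~> nabla L w y :=
  @MkSliceHom C X (MkSlice (ten1 L j (ten1 L p (arr y)))) (MkSlice (ten1 L w (arr y)))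
    (ten_lift (nabla_decomp_sep e y)) _.
Next Obligation. by rewrite ten_lift1. Qed.

(* The mates ⊠_p ⊠_j ≅ ⊠_w. *)
Definition box_comp (X E B : C) (j : X ~> E) (p : E ~> B) (w : X ~> B)
    (e : w = p ∘ j) (x : slice X) : box p (box j x) ~> box w x :=
  adjunct (box w)
    (acounit (box j) x
     ∘ fmap (nabla L j) (acounit (box p) (box j x))
     ∘ nabla_comp e (box p (box j x))).

Definition box_decomp (X E B : C) (j : X ~> E) (p : E ~> B) (w : X ~> B)
    (e : w = p ∘ j) (x : slice X) : box w x ~> box p (box j x) :=
  adjunct (box p) (adjunct (box j) (acounit (box w) x ∘ nabla_decomp e (box w x))).

(* Δ_j Δ_s ≅ Δ_h Δ_u when s ∘ j = u ∘ h. *)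
Program Definition delta_square (I E M X : C) (s : E ~> I) (j : X ~> E) (u : M ~> I) (h : X ~> M)
    (e : s ∘ j = u ∘ h) (a : SliceOb I) :
    Delta PB j (Delta PB s a) ~> Delta PB h (Delta PB u a) :=
  @MkSliceHom C X (MkSlice (pb1 PB j (pb1 PB s (arr a)))) (MkSlice (pb1 PB h (pb1 PB u (arr a))))
    (@pb_lift _ PB _ _ _ h (pb1 PB u (arr a)) _
      (pb1 PB j (pb1 PB s (arr a)))
      (@pb_lift _ PB _ _ _ u (arr a) _
        (h ∘ pb1 PB j (pb1 PB s (arr a)))
        (pb2 PB s (arr a) ∘ pb2 PB j (pb1 PB s (arr a))) _) _) _.
Next Obligation. by rewrite compA -e -compA pb_comm compA pb_comm compA. Qed.
Next Obligation. by rewrite pb_lift1. Qed.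
Next Obligation. by rewrite pb_lift1. Qed.

Program Definition delta_decomp (I E X : C) (s : E ~> I) (j : X ~> E) (a : SliceOb I) :
    Delta PB (s ∘ j) a ~> Delta PB j (Delta PB s a) :=
  @MkSliceHom C X (MkSlice (pb1 PB (s ∘ j) (arr a))) (MkSlice (pb1 PB j (pb1 PB s (arr a))))
    (@pb_lift _ PB _ _ _ j (pb1 PB s (arr a)) _
      (pb1 PB (s ∘ j) (arr a))
      (@pb_lift _ PB _ _ _ s (arr a) _
        (j ∘ pb1 PB (s ∘ j) (arr a)) (pb2 PB (s ∘ j) (arr a)) _) _) _.
Next Obligation. by rewrite compA pb_comm. Qed.
Next Obligation. by rewrite pb_lift1. Qed.
Next Obligation. by rewrite pb_lift1. Qed.

(* Σ_t' Δ_m' ≅ Δ_m Σ_t for the chosen pullback of m and t. *)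
Program Definition sigma_delta_pb (X B J : C) (m : X ~> J) (t : B ~> J) (z : SliceOb B) :
    Sigma (pb1 PB m t) (Delta PB (pb2 PB m t) z) ~> Delta PB m (Sigma t z) :=
  @MkSliceHom C X (MkSlice (pb1 PB m t ∘ pb1 PB (pb2 PB m t) (arr z)))
    (MkSlice (pb1 PB m (t ∘ arr z)))
    (@pb_lift _ PB _ _ _ m (t ∘ arr z) _
      (pb1 PB m t ∘ pb1 PB (pb2 PB m t) (arr z)) (pb2 PB (pb2 PB m t) (arr z)) _) _.
Next Obligation. by rewrite compA pb_comm -!compA pb_comm. Qed.
Next Obligation. by rewrite pb_lift1. Qed.

Lemma nabla_unit_sep (X : C) (y : SliceOb X) : sep L (idm X) (arr y) (arr y) (idm (dom y)).
Proof. by apply: sep_sym; have := sep_id L (arr y) (idm _); rewrite compm1. Qed.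

Program Definition nabla_unit (X : C) (y : SliceOb X) : y ~> nabla L (idm X) y :=
  @MkSliceHom C X y (MkSlice (ten1 L (idm X) (arr y))) (ten_lift (nabla_unit_sep y)) _.
Next Obligation. by rewrite ten_lift1. Qed.

Definition is_distributivity_subpullback (A E B R D : C) (f : A ~> E) (p : E ~> B)
    (e : R ~> A) (p' : R ~> D) (d : D ~> B) : Prop :=
  is_subpullback L p d (f ∘ e) p' /\
  forall (K M : C) (h : K ~> A) (s : K ~> M) (v : M ~> B),
    is_subpullback L p v (f ∘ h) s ->
    exists! xy : (K ~> R) * (M ~> D),
      e ∘ xy.1 = h /\ d ∘ xy.2 = v /\ p' ∘ xy.1 = xy.2 ∘ s.

Definition dist_ob (S X Y : C) (f : S ~> X) (w : X ~> Y) : SliceOb Y := box w (MkSlice f).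

(* The chosen distributivity subpullback of f along w: its third leg is ⊠_w f
   and its first leg is the counit of ∇_w ⊣ ⊠_w. *)
Definition dist_third (S X Y : C) (f : S ~> X) (w : X ~> Y) : dom (dist_ob f w) ~> Y :=
  arr (dist_ob f w).

Definition dist_apex (S X Y : C) (f : S ~> X) (w : X ~> Y) : C :=
  ten L w (dist_third f w).

Definition dist_first (S X Y : C) (f : S ~> X) (w : X ~> Y) : dist_apex f w ~> S :=
  shom (acounit (box w) (MkSlice f)).

Definition dist_second (S X Y : C) (f : S ~> X) (w : X ~> Y) :
    dist_apex f w ~> dom (dist_ob f w) :=
  ten2 L w (dist_third f w).

Lemma dist_first_arr (S X Y : C) (f : S ~> X) (w : X ~> Y) :
  f ∘ dist_first f w = ten1 L w (dist_third f w).
Proof. exact: (shom_arr (acounit (box w) (MkSlice f))). Qed.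

Lemma dist_is_distributivity (S X Y : C) (f : S ~> X) (w : X ~> Y) :
  is_distributivity_subpullback f w (dist_first f w) (dist_second f w) (dist_third f w).
Proof.
split; first by rewrite dist_first_arr; apply: is_subpullback_ten.
move=> K M h s v [i [[j [ji ij]] [e1 e2]]].
have ha : f ∘ (h ∘ j) = ten1 L w v by rewrite compA -e1 -compA ij compm1.
pose u : nabla L w (MkSlice v) ~> MkSlice f :=
  @MkSliceHom C X (nabla L w (MkSlice v)) (MkSlice f) (h ∘ j) ha.
pose y := adjunct (box w) u.
have cy : dist_first f w ∘ shom (fmap (nabla L w) y) = h ∘ j.
  exact: (f_equal (@shom _ _ _ _) (counit_adjunct (box w) u)).
exists (shom (fmap (nabla L w) y) ∘ i, shom y); split=> /=.
  split; first by rewrite compA cy -compA ji compm1.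
  split; first exact: (shom_arr y).
  by rewrite -e2 (compA (dist_second f w)) ten_lift2 !compA.
move=> [x' y'] /= [ex [ey exy]].
pose ys : MkSlice v ~> box w (MkSlice f) := @MkSliceHom C Y (MkSlice v) (dist_ob f w) y' ey.
have ex' : x' = shom (fmap (nabla L w) ys) ∘ i.
  apply: (@ten_monic _ L); rewrite compA ?ten_lift1 ?ten_lift2.
    by rewrite e1 -ex compA dist_first_arr.
  by rewrite -compA e2.
have ysy : ys = y.
  apply: (@radj_ext _ _ _ (box w)); rewrite counit_adjunct; apply: slice_hom_eq.
  rewrite /= -ex ex' -!compA ij compm1; congr comp.
change ((shom (fmap (nabla L w) y) ∘ i, shom y) = (x', y')).
by rewrite -ysy -ex'.
Qed.

End Comparison.

(* A monoidal product on objects with jointly monic projections; the structure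
   maps are the ones commuting with projections, the left unitor is the second
   projection out of [munit ⊗ A], and [mnabla] compares K ⊗ - with the ∇_p.
   The two instances are × and ⊗_1 below. *)
Record ProjProduct (C : Category) (L : LocallySubcartesian C) := {
  mten : C -> C -> C;
  mp1 : forall K A : C, mten K A ~> K;
  mp2 : forall K A : C, mten K A ~> A;
  mp_monic : forall (K A Z : C) (u v : Z ~> mten K A),
    mp1 K A ∘ u = mp1 K A ∘ v -> mp2 K A ∘ u = mp2 K A ∘ v -> u = v;
  mmap : forall K K' A A' : C, (K ~> K') -> (A ~> A') -> (mten K A ~> mten K' A');
  mmap1 : forall (K K' A A' : C) (k : K ~> K') (u : A ~> A'),
    mp1 K' A' ∘ mmap k u = k ∘ mp1 K A;
  mmap2 : forall (K K' A A' : C) (k : K ~> K') (u : A ~> A'),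
    mp2 K' A' ∘ mmap k u = u ∘ mp2 K A;
  munit : C;
  massoc : forall K M A : C, mten (mten K M) A ~> mten K (mten M A);
  massoc1 : forall K M A : C,
    mp1 K (mten M A) ∘ massoc K M A = mp1 K M ∘ mp1 (mten K M) A;
  massoc2 : forall K M A : C,
    mp1 M A ∘ (mp2 K (mten M A) ∘ massoc K M A) = mp2 K M ∘ mp1 (mten K M) A;
  massoc3 : forall K M A : C,
    mp2 M A ∘ (mp2 K (mten M A) ∘ massoc K M A) = mp2 (mten K M) A;
  mnabla : forall (E B : C) (p : E ~> B) (K Y : C) (y : Y ~> B),
    ten L p (y ∘ mp2 K Y) ~> mten K (ten L p y);
  mnabla1 : forall (E B : C) (p : E ~> B) (K Y : C) (y : Y ~> B),
    mp1 K (ten L p y) ∘ mnabla p K y = mp1 K Y ∘ ten2 L p (y ∘ mp2 K Y);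
  mnabla2 : forall (E B : C) (p : E ~> B) (K Y : C) (y : Y ~> B),
    ten1 L p y ∘ (mp2 K (ten L p y) ∘ mnabla p K y) = ten1 L p (y ∘ mp2 K Y);
  mnabla3 : forall (E B : C) (p : E ~> B) (K Y : C) (y : Y ~> B),
    ten2 L p y ∘ (mp2 K (ten L p y) ∘ mnabla p K y) = mp2 K Y ∘ ten2 L p (y ∘ mp2 K Y) }.

Section Strengths.
Local Obligation Tactic := intros.
Variables (C : Category) (PB : Pullbacks C) (L : LocallySubcartesian C).
Variable box : forall (X Y : C) (f : X ~> Y), RightAdjoint (nabla L f).
Variable M : ProjProduct L.

Lemma pb_lift1r (A B X : C) (f : A ~> X) (g : B ~> X) (Z W : C)
    (z1 : Z ~> A) (z2 : Z ~> B) (e : f ∘ z1 = g ∘ z2) (x : W ~> Z) :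
  pb1 PB f g ∘ (pb_lift PB e ∘ x) = z1 ∘ x.
Proof. by rewrite compA pb_lift1. Qed.
Lemma pb_lift2r (A B X : C) (f : A ~> X) (g : B ~> X) (Z W : C)
    (z1 : Z ~> A) (z2 : Z ~> B) (e : f ∘ z1 = g ∘ z2) (x : W ~> Z) :
  pb2 PB f g ∘ (pb_lift PB e ∘ x) = z2 ∘ x.
Proof. by rewrite compA pb_lift2. Qed.
Lemma ten_lift1r (A B X : C) (f : A ~> X) (g : B ~> X) (Z W : C)
    (z1 : Z ~> A) (z2 : Z ~> B) (e : sep L f g z1 z2) (x : W ~> Z) :
  ten1 L f g ∘ (ten_lift e ∘ x) = z1 ∘ x.
Proof. by rewrite compA ten_lift1. Qed.
Lemma ten_lift2r (A B X : C) (f : A ~> X) (g : B ~> X) (Z W : C)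
    (z1 : Z ~> A) (z2 : Z ~> B) (e : sep L f g z1 z2) (x : W ~> Z) :
  ten2 L f g ∘ (ten_lift e ∘ x) = z2 ∘ x.
Proof. by rewrite compA ten_lift2. Qed.
Lemma mmap1r (K K' A A' W : C) (k : K ~> K') (u : A ~> A') (x : W ~> mten M K A) :
  mp1 M K' A' ∘ (mmap M k u ∘ x) = k ∘ (mp1 M K A ∘ x).
Proof. by rewrite compA mmap1 compA. Qed.
Lemma mmap2r (K K' A A' W : C) (k : K ~> K') (u : A ~> A') (x : W ~> mten M K A) :
  mp2 M K' A' ∘ (mmap M k u ∘ x) = u ∘ (mp2 M K A ∘ x).
Proof. by rewrite compA mmap2 compA. Qed.
Lemma massoc1r (K K' A W : C) (x : W ~> mten M (mten M K K') A) :
  mp1 M K (mten M K' A) ∘ (massoc M K K' A ∘ x) = mp1 M K K' ∘ (mp1 M (mten M K K') A ∘ x).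
Proof. by rewrite compA massoc1 compA. Qed.
Lemma massoc2r (K K' A W : C) (x : W ~> mten M (mten M K K') A) :
  mp1 M K' A ∘ (mp2 M K (mten M K' A) ∘ (massoc M K K' A ∘ x)) =
  mp2 M K K' ∘ (mp1 M (mten M K K') A ∘ x).
Proof. by have := f_equal (fun z => z ∘ x) (massoc2 M K K' A); rewrite -!compA. Qed.
Lemma massoc3r (K K' A W : C) (x : W ~> mten M (mten M K K') A) :
  mp2 M K' A ∘ (mp2 M K (mten M K' A) ∘ (massoc M K K' A ∘ x)) =
  mp2 M (mten M K K') A ∘ x.
Proof. by rewrite -massoc3 -!compA. Qed.
Lemma mnabla1r (E B : C) (p : E ~> B) (K Y : C) (y : Y ~> B) (W : C)
    (x : W ~> ten L p (y ∘ mp2 M K Y)) :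
  mp1 M K (ten L p y) ∘ (mnabla M p K y ∘ x) = mp1 M K Y ∘ (ten2 L p (y ∘ mp2 M K Y) ∘ x).
Proof. by rewrite compA mnabla1 compA. Qed.
Lemma mnabla2r (E B : C) (p : E ~> B) (K Y : C) (y : Y ~> B) (W : C)
    (x : W ~> ten L p (y ∘ mp2 M K Y)) :
  ten1 L p y ∘ (mp2 M K (ten L p y) ∘ (mnabla M p K y ∘ x)) = ten1 L p (y ∘ mp2 M K Y) ∘ x.
Proof. by rewrite -mnabla2 -!compA. Qed.
Lemma mnabla3r (E B : C) (p : E ~> B) (K Y : C) (y : Y ~> B) (W : C)
    (x : W ~> ten L p (y ∘ mp2 M K Y)) :
  ten2 L p y ∘ (mp2 M K (ten L p y) ∘ (mnabla M p K y ∘ x)) =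
  mp2 M K Y ∘ (ten2 L p (y ∘ mp2 M K Y) ∘ x).
Proof. by have := f_equal (fun z => z ∘ x) (mnabla3 M p K y); rewrite -!compA. Qed.

Definition projE := (pb_lift1r, pb_lift2r, ten_lift1r, ten_lift2r, mmap1r, mmap2r,
  massoc1r, massoc2r, massoc3r, mnabla1r, mnabla2r, mnabla3r,
  pb_lift1, pb_lift2, ten_lift1, ten_lift2, mmap1, mmap2, massoc1, massoc2, massoc3,
  mnabla1, mnabla2, mnabla3, comp1m, compm1).

(* K × a, respectively K ⊛ a: the composite of the second projection with a. *)
Definition act (X K : C) (a : SliceOb X) : slice X :=
  MkSlice (arr a ∘ mp2 M K (dom a)).

Program Definition act_map (X K K' : C) (k : K ~> K') (a b : SliceOb X) (u : SliceHom a b) :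
    act K a ~> act K' b :=
  @MkSliceHom C X (act K a) (act K' b) (mmap M k (shom u)) _.
Next Obligation. by rewrite -compA mmap2 compA shom_arr. Qed.

Definition act_unitor (X : C) (a : SliceOb X) : act (munit M) a ~> a :=
  @MkSliceHom C X (act (munit M) a) a (mp2 M (munit M) (dom a)) erefl.

Program Definition act_assoc (X K K' : C) (a : SliceOb X) :
    act (mten M K K') a ~> act K (act K' a) :=
  @MkSliceHom C X (act (mten M K K') a) (act K (act K' a)) (massoc M K K' (dom a)) _.
Next Obligation. by rewrite -!compA massoc3. Qed.

Lemma act_ext (X K : C) (a b : SliceOb X) (u v : SliceHom b (act K a)) :
  mp1 M K (dom a) ∘ shom u = mp1 M K (dom a) ∘ shom v ->
  mp2 M K (dom a) ∘ shom u = mp2 M K (dom a) ∘ shom v -> u = v.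
Proof. by move=> e1 e2; apply: slice_hom_eq; apply: (@mp_monic _ _ M). Qed.

Record Strength (X Y : C) (F : Functor (slice X) (slice Y)) := {
  st : forall (K : C) (a : slice X), act K (F a) ~> F (act K a);
  st_nat : forall (K K' : C) (k : K ~> K') (a b : slice X) (u : a ~> b),
    fmap F (act_map k u) ∘ st K a = st K' b ∘ act_map k (fmap F u);
  st_unitor : forall a : slice X,
    fmap F (act_unitor a) ∘ st (munit M) a = act_unitor (F a);
  st_assoc : forall (K K' : C) (a : slice X),
    fmap F (act_assoc K K' a) ∘ st (mten M K K') a =
    st K (act K' a) ∘ act_map (idm K) (st K' a) ∘ act_assoc K K' (F a) }.

Lemma act_map_comp (X K K' K'' : C) (k' : K' ~> K'') (k : K ~> K') (a b c : slice X)
    (v : b ~> c) (u : a ~> b) :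
  act_map k' v ∘ act_map k u = act_map (k' ∘ k) (v ∘ u).
Proof.
apply: act_ext; rewrite /=.
  by rewrite compA !mmap1 -compA mmap1 compA.
by rewrite compA !mmap2 -compA mmap2 compA.
Qed.

Lemma act_map_id (X K : C) (a : slice X) : act_map (idm K) (idm a) = idm (act K a).
Proof. by apply: act_ext; rewrite /= ?mmap1 ?mmap2 comp1m compm1. Qed.

Program Definition id_strength (X : C) : Strength (id_functor (slice X)) :=
  {| st := fun K a => @idm (slice X) (act K a) |}.
Next Obligation. by rewrite comp1m compm1. Qed.
Next Obligation. by rewrite compm1. Qed.
Next Obligation. by rewrite act_map_id !comp1m compm1. Qed.

Program Definition comp_strength (X Y Z : C)
    (G : Functor (slice Y) (slice Z)) (F : Functor (slice X) (slice Y))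
    (sG : Strength G) (sF : Strength F) : Strength (comp_functor G F) :=
  {| st := fun K a => fmap G (st sF K a) ∘ st sG K (F a) |}.
Next Obligation.
cbn [fmap comp_functor fobj].
by rewrite compA -fmap_comp st_nat fmap_comp -!compA st_nat.
Qed.
Next Obligation.
cbn [fmap comp_functor fobj].
by rewrite compA -fmap_comp st_unitor st_unitor.
Qed.
Next Obligation.
cbn [fmap comp_functor fobj].
rewrite compA -fmap_comp st_assoc !fmap_comp -!compA st_assoc !compA.
rewrite -[fmap G (st sF K (act K' a)) ∘ _ ∘ _]compA st_nat.
rewrite -[in RHS](comp1m (idm K)) -act_map_comp.
by rewrite !compA.
Qed.

Program Definition sigma_strength (X Y : C) (f : X ~> Y) : Strength (Sigma f) :=
  {| st := fun K a => @MkSliceHom C Y (act K (Sigma f a)) (Sigma f (act K a))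
                        (idm (mten M K (dom a))) _ |}.
Next Obligation. by rewrite compm1 /= compA. Qed.
Next Obligation. by apply: slice_hom_eq; rewrite /= compm1 comp1m. Qed.
Next Obligation. by apply: slice_hom_eq; rewrite /= compm1. Qed.
Next Obligation.
apply: slice_hom_eq; rewrite /= compm1 comp1m.
apply: (@mp_monic _ _ M); rewrite compA ?mmap1 ?mmap2 ?comp1m //.
Qed.

Program Definition delta_strength (X Y : C) (f : X ~> Y) : Strength (Delta PB f) :=
  {| st := fun K c => @MkSliceHom C X (act K (Delta PB f c)) (Delta PB f (act K c))
       (@pb_lift _ PB _ _ _ f (arr c ∘ mp2 M K (dom c)) _
          (pb1 PB f (arr c) ∘ mp2 M K (pb PB f (arr c)))
          (mmap M (idm K) (pb2 PB f (arr c))) _) _ |}.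
Next Obligation. by rewrite -compA mmap2 !compA pb_comm. Qed.
Next Obligation. by rewrite pb_lift1. Qed.
Next Obligation.
apply: slice_hom_eq; apply: pb_ext => /=.
  by rewrite !compA !pb_lift1 -!compA mmap2 !compA pb_lift1.
rewrite !compA !pb_lift2 -!compA pb_lift2.
by apply: (@mp_monic _ _ M); rewrite !compA ?mmap1 ?mmap2 -!compA ?mmap1 ?mmap2 ?compA
  ?pb_lift2 ?mmap1 ?mmap2 ?compm1 ?comp1m -?compA ?mmap1 ?mmap2 ?compA ?pb_lift2.
Qed.
Next Obligation.
apply: slice_hom_eq; apply: pb_ext => /=.
  by rewrite compA !pb_lift1.
by rewrite compA pb_lift2 -compA pb_lift2 mmap2.
Qed.
Next Obligation.
apply: slice_hom_eq; apply: pb_ext => /=; rewrite -[pb_lift PB _ ∘ _ ∘ _]compA !projE.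
  by rewrite -compA !projE -compA !projE.
by apply: (@mp_monic _ _ M); [|apply: (@mp_monic _ _ M)]; rewrite -?compA !projE.
Qed.

(* The comparison ∇_p (K · y) -> K · ∇_p y given by projections. *)
Definition act_nabla (E B : C) (p : E ~> B) (K : C) (y : SliceOb B) :
    nabla L p (act K y) ~> act K (nabla L p y) :=
  @MkSliceHom C E (nabla L p (act K y)) (act K (nabla L p y)) (mnabla M p K (arr y))
    (etrans (esym (compA _ _ _)) (mnabla2 M p K (arr y))).

Lemma act_nabla_nat (E B : C) (p : E ~> B) (K K' : C) (k : K ~> K') (y z : slice B)
    (u : y ~> z) :
  act_nabla p K' z ∘ fmap (nabla L p) (act_map k u) =
  act_map k (fmap (nabla L p) u) ∘ act_nabla p K y.
Proof.
apply: act_ext; rewrite /= ?projE //.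
by apply: (@ten_monic _ L); rewrite -?compA !projE // -compA !projE.
Qed.

Lemma act_assoc_nat (X K K' : C) (a b : slice X) (u : a ~> b) :
  act_assoc K K' b ∘ act_map (idm (mten M K K')) u =
  act_map (idm K) (act_map (idm K') u) ∘ act_assoc K K' a.
Proof.
by apply: act_ext; [|apply: (@mp_monic _ _ M)]; rewrite /= ?projE // -?compA ?projE.
Qed.

Lemma act_assoc_nabla (E B K K' : C) (p : E ~> B) (y : slice B) :
  act_assoc K K' (nabla L p y) ∘ act_nabla p (mten M K K') y =
  act_map (idm K) (act_nabla p K' y) ∘ (act_nabla p K (act K' y)
    ∘ fmap (nabla L p) (act_assoc K K' y)).
Proof.
apply: slice_hom_eq => /=.
apply: (@mp_monic _ _ M); [|apply: (@mp_monic _ _ M); [|apply: (@ten_monic _ L)]];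
  rewrite -?compA ?projE -?compA ?projE //.
Qed.

(* The adjunct of ∇_p (K · ⊠_p x) -> K · ∇_p ⊠_p x -> K · x. *)
Program Definition box_strength (E B : C) (p : E ~> B) : Strength (box p) :=
  {| st := fun K x =>
       adjunct (box p) (act_map (idm K) (acounit (box p) x) ∘ act_nabla p K (box p x)) |}.
Next Obligation.
cbv beta; apply: radj_ext.
rewrite fmap_comp compA acounit_nat -compA counit_adjunct.
rewrite fmap_comp [in RHS]compA counit_adjunct -[in RHS]compA act_nabla_nat.
by rewrite !compA !act_map_comp acounit_nat comp1m compm1.
Qed.
Next Obligation.
cbv beta; apply: radj_ext; rewrite fmap_comp compA acounit_nat -compA counit_adjunct.
apply: slice_hom_eq; rewrite /= !projE; congr comp.
by apply: (@ten_monic _ L); rewrite ?projE.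
Qed.
Next Obligation.
cbv beta; apply: radj_ext; rewrite fmap_comp compA acounit_nat -compA counit_adjunct.
rewrite 2!(fmap_comp (nabla L p)) 2!(compA (acounit _ _)) counit_adjunct.
rewrite -[act_map _ _ ∘ act_nabla _ _ _ ∘ _]compA act_nabla_nat [in RHS]compA act_map_comp
  counit_adjunct.
rewrite compA act_assoc_nat -compA act_assoc_nabla -act_map_comp.
by rewrite !compA.
Qed.

End Strengths.

Section Products.
Variables (C : Category) (PB : Pullbacks C) (T : Terminal C) (L : LocallySubcartesian C).

Lemma bang_ext (A : C) (f g : A ~> one T) : f = g.
Proof. by rewrite (bang_unique f) (bang_unique g). Qed.

Local Obligation Tactic := intros.

(* K × A, as the pullback over the terminal object. *)
Program Definition cartesian_product : ProjProduct L := {|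
  mten := fun K A => pb PB (bang T K) (bang T A);
  mp1 := fun K A => pb1 PB (bang T K) (bang T A);
  mp2 := fun K A => pb2 PB (bang T K) (bang T A);
  mmap := fun K K' A A' k u =>
    @pb_lift _ PB _ _ _ (bang T K') (bang T A') _
      (k ∘ pb1 PB (bang T K) (bang T A)) (u ∘ pb2 PB (bang T K) (bang T A)) (bang_ext _ _);
  munit := one T;
  massoc := fun K M A =>
    @pb_lift _ PB _ _ _ (bang T K) (bang T (pb PB (bang T M) (bang T A))) _
      (pb1 PB (bang T K) (bang T M) ∘ pb1 PB (bang T (pb PB (bang T K) (bang T M))) (bang T A))
      (@pb_lift _ PB _ _ _ (bang T M) (bang T A) _
        (pb2 PB (bang T K) (bang T M) ∘ pb1 PB (bang T (pb PB (bang T K) (bang T M))) (bang T A))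
        (pb2 PB (bang T (pb PB (bang T K) (bang T M))) (bang T A))
        (bang_ext _ _))
      (bang_ext _ _);
  mnabla := fun E B p K Y y =>
    @pb_lift _ PB _ _ _ (bang T K) (bang T (ten L p y)) _
      (pb1 PB (bang T K) (bang T Y) ∘ ten2 L p (y ∘ pb2 PB (bang T K) (bang T Y)))
      (@ten_lift _ L _ _ _ p y _
        (ten1 L p (y ∘ pb2 PB (bang T K) (bang T Y)))
        (pb2 PB (bang T K) (bang T Y) ∘ ten2 L p (y ∘ pb2 PB (bang T K) (bang T Y)))
        (sep_post2 (sep_ten0 L _ _)))
      (bang_ext _ _) |}.
Next Obligation. exact: pb_ext H H0. Qed.
Next Obligation. by rewrite pb_lift1. Qed.
Next Obligation. by rewrite pb_lift2. Qed.
Next Obligation. by rewrite pb_lift1. Qed.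
Next Obligation. by rewrite pb_lift2 pb_lift1. Qed.
Next Obligation. by rewrite pb_lift2 pb_lift2. Qed.
Next Obligation. by rewrite pb_lift1. Qed.
Next Obligation. by rewrite pb_lift2 ten_lift1. Qed.
Next Obligation. by rewrite pb_lift2 ten_lift2. Qed.

Lemma sub_map_sep (K K' A A' : C) (k : K ~> K') (u : A ~> A') :
  sep L (bang T K') (bang T A')
    (k ∘ ten1 L (bang T K) (bang T A)) (u ∘ ten2 L (bang T K) (bang T A)).
Proof.
apply: sep_post1; apply: sep_post2; rewrite (bang_ext (_ ∘ k) (bang T K)).
by rewrite (bang_ext (_ ∘ u) (bang T A)); apply: sep_ten0.
Qed.

Lemma sub_assoc_sep (K M A : C) :
  exists u : ten L (bang T (ten L (bang T K) (bang T M))) (bang T A) ~>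
             ten L (bang T M) (bang T A),
    ten1 L (bang T M) (bang T A) ∘ u =
      ten2 L (bang T K) (bang T M) ∘ ten1 L (bang T (ten L (bang T K) (bang T M))) (bang T A) /\
    ten2 L (bang T M) (bang T A) ∘ u =
      ten2 L (bang T (ten L (bang T K) (bang T M))) (bang T A) /\
    sep L (bang T K) (bang T (ten L (bang T M) (bang T A)))
      (ten1 L (bang T K) (bang T M) ∘ ten1 L (bang T (ten L (bang T K) (bang T M))) (bang T A)) u.
Proof.
have := sep_ten0 L (bang T (ten L (bang T K) (bang T M))) (bang T A).
rewrite -{1}(bang_ext (bang T M ∘ ten2 L (bang T K) (bang T M)) (bang T _)).
move=> /sep_bin [u [u1 [u2 us]]]; exists u; split=> //; split=> //.
have [s [_ [s1 s2]]] := ten_symmetry L (bang T K) (bang T M).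
rewrite -s2 in us; have /sep_post1 /sep_sym /sep_bin_inv := us.
rewrite compA s1 => /sep_sym; rewrite (bang_ext (bang T M ∘ _) (bang T _)) //.
Qed.

Definition sub_assoc_sig (K M A : C) := constructive_indefinite_description _ (sub_assoc_sep K M A).

Lemma sub_nabla_sep (E B : C) (p : E ~> B) (K Y : C) (y : Y ~> B) :
  exists u : ten L p (y ∘ ten2 L (bang T K) (bang T Y)) ~> ten L p y,
    ten1 L p y ∘ u = ten1 L p (y ∘ ten2 L (bang T K) (bang T Y)) /\
    ten2 L p y ∘ u = ten2 L (bang T K) (bang T Y)
      ∘ ten2 L p (y ∘ ten2 L (bang T K) (bang T Y)) /\
    sep L (bang T K) (bang T (ten L p y))
      (ten1 L (bang T K) (bang T Y) ∘ ten2 L p (y ∘ ten2 L (bang T K) (bang T Y))) u.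
Proof.
have /sep_sym /sep_bin [u [u1 [u2 us]]] := sep_ten0 L p (y ∘ ten2 L (bang T K) (bang T Y)).
have [s [_ [s1 s2]]] := ten_symmetry L y p.
exists (s ∘ u); rewrite !compA s1 s2; split=> //; split=> //.
have [r [_ [r1 r2]]] := ten_symmetry L (bang T K) (bang T Y).
have us' : sep L (ten1 L (bang T Y) (bang T K) ∘ r) (ten1 L y p)
    (ten2 L p (y ∘ ten2 L (bang T K) (bang T Y))) u by rewrite r2.
have /sep_post1 /sep_sym /sep_bin_inv := us'.
rewrite compA r1 => /sep_sym.
rewrite (bang_ext (bang T Y ∘ _) (bang T (ten L p y) ∘ s)) => /sep_post2 //.
Qed.

Definition sub_nabla_sig (E B : C) (p : E ~> B) (K Y : C) (y : Y ~> B) :=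
  constructive_indefinite_description _ (sub_nabla_sep p K y).

(* K ⊗_1 A *)
Program Definition subcartesian_product : ProjProduct L := {|
  mten := fun K A => ten L (bang T K) (bang T A);
  mp1 := fun K A => ten1 L (bang T K) (bang T A);
  mp2 := fun K A => ten2 L (bang T K) (bang T A);
  mmap := fun K K' A A' k u => ten_lift (sub_map_sep k u);
  munit := one T;
  massoc := fun K M A =>
    ten_lift (proj2 (proj2 (proj2_sig (sub_assoc_sig K M A))));
  mnabla := fun E B p K Y y =>
    ten_lift (proj2 (proj2 (proj2_sig (sub_nabla_sig p K y)))) |}.
Next Obligation. exact: ten_monic H H0. Qed.
Next Obligation. by rewrite ten_lift1. Qed.
Next Obligation. by rewrite ten_lift2. Qed.
Next Obligation. by rewrite ten_lift1. Qed.
Next Obligation. by rewrite ten_lift2; case: (sub_assoc_sig K M A) => u []. Qed.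
Next Obligation. by rewrite ten_lift2; case: (sub_assoc_sig K M A) => u [? []]. Qed.
Next Obligation. by rewrite ten_lift1. Qed.
Next Obligation. by rewrite ten_lift2; case: (sub_nabla_sig p K y) => u []. Qed.
Next Obligation. by rewrite ten_lift2; case: (sub_nabla_sig p K y) => u [? []]. Qed.

End Products.

(* The part of a bicategory preceding its 2-dimensional operations.  2-cells are
   considered up to the relation [eq2]. *)
Record Cells := {
  cell0 : Type;
  cell1 : cell0 -> cell0 -> Type;
  cell2 : forall I J : cell0, cell1 I J -> cell1 I J -> Type;
  eq2 : forall (I J : cell0) (f g : cell1 I J), cell2 f g -> cell2 f g -> Prop;
  id1 : forall I : cell0, cell1 I I;
  comp1 : forall I J K : cell0, cell1 J K -> cell1 I J -> cell1 I K }.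

Arguments id1 {c} I.
Notation "f ==> g" := (cell2 f g) (at level 90) : cat_scope.
Notation "α ≈ β" := (eq2 α β) (at level 70) : cat_scope.
Notation "g ⊙ f" := (comp1 g f) (at level 40, left associativity) : cat_scope.

(* [post g α] and [pre β f] are the whiskerings g α and β f; [associator f g h]
   goes from h (g f) to (h g) f. *)
Record Bicategory (B : Cells) := {
  id2 : forall (I J : cell0 B) (f : cell1 I J), f ==> f;
  vcomp : forall (I J : cell0 B) (f g h : cell1 I J), (g ==> h) -> (f ==> g) -> (f ==> h);
  post : forall (I J K : cell0 B) (g : cell1 J K) (f f' : cell1 I J),
    (f ==> f') -> (g ⊙ f ==> g ⊙ f');
  pre : forall (I J K : cell0 B) (g g' : cell1 J K),
    (g ==> g') -> forall f : cell1 I J, g ⊙ f ==> g' ⊙ f;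
  associator : forall (I J K M : cell0 B) (f : cell1 I J) (g : cell1 J K) (h : cell1 K M),
    h ⊙ (g ⊙ f) ==> h ⊙ g ⊙ f;
  associator_inv : forall (I J K M : cell0 B) (f : cell1 I J) (g : cell1 J K) (h : cell1 K M),
    h ⊙ g ⊙ f ==> h ⊙ (g ⊙ f);
  left_unitor : forall (I J : cell0 B) (f : cell1 I J), id1 J ⊙ f ==> f;
  left_unitor_inv : forall (I J : cell0 B) (f : cell1 I J), f ==> id1 J ⊙ f;
  right_unitor : forall (I J : cell0 B) (f : cell1 I J), f ⊙ id1 I ==> f;
  right_unitor_inv : forall (I J : cell0 B) (f : cell1 I J), f ==> f ⊙ id1 I;

  eq2_refl : forall (I J : cell0 B) (f g : cell1 I J) (a : f ==> g), a ≈ a;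
  eq2_sym : forall (I J : cell0 B) (f g : cell1 I J) (a b : f ==> g), a ≈ b -> b ≈ a;
  eq2_trans : forall (I J : cell0 B) (f g : cell1 I J) (a b c : f ==> g),
    a ≈ b -> b ≈ c -> a ≈ c;
  vcomp_eq2 : forall (I J : cell0 B) (f g h : cell1 I J) (b b' : g ==> h) (a a' : f ==> g),
    b ≈ b' -> a ≈ a' -> vcomp b a ≈ vcomp b' a';
  post_eq2 : forall (I J K : cell0 B) (g : cell1 J K) (f f' : cell1 I J) (a a' : f ==> f'),
    a ≈ a' -> post g a ≈ post g a';
  pre_eq2 : forall (I J K : cell0 B) (g g' : cell1 J K) (b b' : g ==> g') (f : cell1 I J),
    b ≈ b' -> pre b f ≈ pre b' f;

  vcompA : forall (I J : cell0 B) (f g h k : cell1 I J)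
      (c : h ==> k) (b : g ==> h) (a : f ==> g),
    vcomp c (vcomp b a) ≈ vcomp (vcomp c b) a;
  vcomp1 : forall (I J : cell0 B) (f g : cell1 I J) (a : f ==> g), vcomp (id2 g) a ≈ a;
  vcomp2 : forall (I J : cell0 B) (f g : cell1 I J) (a : f ==> g), vcomp a (id2 f) ≈ a;
  post_id : forall (I J K : cell0 B) (g : cell1 J K) (f : cell1 I J),
    post g (id2 f) ≈ id2 (g ⊙ f);
  post_vcomp : forall (I J K : cell0 B) (g : cell1 J K) (f f' f'' : cell1 I J)
      (b : f' ==> f'') (a : f ==> f'),
    post g (vcomp b a) ≈ vcomp (post g b) (post g a);
  pre_id : forall (I J K : cell0 B) (g : cell1 J K) (f : cell1 I J),
    pre (id2 g) f ≈ id2 (g ⊙ f);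
  pre_vcomp : forall (I J K : cell0 B) (g g' g'' : cell1 J K)
      (b : g' ==> g'') (a : g ==> g') (f : cell1 I J),
    pre (vcomp b a) f ≈ vcomp (pre b f) (pre a f);
  interchange : forall (I J K : cell0 B) (g g' : cell1 J K) (f f' : cell1 I J)
      (b : g ==> g') (a : f ==> f'),
    vcomp (pre b f') (post g a) ≈ vcomp (post g' a) (pre b f);

  associator_nat1 : forall (I J K M : cell0 B) (f f' : cell1 I J) (g : cell1 J K) (h : cell1 K M)
      (a : f ==> f'),
    vcomp (associator f' g h) (post h (post g a)) ≈ vcomp (post (h ⊙ g) a) (associator f g h);
  associator_nat2 : forall (I J K M : cell0 B) (f : cell1 I J) (g g' : cell1 J K) (h : cell1 K M)
      (a : g ==> g'),
    vcomp (associator f g' h) (post h (pre a f)) ≈ vcomp (pre (post h a) f) (associator f g h);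
  associator_nat3 : forall (I J K M : cell0 B) (f : cell1 I J) (g : cell1 J K) (h h' : cell1 K M)
      (a : h ==> h'),
    vcomp (associator f g h') (pre a (g ⊙ f)) ≈ vcomp (pre (pre a g) f) (associator f g h);
  associatorK : forall (I J K M : cell0 B) (f : cell1 I J) (g : cell1 J K) (h : cell1 K M),
    vcomp (associator_inv f g h) (associator f g h) ≈ id2 (h ⊙ (g ⊙ f));
  associator_invK : forall (I J K M : cell0 B) (f : cell1 I J) (g : cell1 J K) (h : cell1 K M),
    vcomp (associator f g h) (associator_inv f g h) ≈ id2 (h ⊙ g ⊙ f);
  left_unitor_nat : forall (I J : cell0 B) (f f' : cell1 I J) (a : f ==> f'),
    vcomp (left_unitor f') (post (id1 J) a) ≈ vcomp a (left_unitor f);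
  left_unitorK : forall (I J : cell0 B) (f : cell1 I J),
    vcomp (left_unitor_inv f) (left_unitor f) ≈ id2 (id1 J ⊙ f);
  left_unitor_invK : forall (I J : cell0 B) (f : cell1 I J),
    vcomp (left_unitor f) (left_unitor_inv f) ≈ id2 f;
  right_unitor_nat : forall (I J : cell0 B) (f f' : cell1 I J) (a : f ==> f'),
    vcomp (right_unitor f') (pre a (id1 I)) ≈ vcomp a (right_unitor f);
  right_unitorK : forall (I J : cell0 B) (f : cell1 I J),
    vcomp (right_unitor_inv f) (right_unitor f) ≈ id2 (f ⊙ id1 I);
  right_unitor_invK : forall (I J : cell0 B) (f : cell1 I J),
    vcomp (right_unitor f) (right_unitor_inv f) ≈ id2 f;

  pentagon : forall (I J K M N : cell0 B)
      (f : cell1 I J) (g : cell1 J K) (h : cell1 K M) (k : cell1 M N),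
    vcomp (pre (associator g h k) f)
      (vcomp (associator f (h ⊙ g) k) (post k (associator f g h)))
    ≈ vcomp (associator f g (k ⊙ h)) (associator (g ⊙ f) h k);
  triangle : forall (I J K : cell0 B) (f : cell1 I J) (g : cell1 J K),
    vcomp (pre (right_unitor g) f) (associator f (id1 J) g) ≈ post g (left_unitor f) }.

Section BicategoryNotions.
Variables (A B : Cells) (bA : Bicategory A) (bB : Bicategory B).

Definition invertible2 (I J : cell0 B) (f g : cell1 I J) (a : f ==> g) : Prop :=
  exists b : g ==> f, vcomp bB b a ≈ id2 bB f /\ vcomp bB a b ≈ id2 bB g.

Definition isomorphic1 (I J : cell0 B) (f g : cell1 I J) : Prop :=
  exists a : f ==> g, invertible2 a.

Definition equivalent0 (I J : cell0 B) : Prop :=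
  exists (f : cell1 I J) (g : cell1 J I),
    isomorphic1 (g ⊙ f) (id1 I) /\ isomorphic1 (f ⊙ g) (id1 J).

(* The actions F0 and F1 on 0-cells and 1-cells are prescribed. *)
Record Pseudofunctor (F0 : cell0 A -> cell0 B)
    (F1 : forall I J : cell0 A, cell1 I J -> cell1 (F0 I) (F0 J)) := {
  ps2 : forall (I J : cell0 A) (f g : cell1 I J), (f ==> g) -> (F1 I J f ==> F1 I J g);
  ps_comp : forall (I J K : cell0 A) (g : cell1 J K) (f : cell1 I J),
    F1 J K g ⊙ F1 I J f ==> F1 I K (g ⊙ f);
  ps_comp_inv : forall (I J K : cell0 A) (g : cell1 J K) (f : cell1 I J),
    F1 I K (g ⊙ f) ==> F1 J K g ⊙ F1 I J f;
  ps_unit : forall I : cell0 A, id1 (F0 I) ==> F1 I I (id1 I);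
  ps_unit_inv : forall I : cell0 A, F1 I I (id1 I) ==> id1 (F0 I);

  ps2_eq2 : forall (I J : cell0 A) (f g : cell1 I J) (a b : f ==> g),
    a ≈ b -> ps2 a ≈ ps2 b;
  ps2_id : forall (I J : cell0 A) (f : cell1 I J), ps2 (id2 bA f) ≈ id2 bB (F1 I J f);
  ps2_vcomp : forall (I J : cell0 A) (f g h : cell1 I J) (b : g ==> h) (a : f ==> g),
    ps2 (vcomp bA b a) ≈ vcomp bB (ps2 b) (ps2 a);
  ps_compK : forall (I J K : cell0 A) (g : cell1 J K) (f : cell1 I J),
    vcomp bB (ps_comp_inv g f) (ps_comp g f) ≈ id2 bB (F1 J K g ⊙ F1 I J f);
  ps_comp_invK : forall (I J K : cell0 A) (g : cell1 J K) (f : cell1 I J),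
    vcomp bB (ps_comp g f) (ps_comp_inv g f) ≈ id2 bB (F1 I K (g ⊙ f));
  ps_unitK : forall I : cell0 A,
    vcomp bB (ps_unit_inv I) (ps_unit I) ≈ id2 bB (id1 (F0 I));
  ps_unit_invK : forall I : cell0 A,
    vcomp bB (ps_unit I) (ps_unit_inv I) ≈ id2 bB (F1 I I (id1 I));
  ps_comp_post : forall (I J K : cell0 A) (g : cell1 J K) (f f' : cell1 I J) (a : f ==> f'),
    vcomp bB (ps_comp g f') (post bB (F1 J K g) (ps2 a))
    ≈ vcomp bB (ps2 (post bA g a)) (ps_comp g f);
  ps_comp_pre : forall (I J K : cell0 A) (g g' : cell1 J K) (b : g ==> g') (f : cell1 I J),
    vcomp bB (ps_comp g' f) (pre bB (ps2 b) (F1 I J f))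
    ≈ vcomp bB (ps2 (pre bA b f)) (ps_comp g f);
  ps_associator : forall (I J K M : cell0 A)
      (f : cell1 I J) (g : cell1 J K) (h : cell1 K M),
    vcomp bB (ps2 (associator bA f g h))
      (vcomp bB (ps_comp h (g ⊙ f)) (post bB (F1 K M h) (ps_comp g f)))
    ≈ vcomp bB (ps_comp (h ⊙ g) f)
        (vcomp bB (pre bB (ps_comp h g) (F1 I J f))
          (associator bB (F1 I J f) (F1 J K g) (F1 K M h)));
  ps_left_unitor : forall (I J : cell0 A) (f : cell1 I J),
    vcomp bB (ps2 (left_unitor bA f))
      (vcomp bB (ps_comp (id1 J) f) (pre bB (ps_unit J) (F1 I J f)))
    ≈ left_unitor bB (F1 I J f);
  ps_right_unitor : forall (I J : cell0 A) (f : cell1 I J),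
    vcomp bB (ps2 (right_unitor bA f))
      (vcomp bB (ps_comp f (id1 I)) (post bB (F1 I J f) (ps_unit I)))
    ≈ right_unitor bB (F1 I J f) }.

(* Surjective on 0-cells up to equivalence, and an equivalence of categories
   (essentially surjective, full and faithful) on each hom-category. *)
Definition is_biequivalence (F0 : cell0 A -> cell0 B)
    (F1 : forall I J : cell0 A, cell1 I J -> cell1 (F0 I) (F0 J))
    (F : Pseudofunctor F1) : Prop :=
  (forall I' : cell0 B, exists I : cell0 A, equivalent0 (F0 I) I') /\
  forall I J : cell0 A,
    (forall g : cell1 (F0 I) (F0 J), exists f : cell1 I J, isomorphic1 (F1 I J f) g) /\
    (forall (f g : cell1 I J) (b : F1 I J f ==> F1 I J g),
       exists a : f ==> g, ps2 F a ≈ b) /\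
    (forall (f g : cell1 I J) (a a' : f ==> g), ps2 F a ≈ ps2 F a' -> a ≈ a').

Variable P : forall I J : cell0 B, cell1 I J -> Prop.
Hypothesis P_id : forall I : cell0 B, P (id1 I).
Hypothesis P_comp : forall (I J K : cell0 B) (g : cell1 J K) (f : cell1 I J),
  P g -> P f -> P (g ⊙ f).

Definition sub_cells : Cells := {|
  cell0 := cell0 B;
  cell1 := fun I J => {f : cell1 I J | P f};
  cell2 := fun I J f g => sval f ==> sval g;
  eq2 := fun I J f g a b => a ≈ b;
  id1 := fun I => exist _ (id1 I) (P_id I);
  comp1 := fun I J K g f =>
    exist _ (sval g ⊙ sval f) (P_comp (proj2_sig g) (proj2_sig f)) |}.

Definition sub_bicategory : Bicategory sub_cells.
Proof.
unshelve refine (@Build_Bicategory sub_cells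
  (fun I J f => id2 bB (sval f))
  (fun I J f g h b a => vcomp bB b a)
  (fun I J K g f f' a => post bB (sval g) a)
  (fun I J K g g' b f => pre bB b (sval f))
  (fun I J K M f g h => associator bB (sval f) (sval g) (sval h))
  (fun I J K M f g h => associator_inv bB (sval f) (sval g) (sval h))
  (fun I J f => left_unitor bB (sval f))
  (fun I J f => left_unitor_inv bB (sval f))
  (fun I J f => right_unitor bB (sval f))
  (fun I J f => right_unitor_inv bB (sval f))
  _ _ _ _ _ _ _ _ _ _ _ _ _ _ _ _ _ _ _ _ _ _ _ _ _ _ _); abstract (move=> * /=;
  first [ exact: (eq2_refl bB) | (by apply: (eq2_sym bB))
  | match goal with H1 : eq2 _ _, H2 : eq2 _ _ |- _ => exact (@eq2_trans B bB _ _ _ _ _ _ _ H1 H2) end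
  | by apply: vcomp_eq2 | by apply: post_eq2 | by apply: pre_eq2
  | apply: vcompA | apply: vcomp1 | apply: vcomp2 | apply: post_id | apply: post_vcomp
  | apply: pre_id | apply: pre_vcomp | apply: interchange
  | apply: associator_nat1 | apply: associator_nat2 | apply: associator_nat3
  | apply: associatorK | apply: associator_invK
  | apply: left_unitor_nat | apply: left_unitorK | apply: left_unitor_invK
  | apply: right_unitor_nat | apply: right_unitorK | apply: right_unitor_invK
  | apply: pentagon | apply: triangle ]).
Defined.

End BicategoryNotions.

Arguments sub_cells : clear implicits.

Section PolynomialFunctors.
Variables (C : Category) (PB : Pullbacks C) (T : Terminal C) (L : LocallySubcartesian C).
Variable box : forall (X Y : C) (f : X ~> Y), RightAdjoint (nabla L f).

Notation cart := (cartesian_product PB T L).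
Notation sub := (subcartesian_product T L).

Record BunchedFunctor (X Y : C) := {
  bfun :> Functor (slice X) (slice Y);
  cartesian_strength : Strength cart bfun;
  subcartesian_strength : Strength sub bfun }.

Record StrongTrans (X Y : C) (F G : BunchedFunctor X Y) := {
  tr :> forall a : slice X, F a ~> G a;
  tr_nat : forall (a b : slice X) (u : a ~> b), fmap G u ∘ tr a = tr b ∘ fmap F u;
  tr_strong : forall (K : C) (a : slice X),
    tr (act cart K a) ∘ st (cartesian_strength F) K a =
    st (cartesian_strength G) K a ∘ act_map cart (idm K) (tr a) }.

Definition is_cartesian_trans (X Y : C) (F G : BunchedFunctor X Y) (θ : StrongTrans F G) : Prop :=
  forall (a b : slice X) (u : a ~> b), is_pullback (θ a) (fmap F u) (fmap G u) (θ b).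

Definition id_bunched (X : C) : BunchedFunctor X X :=
  {| cartesian_strength := id_strength cart X; subcartesian_strength := id_strength sub X |}.

Definition comp_bunched (X Y Z : C) (G : BunchedFunctor Y Z) (F : BunchedFunctor X Y) :
    BunchedFunctor X Z := {|
  cartesian_strength := comp_strength (cartesian_strength G) (cartesian_strength F);
  subcartesian_strength := comp_strength (subcartesian_strength G) (subcartesian_strength F) |}.

(* The 0-cell X stands for the slice C/X. *)
Definition strong_cells : Cells := {|
  cell0 := C;
  cell1 := BunchedFunctor;
  cell2 := StrongTrans;
  eq2 := fun X Y F G θ ζ => forall a : slice X, θ a = ζ a;
  id1 := id_bunched;
  comp1 := comp_bunched |}.

Local Obligation Tactic := intros.
Local Ltac unfold_comp := cbn [fmap fobj comp_functor id_functor bfun comp_bunched id_bunched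
  st comp_strength id_strength cartesian_strength].

Program Definition st_id (X Y : C) (F : BunchedFunctor X Y) : StrongTrans F F :=
  {| tr := fun a => idm (F a) |}.
Next Obligation. unfold_comp; by rewrite comp1m compm1. Qed.
Next Obligation. unfold_comp; by rewrite act_map_id comp1m compm1. Qed.

Program Definition st_vcomp (X Y : C) (F G H : BunchedFunctor X Y)
    (ζ : StrongTrans G H) (θ : StrongTrans F G) : StrongTrans F H :=
  {| tr := fun a => ζ a ∘ θ a |}.
Next Obligation. unfold_comp; by rewrite compA tr_nat -compA tr_nat compA. Qed.
Next Obligation.
unfold_comp; rewrite -compA tr_strong compA tr_strong -compA act_map_comp.
by rewrite comp1m.
Qed.

Program Definition st_post (X Y Z : C) (G : BunchedFunctor Y Z) (F F' : BunchedFunctor X Y)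
    (θ : StrongTrans F F') : StrongTrans (comp_bunched G F) (comp_bunched G F') :=
  {| tr := fun a => fmap G (θ a) |}.
Next Obligation. unfold_comp; by rewrite -!fmap_comp tr_nat. Qed.
Next Obligation.
unfold_comp; by rewrite compA -fmap_comp tr_strong fmap_comp -!compA st_nat.
Qed.

Program Definition st_pre (X Y Z : C) (G G' : BunchedFunctor Y Z)
    (ζ : StrongTrans G G') (F : BunchedFunctor X Y) :
    StrongTrans (comp_bunched G F) (comp_bunched G' F) :=
  {| tr := fun a => ζ (F a) |}.
Next Obligation. unfold_comp; by rewrite tr_nat. Qed.
Next Obligation. unfold_comp; by rewrite compA -tr_nat -!compA tr_strong. Qed.

Program Definition st_assoc2 (X Y Z W : C) (F : BunchedFunctor X Y) (G : BunchedFunctor Y Z)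
    (H : BunchedFunctor Z W) :
    StrongTrans (comp_bunched H (comp_bunched G F)) (comp_bunched (comp_bunched H G) F) :=
  {| tr := fun a => idm (H (G (F a))) |}.
Next Obligation. unfold_comp; by rewrite comp1m compm1. Qed.
Next Obligation. unfold_comp; by rewrite act_map_id comp1m compm1 fmap_comp compA. Qed.

Program Definition st_assoc2_inv (X Y Z W : C) (F : BunchedFunctor X Y) (G : BunchedFunctor Y Z)
    (H : BunchedFunctor Z W) :
    StrongTrans (comp_bunched (comp_bunched H G) F) (comp_bunched H (comp_bunched G F)) :=
  {| tr := fun a => idm (H (G (F a))) |}.
Next Obligation. unfold_comp; by rewrite comp1m compm1. Qed.
Next Obligation. unfold_comp; by rewrite act_map_id comp1m compm1 fmap_comp compA. Qed.

Program Definition st_lunit (X Y : C) (F : BunchedFunctor X Y) :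
    StrongTrans (comp_bunched (id_bunched Y) F) F := {| tr := fun a => idm (F a) |}.
Next Obligation. unfold_comp; by rewrite comp1m compm1. Qed.
Next Obligation. unfold_comp; by rewrite act_map_id ?comp1m ?compm1. Qed.

Program Definition st_lunit_inv (X Y : C) (F : BunchedFunctor X Y) :
    StrongTrans F (comp_bunched (id_bunched Y) F) := {| tr := fun a => idm (F a) |}.
Next Obligation. unfold_comp; by rewrite comp1m compm1. Qed.
Next Obligation. unfold_comp; by rewrite act_map_id ?comp1m ?compm1. Qed.

Program Definition st_runit (X Y : C) (F : BunchedFunctor X Y) :
    StrongTrans (comp_bunched F (id_bunched X)) F := {| tr := fun a => idm (F a) |}.
Next Obligation. unfold_comp; by rewrite comp1m compm1. Qed.
Next Obligation. unfold_comp; by rewrite act_map_id ?fmap_id ?comp1m ?compm1. Qed.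

Program Definition st_runit_inv (X Y : C) (F : BunchedFunctor X Y) :
    StrongTrans F (comp_bunched F (id_bunched X)) := {| tr := fun a => idm (F a) |}.
Next Obligation. unfold_comp; by rewrite comp1m compm1. Qed.
Next Obligation. unfold_comp; by rewrite act_map_id ?fmap_id ?comp1m ?compm1. Qed.

(* This is a 2-category: associators and unitors have identity components. *)
Definition strong_bicategory : Bicategory strong_cells.
Proof.
unshelve refine (@Build_Bicategory strong_cells st_id st_vcomp st_post st_pre
  st_assoc2 st_assoc2_inv st_lunit st_lunit_inv st_runit st_runit_inv
  _ _ _ _ _ _ _ _ _ _ _ _ _ _ _ _ _ _ _ _ _ _ _ _ _ _ _);
  abstract (move=> * z; cbn [tr st_id st_vcomp st_post st_pre st_assoc2 st_assoc2_inv
      st_lunit st_lunit_inv st_runit st_runit_inv fmap fobj comp_functor id_functor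
      bfun comp_bunched id_bunched comp1 id1 strong_cells];
    rewrite ?fmap_id ?comp1m ?compm1 ?fmap_id ?fmap_comp ?compA //;
    first [ match goal with H1 : eq2 _ _, H2 : eq2 _ _ |- _ => exact (etrans (H1 z) (H2 z)) end
          | match goal with H1 : eq2 _ _, H2 : eq2 _ _ |- _ =>
              exact (f_equal2 (fun u v => u ∘ v) (H1 z) (H2 z)) end
          | match goal with H : eq2 _ _ |- _ => by rewrite (H z) end
          | by rewrite tr_nat ]).
Defined.

Record Poly (I J : C) := MkPoly {
  pE : C;
  pB : C;
  ps : pE ~> I;
  pp : pE ~> pB;
  pt : pB ~> J }.

Definition poly_functor (I J : C) (P : Poly I J) : BunchedFunctor I J := {|
  bfun := comp_functor (Sigma (pt P)) (comp_functor (box (pp P)) (Delta PB (ps P)));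
  cartesian_strength := comp_strength (sigma_strength cart (pt P))
    (comp_strength (box_strength box cart (pp P)) (delta_strength PB cart (ps P)));
  subcartesian_strength := comp_strength (sigma_strength sub (pt P))
    (comp_strength (box_strength box sub (pp P)) (delta_strength PB sub (ps P))) |}.

Definition is_subcartesian_polynomial (I J : C) (F : BunchedFunctor I J) : Prop :=
  exists (P : Poly I J) (θ : StrongTrans F (poly_functor P)),
    forall a : slice I, is_iso (θ a).

Lemma poly_functor_polynomial (I J : C) (P : Poly I J) :
  is_subcartesian_polynomial (poly_functor P).
Proof. by exists P, (st_id (poly_functor P)) => a; exists (idm _); rewrite comp1m. Qed.

(* Closure of polynomial functors under identities and composition enters as a
   hypothesis; it is asserted together with the biequivalence. *)
Definition polyfun_cells
    (Hid : forall I : C, is_subcartesian_polynomial (id_bunched I))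
    (Hcomp : forall (I J K : C) (G : BunchedFunctor J K) (F : BunchedFunctor I J),
      is_subcartesian_polynomial G -> is_subcartesian_polynomial F ->
      is_subcartesian_polynomial (comp_bunched G F)) : Cells :=
  sub_cells strong_cells is_subcartesian_polynomial Hid Hcomp.

(* A quadruple (P, j, h, k) with P = [apex]; 2-cells are quadruples satisfying the
   conditions below, up to [poly_cell_eq]. *)
Record PolyCellData (I J : C) (P Q : Poly I J) := MkPolyCellData {
  apex : C;
  cj : apex ~> pE P;
  ch : apex ~> pE Q;
  ck : pB P ~> pB Q }.

Record PolyCell (I J : C) (P Q : Poly I J) := MkPolyCell {
  cell_data :> PolyCellData P Q;
  cell_s : ps P ∘ cj cell_data = ps Q ∘ ch cell_data;
  cell_t : pt P = pt Q ∘ ck cell_data;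
  cell_subpullback :
    is_subpullback L (pp Q) (ck cell_data) (ch cell_data) (pp P ∘ cj cell_data) }.

Definition poly_cell_eq (I J : C) (P Q : Poly I J) (α β : PolyCellData P Q) : Prop :=
  ck α = ck β /\
  exists i : apex α ~> apex β, is_iso i /\ cj β ∘ i = cj α /\ ch β ∘ i = ch α.

Definition is_subcartesian_cell (I J : C) (P Q : Poly I J) (α : PolyCell P Q) : Prop :=
  is_iso (cj α).

Definition poly_id (I : C) : Poly I I := MkPoly (idm I) (idm I) (idm I).

Section Composite.
Variables (I J K : C) (Q : Poly J K) (P : Poly I J).

(* P = (s, p, t) and Q = (m, w, n). *)
Definition pc_S : C := pb PB (ps Q) (pt P).
Definition pc_t' : pc_S ~> pE Q := pb1 PB (ps Q) (pt P).
Definition pc_m' : pc_S ~> pB P := pb2 PB (ps Q) (pt P).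
Definition pc_R : C := dom (dist_ob box pc_t' (pp Q)).
Definition pc_b : pc_R ~> pB Q := dist_third box pc_t' (pp Q).
Definition pc_T : C := dist_apex box pc_t' (pp Q).
Definition pc_e : pc_T ~> pc_S := dist_first box pc_t' (pp Q).
Definition pc_w' : pc_T ~> pc_R := dist_second box pc_t' (pp Q).
Definition pc_A : C := ten L (pp P) (pc_m' ∘ pc_e).
Definition pc_a : pc_A ~> pE P := ten1 L (pp P) (pc_m' ∘ pc_e).
Definition pc_p' : pc_A ~> pc_T := ten2 L (pp P) (pc_m' ∘ pc_e).

Definition poly_comp : Poly I K :=
  MkPoly (ps P ∘ pc_a) (pc_w' ∘ pc_p') (pt Q ∘ pc_b).

End Composite.

Definition poly_cells : Cells := {|
  cell0 := C;
  cell1 := Poly;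
  cell2 := PolyCell;
  eq2 := fun I J P Q α β => poly_cell_eq α β;
  id1 := poly_id;
  comp1 := poly_comp |}.

(* For (P, j, h, k): (s, p, t) => (u, q, v), the composite
   ⊠_p Δ_s a -> ⊠_p ⊠_j ∇_j Δ_s a -> ⊠_p ⊠_j Δ_j Δ_s a -> ⊠_(p ∘ j) Δ_j Δ_s a
   -> ⊠_(p ∘ j) Δ_h Δ_u a -> Δ_k ⊠_q Δ_u a. *)
Definition cell_map (I J : C) (P Q : Poly I J) (α : PolyCell P Q) (a : slice I) :
    box (pp P) (Delta PB (ps P) a) ~> Delta PB (ck α) (box (pp Q) (Delta PB (ps Q) a)) :=
  box_delta PB box (cell_subpullback α) (Delta PB (ps Q) a)
  ∘ fmap (box (pp P ∘ cj α)) (delta_square PB (cell_s α) a)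
  ∘ box_comp box (erefl (pp P ∘ cj α)) (Delta PB (cj α) (Delta PB (ps P) a))
  ∘ fmap (box (pp P)) (fmap (box (cj α)) (nabla_delta L PB (cj α) (Delta PB (ps P) a)))
  ∘ fmap (box (pp P)) (aunit (box (cj α)) (Delta PB (ps P) a)).

(* The component at a of the canonical transformation
   Σ_t ⊠_p Δ_s => Σ_v ⊠_q Δ_u: [cell_map] followed by the counit of Σ_k ⊣ Δ_k. *)
Program Definition cell_trans (I J : C) (P Q : Poly I J) (α : PolyCell P Q) (a : slice I) :
    poly_functor P a ~> poly_functor Q a :=
  @MkSliceHom C J (poly_functor P a) (poly_functor Q a)
    (shom (sigma_delta_counit PB (ck α) (box (pp Q) (Delta PB (ps Q) a)))
     ∘ shom (cell_map α a)) _.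
Next Obligation.
have e : ck α ∘ (pb1 PB (ck α) _ ∘ shom (cell_map α a)) =
    ck α ∘ arr (box (pp P) (Delta PB (ps P) a)) := f_equal _ (shom_arr (cell_map α a)).
change (pt Q ∘ arr (box (pp Q) (Delta PB (ps Q) a)) ∘
  (pb2 PB (ck α) (arr (box (pp Q) (Delta PB (ps Q) a))) ∘ shom (cell_map α a)) =
  pt P ∘ arr (box (pp P) (Delta PB (ps P) a))).
by rewrite (cell_t α) -[RHS]compA -e -compA (compA (arr _)) -pb_comm -compA.
Qed.

(* β is the whiskering of α : P => P' with Q: its apex is T ⊗_B (apex α). *)
Definition is_post_whiskering (I J K : C) (Q : Poly J K) (P P' : Poly I J)
    (α : PolyCell P P') (β : PolyCell (poly_comp Q P) (poly_comp Q P')) : Prop :=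
  let kt : MkSlice (pt P) ~> MkSlice (pt P') :=
    @MkSliceHom C J (MkSlice (pt P)) (MkSlice (pt P')) (ck α) (esym (cell_t α)) in
  let r := fmap (box (pp Q)) (fmap (Delta PB (ps Q)) kt) in
  ck β = shom r /\
  exists (πT : apex β ~> pc_T Q P) (πP : apex β ~> apex α),
    is_subpullback L (pc_m' Q P ∘ pc_e Q P) (pp P ∘ cj α) πT πP /\
    pc_p' Q P ∘ cj β = πT /\ pc_a Q P ∘ cj β = cj α ∘ πP /\
    pc_p' Q P' ∘ ch β = shom (fmap (nabla L (pp Q)) r) ∘ πT /\
    pc_a Q P' ∘ ch β = ch α ∘ πP.

(* β is the whiskering of α : Q => Q' with P: its apex is U ⊗_B E, where
   U = R ⊗_Y (apex α) maps to T = X ⊗_Y R by τ and to T' = X' ⊗_Y' R' by τ'. *)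
Definition is_pre_whiskering (I J K : C) (Q Q' : Poly J K) (α : PolyCell Q Q') (P : Poly I J)
    (β : PolyCell (poly_comp Q P) (poly_comp Q' P)) : Prop :=
  let r : pc_R Q P ~> pc_R Q' P :=
    shom (sigma_delta_counit PB (ck α) (box (pp Q') (Delta PB (ps Q') (MkSlice (pt P)))))
    ∘ shom (cell_map α (MkSlice (pt P))) in
  let U := ten L (pc_b Q P) (pp Q ∘ cj α) in
  let πR : U ~> pc_R Q P := ten1 L (pc_b Q P) (pp Q ∘ cj α) in
  let πP : U ~> apex α := ten2 L (pc_b Q P) (pp Q ∘ cj α) in
  ck β = r /\
  exists (τ : U ~> pc_T Q P) (τ' : U ~> pc_T Q' P)
      (πU : apex β ~> U) (πE : apex β ~> pE P),
    ten1 L (pp Q) (pc_b Q P) ∘ τ = cj α ∘ πP /\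
    ten2 L (pp Q) (pc_b Q P) ∘ τ = πR /\
    ten1 L (pp Q') (pc_b Q' P) ∘ τ' = ch α ∘ πP /\
    ten2 L (pp Q') (pc_b Q' P) ∘ τ' = r ∘ πR /\
    is_subpullback L (pc_m' Q P ∘ pc_e Q P ∘ τ) (pp P) πU πE /\
    pc_p' Q P ∘ cj β = τ ∘ πU /\ pc_a Q P ∘ cj β = πE /\
    pc_p' Q' P ∘ ch β = τ' ∘ πU /\ pc_a Q' P ∘ ch β = πE.

Definition is_poly_bicategory (B : Bicategory poly_cells) : Prop :=
  (forall (I J : C) (P : Poly I J),
    poly_cell_eq (id2 B P) (MkPolyCellData (idm (pE P)) (idm (pE P)) (idm (pB P)))) /\
  (forall (I J : C) (P Q R : Poly I J) (β : PolyCell Q R) (α : PolyCell P Q),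
    poly_cell_eq (vcomp B β α)
      (@MkPolyCellData I J P R (ten L (ch α) (cj β))
        (cj α ∘ ten1 L (ch α) (cj β)) (ch β ∘ ten2 L (ch α) (cj β)) (ck β ∘ ck α))) /\
  (forall (I J K : C) (Q : Poly J K) (P P' : Poly I J) (α : PolyCell P P'),
    is_post_whiskering α (post B Q α)) /\
  (forall (I J K : C) (Q Q' : Poly J K) (α : PolyCell Q Q') (P : Poly I J),
    is_pre_whiskering α (pre B α P)).

Section Compositor.
Variables (I J K : C) (Q : Poly J K) (P : Poly I J).

(* Σ_b ⊠_w' Δ_e y -> ⊠_w Σ_t' y, the adjunct of
   ∇_w Σ_b ⊠_w' Δ_e y ≅ Σ_(t' ∘ e) ∇_w' ⊠_w' Δ_e y -> Σ_t' Σ_e Δ_e y -> Σ_t' y. *)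
Program Definition dist_collapse (y : SliceOb (pc_S Q P)) :
    Sigma (ten1 L (pp Q) (pc_b Q P)) (Delta PB (pc_e Q P) y) ~> Sigma (pc_t' Q P) y :=
  @MkSliceHom C (pE Q)
    (Sigma (ten1 L (pp Q) (pc_b Q P)) (Delta PB (pc_e Q P) y)) (Sigma (pc_t' Q P) y)
    (pb2 PB (pc_e Q P) (arr y)) _.
Next Obligation. by rewrite /= -compA -pb_comm compA dist_first_arr. Qed.

Definition dist_map (y : slice (pc_S Q P)) :
    Sigma (pc_b Q P) (box (pc_w' Q P) (Delta PB (pc_e Q P) y)) ~>
    box (pp Q) (Sigma (pc_t' Q P) y) :=
  adjunct (box (pp Q))
    (dist_collapse y
     ∘ fmap (Sigma (ten1 L (pp Q) (pc_b Q P))) (acounit (box (pc_w' Q P)) (Delta PB (pc_e Q P) y))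
     ∘ nabla_sigma (is_subpullback_ten L (pp Q) (pc_b Q P))
         (box (pc_w' Q P) (Delta PB (pc_e Q P) y))).

(* ⊠_(w' ∘ p') Δ_(s ∘ a) x -> ⊠_w' ⊠_p' Δ_a Δ_s x -> ⊠_w' Δ_(m' ∘ e) ⊠_p Δ_s x
   -> ⊠_w' Δ_e Δ_m' ⊠_p Δ_s x, and then, via [dist_map],
   -> ⊠_w Σ_t' Δ_m' ⊠_p Δ_s x -> ⊠_w Δ_m Σ_t ⊠_p Δ_s x over Y. *)
Definition comp_compare_inner (x : slice I) :
    box (pc_w' Q P ∘ pc_p' Q P) (Delta PB (ps P ∘ pc_a Q P) x) ~>
    box (pc_w' Q P) (Delta PB (pc_e Q P) (Delta PB (pc_m' Q P) (box (pp P) (Delta PB (ps P) x)))) :=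
  fmap (box (pc_w' Q P))
    (delta_decomp PB (pc_m' Q P) (pc_e Q P) (box (pp P) (Delta PB (ps P) x))
     ∘ box_delta PB box (is_subpullback_ten L (pp P) (pc_m' Q P ∘ pc_e Q P)) (Delta PB (ps P) x)
     ∘ fmap (box (pc_p' Q P)) (delta_decomp PB (ps P) (pc_a Q P) x))
  ∘ box_decomp box (erefl (pc_w' Q P ∘ pc_p' Q P)) (Delta PB (ps P ∘ pc_a Q P) x).

Definition comp_compare_over (x : slice I) :
    Sigma (pc_b Q P) (box (pc_w' Q P ∘ pc_p' Q P) (Delta PB (ps P ∘ pc_a Q P) x)) ~>
    box (pp Q) (Delta PB (ps Q) (Sigma (pt P) (box (pp P) (Delta PB (ps P) x)))) :=
  fmap (box (pp Q)) (sigma_delta_pb PB (ps Q) (pt P) (box (pp P) (Delta PB (ps P) x)))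
  ∘ dist_map (Delta PB (pc_m' Q P) (box (pp P) (Delta PB (ps P) x)))
  ∘ fmap (Sigma (pc_b Q P)) (comp_compare_inner x).

Program Definition comp_compare (x : slice I) :
    poly_functor (poly_comp Q P) x ~> poly_functor Q (poly_functor P x) :=
  @MkSliceHom C K (poly_functor (poly_comp Q P) x) (poly_functor Q (poly_functor P x))
    (shom (comp_compare_over x)) _.
Next Obligation.
have := f_equal (fun z => pt Q ∘ z) (shom_arr (comp_compare_over x)).
by rewrite /= !compA.
Qed.

End Compositor.

(* Σ_id ⊠_id Δ_id x ≅ ∇_id ⊠_id Δ_id x -> Δ_id x -> x. *)
Program Definition unit_compare (I : C) (x : slice I) : poly_functor (poly_id I) x ~> x :=
  @MkSliceHom C I (poly_functor (poly_id I) x) x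
    (shom (sigma_delta_counit PB (idm I) x)
     ∘ (shom (acounit (box (idm I)) (Delta PB (idm I) x))
        ∘ shom (nabla_unit L (box (idm I) (Delta PB (idm I) x))))) _.
Next Obligation.
rewrite compA shom_arr [LHS]/= !comp1m -/(nabla L (idm I)).
have e1 := shom_arr (acounit (box (idm I)) (Delta PB (idm I) x)).
have e2 := shom_arr (nabla_unit L (box (idm I) (Delta PB (idm I) x))).
by rewrite compA e1 e2 /= comp1m.
Qed.

Section Canonical.
Hypothesis Hid : forall I : C, is_subcartesian_polynomial (id_bunched I).
Hypothesis Hcomp : forall (I J K : C) (G : BunchedFunctor J K) (F : BunchedFunctor I J),
  is_subcartesian_polynomial G -> is_subcartesian_polynomial F ->
  is_subcartesian_polynomial (comp_bunched G F).

Definition polyfun_bicategory : Bicategory (polyfun_cells Hid Hcomp) :=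
  sub_bicategory strong_bicategory Hid Hcomp.

Definition poly_functor1 (I J : C) (P : Poly I J) : {F : BunchedFunctor I J | is_subcartesian_polynomial F} :=
  exist _ (poly_functor P) (poly_functor_polynomial P).

Variable B : Bicategory poly_cells.
Variable F : Pseudofunctor B polyfun_bicategory (F0 := fun I : C => I) poly_functor1.

(* The comparisons of F with identities and composition are required to be the
   canonical isomorphisms; as F is locally faithful, this determines the
   associators and unitors of B. *)
Definition is_canonical_pseudofunctor : Prop :=
  (forall (I J : C) (P Q : Poly I J) (α : PolyCell P Q) (x : slice I),
    tr (ps2 F α) x = cell_trans α x) /\
  (forall (I J K : C) (Q : Poly J K) (P : Poly I J) (x : slice I),
    tr (ps_comp_inv F Q P) x = comp_compare Q P x) /\
  (forall (I : C) (x : slice I), tr (ps_unit_inv F I) x = unit_compare x).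

End Canonical.

End PolynomialFunctors.

(* Main.v *)
(* Since ∇_p ⊣ ⊠_p, a map from M into the polynomial functor Σ_t ⊠_p Δ_s at a : A -> I is a pair
   (v : M -> B, φ : E ⊗_B M -> A) with a ∘ φ = s ∘ π_1, so that all the canonical maps can be
   computed on such elements.  A strong transformation is determined by its value (k, φ) at the
   generic element (id_B, id_E) of the functor at s: by naturality it suffices to know it on the
   elements (v, id), and E ⊗_B M embeds in M × E, where the strength reduces (v, id) to the generic
   element.  Naturality along ⟨p, id⟩ : E -> B × E makes (k, φ) a 2-cell of polynomials with apex
   E' ⊗_B' B.  Hence the canonical assignment is fully faithful on 2-cells, it carries the explicit
   vertical composites and whiskerings to those of transformations, and the bicategory axioms are
   reflected from strong transformations.  A 2-cell acts by precomposition with j, which is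
   bijective on the maps φ exactly when j is invertible; this is the cartesian case. *)

From Stdlib Require Import ssreflect ssrfun ProofIrrelevance IndefiniteDescription.
Require Import Defs.
Set Implicit Arguments.
Unset Strict Implicit.
Unset Printing Implicit Defensive.
Open Scope cat_scope.

(** The obstacle is that the squares [ten] are not universal: a commuting pair need not factor
    through them, so an element of ⊠_p x is a partial function, defined only at arguments separated
    ([sep]) from it. Separation passes to images ([sep_post1], [sep_post2]) but is not recovered
    from them. Hence application is a relation carrying its own witness, totality is conditional on
    separation, and equality of elements is tested at arguments that live at a later stage [Z] with
    a map [m] back to the stage of definition. When a value is itself applied, the second argument
    may again live at a later stage; this is the origin of the maps [g : W ~> Z] in the statements
    about composites. Inverses of the comparison maps are not written down as mates: they come from
    bijectivity on generalised elements. Likewise the associators and unitors of polynomials have no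
    explicit quadruple; they are preimages, under full faithfulness, of composites of strong
    transformations. *)

Lemma comp_pre (C : Category) (X Y Y' Z W : C) (f : Y ~> Z) (g : X ~> Y) (f' : Y' ~> Z)
    (g' : X ~> Y') (w : W ~> X) : f ∘ g = f' ∘ g' -> f ∘ (g ∘ w) = f' ∘ (g' ∘ w).
Proof. by move=> e; rewrite !compA e. Qed.

Lemma comp_pre1 (C : Category) (X Y Z W : C) (f : Y ~> Z) (g : X ~> Y) (h : X ~> Z)
    (w : W ~> X) : f ∘ g = h -> f ∘ (g ∘ w) = h ∘ w.
Proof. by move=> <-; rewrite compA. Qed.

Lemma comp_chain (C : Category) (X Y Z W V : C) (a : X ~> Y) (f : Z ~> X) (b : Z ~> Y)
    (g : W ~> Z) (c : W ~> Y) (w : V ~> W) :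
  a ∘ f = b -> b ∘ g = c -> a ∘ (f ∘ g ∘ w) = c ∘ w.
Proof. by move=> <- <-; rewrite !compA. Qed.

(** * Pasting of subpullbacks *)

Section Subpullbacks.
Variables (C : Category) (L : LocallySubcartesian C).

(** This trades the isomorphism with the chosen square for a test on generalised elements. The
    inverse is the lift of the two chosen projections, which form the universal separated pair. *)
Lemma subpb_intro (P A B X : C) (f : A ~> X) (g : B ~> X) (a : P ~> A) (b : P ~> B) :
  (forall (Z : C) (u v : Z ~> P), a ∘ u = a ∘ v -> b ∘ u = b ∘ v -> u = v) ->
  sep L f g a b ->
  (forall (Z : C) (z1 : Z ~> A) (z2 : Z ~> B), sep L f g z1 z2 ->
    exists v : Z ~> P, a ∘ v = z1 /\ b ∘ v = z2) ->
  is_subpullback L f g a b.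
Proof.
move=> mon [i [i1 i2]] univ; exists i; split=> //.
have [j [j1 j2]] := univ _ _ _ (sep_ten0 L f g).
exists j; split; first by apply: mon; rewrite compm1 compA ?j1 ?j2.
by apply: (@ten_monic _ L); rewrite compm1 compA ?i1 ?i2.
Qed.

Lemma subpb_sep (P A B X : C) (f : A ~> X) (g : B ~> X) (a : P ~> A) (b : P ~> B) :
  is_subpullback L f g a b -> sep L f g a b.
Proof. by move=> [i [_ ei]]; exists i. Qed.

Lemma subpb_comm (P A B X : C) (f : A ~> X) (g : B ~> X) (a : P ~> A) (b : P ~> B) :
  is_subpullback L f g a b -> f ∘ a = g ∘ b.
Proof. by move=> /subpb_sep /sep_eq. Qed.

Lemma subpb_monic (P A B X : C) (f : A ~> X) (g : B ~> X) (a : P ~> A) (b : P ~> B) :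
  is_subpullback L f g a b ->
  forall (Z : C) (u v : Z ~> P), a ∘ u = a ∘ v -> b ∘ u = b ∘ v -> u = v.
Proof.
move=> [i [[j [ji _]] [<- <-]]] Z u v e1 e2.
rewrite -(comp1m u) -(comp1m v) -ji -!compA; congr comp.
by apply: (@ten_monic _ L); rewrite !compA.
Qed.

Lemma subpb_sym (P A B X : C) (f : A ~> X) (g : B ~> X) (a : P ~> A) (b : P ~> B) :
  is_subpullback L f g a b -> is_subpullback L g f b a.
Proof.
move=> H; apply: subpb_intro.
- by move=> Z u v e1 e2; apply: (subpb_monic H).
- by apply: sep_sym; apply: subpb_sep.
- move=> Z z1 z2 /sep_sym /(sep_subpullback H) [v [v1 v2]]; by exists v.
Qed.

Section Pasting.
Variables (P A B X : C) (f : A ~> X) (g : B ~> X) (a : P ~> A) (b : P ~> B).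
Hypothesis H : is_subpullback L f g a b.

(** The binary axiom on elements, moved from the chosen square to an arbitrary subpullback. As
    [sep_bin] decomposes the first leg, the cospan is flipped; the resulting point of [ten L g f] is
    carried to [P] by lifting its projections. *)
Lemma sep_paste (B' Z : C) (g' : B' ~> B) (z1 : Z ~> A) (z2 : Z ~> B') :
  sep L f (g ∘ g') z1 z2 ->
  exists u : Z ~> P, a ∘ u = z1 /\ b ∘ u = g' ∘ z2 /\ sep L b g' u z2.
Proof.
move=> /sep_sym /sep_bin [u [u1 [u2 us]]].
have [v [v1 v2]] : exists v : ten L g f ~> P, a ∘ v = ten2 L g f /\ b ∘ v = ten1 L g f.
  by apply: (sep_subpullback H); apply: sep_sym; apply: sep_ten0.
exists (v ∘ u); rewrite !compA v1 v2; split=> //; split=> //.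
by apply: sep_sym; rewrite -v2 in us; apply: sep_post2 us.
Qed.

Lemma sep_paste_inv (B' Z : C) (g' : B' ~> B) (u : Z ~> P) (z2 : Z ~> B') :
  sep L b g' u z2 -> sep L f (g ∘ g') (a ∘ u) z2.
Proof.
have [i [i1 i2]] := sep_sym (subpb_sep H).
rewrite -i1 -i2 => /sep_sym /sep_post2 /sep_bin_inv /sep_sym.
by rewrite !compA.
Qed.

Lemma subpb_paste (P' B' : C) (g' : B' ~> B) (a' : P' ~> P) (b' : P' ~> B') :
  is_subpullback L b g' a' b' -> is_subpullback L f (g ∘ g') (a ∘ a') b'.
Proof.
move=> H'; apply: subpb_intro.
- move=> Z u v; rewrite -!compA => e1 e2; apply: (subpb_monic H') => //.
  apply: (subpb_monic H) => //.
  by rewrite !(comp_pre _ (subpb_comm H')) e2.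
- by apply: sep_paste_inv; apply: subpb_sep.
- move=> Z z1 z2 /sep_paste [u [u1 [u2 /(sep_subpullback H')]]] [v [v1 v2]].
  by exists v; rewrite -compA v1.
Qed.

(** The other half of the pasting law. It shows that the maps induced between the objects T and A of
    two composites form subpullbacks, by pasting them onto the chosen squares that define T and
    A. *)
Lemma subpb_cancel (P' B' : C) (g' : B' ~> B) (a' : P' ~> P) (b' : P' ~> B') :
  is_subpullback L f (g ∘ g') (a ∘ a') b' -> b ∘ a' = g' ∘ b' ->
  is_subpullback L b g' a' b'.
Proof.
move=> H' e; apply: subpb_intro.
- by move=> Z u v e1 e2; apply: (subpb_monic H') => //; rewrite -!compA e1.
- have [u [u1 [u2 us]]] := sep_paste (subpb_sep H').
  suff <- : u = a' by [].
  by apply: (subpb_monic H) => //; rewrite u2 e.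
- move=> Z z1 z2 s; have /(sep_subpullback H') [v [v1 v2]] := sep_paste_inv s.
  exists v; split=> //; apply: (subpb_monic H); first by rewrite compA.
  by rewrite (comp_pre _ e) v2 (sep_eq s).
Qed.

End Pasting.

Lemma subpb_identity (X Y : C) (f : X ~> Y) : is_subpullback L f (idm Y) (idm X) f.
Proof.
apply: subpb_intro.
- by move=> Z u v; rewrite !comp1m.
- by have := sep_id L f (idm X); rewrite compm1.
- by move=> Z z1 z2 /sep_eq; rewrite comp1m => <-; exists z1; rewrite comp1m.
Qed.

Lemma subpb_unique (X Y Z A B : C) (f : X ~> Z) (g : Y ~> Z) (a : A ~> X) (b : A ~> Y)
    (a' : B ~> X) (b' : B ~> Y) :
  is_subpullback L f g a b -> is_subpullback L f g a' b' ->
  exists i : A ~> B, is_iso i /\ a' ∘ i = a /\ b' ∘ i = b.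
Proof.
move=> H H'.
have [i [i1 i2]] := sep_subpullback H' (subpb_sep H).
have [j [j1 j2]] := sep_subpullback H (subpb_sep H').
exists i; split=> //; exists j; split.
  by apply: (subpb_monic H); rewrite compA ?j1 ?j2 compm1.
by apply: (subpb_monic H'); rewrite compA ?i1 ?i2 compm1.
Qed.

(** Rewrite [p] as [(p ∘ j) ∘ r]. With [j] the leg of a subcartesian 2-cell, this turns arguments of
    the source polynomial into points of the apex. *)
Lemma sep_precomp_iso (X Y Z A B : C) (j : A ~> X) (r : X ~> A) (p : X ~> Y) (v : B ~> Y)
    (e : Z ~> X) (m : Z ~> B) :
  j ∘ r = idm X -> sep L p v e m -> sep L (p ∘ j) v (r ∘ e) m.
Proof. by move=> jr s; apply: sep_post1; rewrite -compA jr compm1. Qed.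

End Subpullbacks.

(** * Elements of the right adjoints of the functors ∇ *)

Section Application.
Variables (C : Category) (PB : Pullbacks C) (L : LocallySubcartesian C).
Variable box : forall (X Y : C) (f : X ~> Y), RightAdjoint (nabla L f).

(* [App e y c]: the element y of ⊠_p x, applied to a point e of E separated from y,
   has the value c. *)
Definition App (E B : C) (p : E ~> B) (x : slice E) (Z : C)
    (e : Z ~> E) (y : Z ~> dom (box p x)) (c : Z ~> dom x) : Prop :=
  exists u : Z ~> ten L p (arr (box p x)),
    ten1 L p (arr (box p x)) ∘ u = e /\ ten2 L p (arr (box p x)) ∘ u = y /\
    shom (acounit (box p) x) ∘ u = c.

Section Basics.
Variables (E B : C) (p : E ~> B) (x : slice E).

Lemma app_total (Z : C) (e : Z ~> E) (y : Z ~> dom (box p x)) :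
  sep L p (arr (box p x)) e y -> exists c, App e y c.
Proof. by move=> [u [u1 u2]]; exists (shom (acounit (box p) x) ∘ u), u. Qed.

Lemma app_sep (Z : C) (e : Z ~> E) (y : Z ~> dom (box p x)) (c : Z ~> dom x) :
  App e y c -> sep L p (arr (box p x)) e y.
Proof. by move=> [u [u1 [u2 _]]]; exists u. Qed.

Lemma app_fun (Z : C) (e : Z ~> E) (y : Z ~> dom (box p x)) (c c' : Z ~> dom x) :
  App e y c -> App e y c' -> c = c'.
Proof.
move=> [u [u1 [u2 <-]]] [u' [u1' [u2' <-]]]; congr comp.
by apply: (@ten_monic _ L); rewrite ?u1 ?u2.
Qed.

Lemma app_arr (Z : C) (e : Z ~> E) (y : Z ~> dom (box p x)) (c : Z ~> dom x) :
  App e y c -> arr x ∘ c = e.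
Proof. by move=> [u [<- [_ <-]]]; rewrite compA (shom_arr (acounit (box p) x)). Qed.

Lemma app_pre (Z W : C) (e : Z ~> E) (y : Z ~> dom (box p x)) (c : Z ~> dom x) (g : W ~> Z) :
  App e y c -> App (e ∘ g) (y ∘ g) (c ∘ g).
Proof. by move=> [u [<- [<- <-]]]; exists (u ∘ g); rewrite !compA. Qed.

(** The beta rule for ⊠: the triangle identity for ∇_p ⊣ ⊠_p read at a point. *)
Lemma app_adjunct (a : slice B) (h : nabla L p a ~> x) (Z : C) (u : Z ~> ten L p (arr a)) :
  App (ten1 L p (arr a) ∘ u) (shom (adjunct (box p) h) ∘ (ten2 L p (arr a) ∘ u)) (shom h ∘ u).
Proof.
exists (shom (fmap (nabla L p) (adjunct (box p) h)) ∘ u).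
rewrite /= !projE -!compA; split=> //; split=> //.
by rewrite compA; have /(f_equal (@shom _ _ _ _)) /= -> := counit_adjunct (box p) h.
Qed.

Lemma app_fmap (x' : slice E) (f : x ~> x') (Z : C) (e : Z ~> E) (y : Z ~> dom (box p x))
    (c : Z ~> dom x) :
  App e y c -> App e (shom (fmap (box p) f) ∘ y) (shom f ∘ c).
Proof.
move=> [u [<- [<- <-]]].
exists (shom (fmap (nabla L p) (fmap (box p) f)) ∘ u); rewrite /= !projE -!compA; split=> //.
split=> //; rewrite !compA.
by have /(f_equal (@shom _ _ _ _)) /= -> := acounit_nat (box p) f.
Qed.

Lemma app_abs (M : C) (v : M ~> B) (phi : ten L p v ~> dom x) :
  arr x ∘ phi = ten1 L p v ->
  exists y : M ~> dom (box p x), arr (box p x) ∘ y = v /\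
    forall (Z : C) (u : Z ~> ten L p v), App (ten1 L p v ∘ u) (y ∘ (ten2 L p v ∘ u)) (phi ∘ u).
Proof.
move=> e; pose h : nabla L p (MkSlice v) ~> x := @MkSliceHom C E (nabla L p (MkSlice v)) x phi e.
exists (shom (adjunct (box p) h)); split; first exact: (shom_arr (adjunct (box p) h)).
by move=> Z u; apply: (app_adjunct h).
Qed.

(** Extensionality. Only the universal separated pair ([ten1], [ten2]) is used: there the
    applications are the transposes of [y] and [y'], which determine them. *)
Lemma app_ext (M : C) (y y' : M ~> dom (box p x)) :
  arr (box p x) ∘ y = arr (box p x) ∘ y' ->
  (forall (Z : C) (e : Z ~> E) (m : Z ~> M) (c : Z ~> dom x),
    sep L p (arr (box p x) ∘ y) e m -> App e (y ∘ m) c -> App e (y' ∘ m) c) ->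
  y = y'.
Proof.
move=> ea H; pose v := arr (box p x) ∘ y.
pose ys : MkSlice v ~> box p x := @MkSliceHom C B (MkSlice v) (box p x) y erefl.
pose ys' : MkSlice v ~> box p x := @MkSliceHom C B (MkSlice v) (box p x) y' (esym ea).
suff /(f_equal (@shom _ _ _ _)) : ys = ys' by [].
apply: radj_ext; apply: slice_hom_eq => /=.
have a1 : App (ten1 L p v) (y ∘ ten2 L p v) (shom (acounit (box p) x) ∘ shom (fmap (nabla L p) ys)).
  by exists (shom (fmap (nabla L p) ys)); rewrite /= !projE.
have a2 : App (ten1 L p v) (y' ∘ ten2 L p v) (shom (acounit (box p) x) ∘ shom (fmap (nabla L p) ys')).
  by exists (shom (fmap (nabla L p) ys')); rewrite /= !projE.
by apply: app_fun a2; apply: H a1; apply: sep_ten0.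
Qed.

End Basics.

(** The Beck-Chevalley map only reindexes: an argument [k] of the old element becomes the argument
    [g' ∘ k] of the new one, and the value loses its K-component. *)
Lemma app_box_delta (T A B K : C) (f : A ~> T) (g : B ~> T) (g' : K ~> A) (f' : K ~> B)
    (H : is_subpullback L f g g' f') (x : slice A) (Z : C) (k : Z ~> K)
    (y : Z ~> dom (box f' (Delta PB g' x))) (c : Z ~> pb PB g' (arr x)) :
  @App _ _ f' (Delta PB g' x) _ k y c ->
  @App _ _ f x _ (g' ∘ k) (pb2 PB g (arr (box f x)) ∘ (shom (box_delta PB box H x) ∘ y))
    (pb2 PB g' (arr x) ∘ c).
Proof.
move=> [u [u1 [u2 uc]]].
have s : sep L f (g ∘ arr (box f' (Delta PB g' x))) (g' ∘ k) y.
  by apply: (sep_paste_inv H); exists u.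
have [w [w1 w2]] := s.
rewrite /box_delta; cbn [shom sigma_delta_adjunct]; rewrite pb_lift2r.
set h := (_ ∘ nabla_sigma _ _).
have := app_adjunct h w; rewrite [_ ∘ w]w1 [ten2 _ _ _ ∘ w]w2.
suff -> : shom h ∘ w = pb2 PB g' (arr x) ∘ c by [].
rewrite /h /=; case: (nabla_sigma_sep _ _) => /= i [i1 i2].
rewrite -uc -!compA; congr (_ ∘ (_ ∘ _)).
have wm : arr (box f' (Delta PB g' x)) ∘ (ten2 L f' (arr (box f' (Delta PB g' x))) ∘ (i ∘ w)) = f' ∘ k.
  rewrite (compA _ i) i2.
  by move: w2 => /= ->; rewrite -u2 -u1 !compA ten_comm.
apply: (@ten_monic _ L).
  rewrite u1; apply: (subpb_monic H).
    by rewrite -w1 -i1 -!compA.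
  by rewrite -wm compA ten_comm -compA.
by rewrite compA i2 w2 u2.
Qed.

(** The isomorphism ⊠_p ⊠_j ≅ ⊠_w is uncurrying: apply at [j ∘ k], then at [k]. Separation of [k]
    from [y] along [w] is assumed because the two applications only give separation of [k] from the
    image [z] of [y]. *)
Lemma app_box_comp (X E B : C) (j : X ~> E) (p : E ~> B) (w : X ~> B) (e : w = p ∘ j)
    (x : slice X) (Z : C) (k : Z ~> X) (y : Z ~> dom (box p (box j x)))
    (z : Z ~> dom (box j x)) (c : Z ~> dom x) :
  sep L w (arr (box p (box j x))) k y ->
  @App _ _ p (box j x) _ (j ∘ k) y z -> @App _ _ j x _ k z c ->
  @App _ _ w x _ k (shom (box_comp box e x) ∘ y) c.
Proof.
move=> [u [u1 u2]] [v [v1 [v2 vz]]] [r [r1 [r2 rc]]].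
rewrite /box_comp; set h := (_ ∘ nabla_comp _ _ _).
have := app_adjunct h u; rewrite [_ ∘ u]u1 [ten2 _ _ _ ∘ u]u2.
suff -> : shom h ∘ u = c by [].
rewrite /h /=; case: (nabla_comp_sep _ _) => /= i [i1 i2].
rewrite -rc -!compA; congr comp.
apply: (@ten_monic _ L); rewrite /= !projE.
  by rewrite r1 -u1 -i1 -compA.
rewrite r2 -vz -!compA; congr comp.
apply: (@ten_monic _ L).
  by rewrite (comp_pre _ (esym (ten_comm _ _ _))) (comp_pre1 _ i1) v1 [_ ∘ u]u1.
by rewrite v2 -u2 -i2 -!compA.
Qed.

(** Currying. The first application happens at stage [Z], while the second argument [k] lives at a
    later stage [W] and is compatible with [a] only after restriction along [g]. *)
Lemma app_box_decomp (X E B : C) (j : X ~> E) (p : E ~> B) (w : X ~> B) (e : w = p ∘ j)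
    (x : slice X) (Z W : C) (a : Z ~> E) (y : Z ~> dom (box w x))
    (z : Z ~> dom (box j x)) (g : W ~> Z) (k : W ~> X) (c : W ~> dom x) :
  @App _ _ p (box j x) _ a (shom (box_decomp box e x) ∘ y) z ->
  sep L p (arr (box w x)) a y ->
  a ∘ g = j ∘ k ->
  @App _ _ w x _ k (y ∘ g) c -> @App _ _ j x _ k (z ∘ g) c.
Proof.
move=> az [u [u1 u2]] ag [v [v1 [v2 vc]]].
rewrite /box_decomp in az; set h := adjunct (box j) _ in az.
have := app_adjunct h u; rewrite [_ ∘ u]u1 [ten2 _ _ _ ∘ u]u2 => /(app_fun az) ->.
have [r [r1 r2]] : sep L j (ten1 L p (arr (box w x))) k (u ∘ g).
  have : sep L (p ∘ j) (arr (box w x)) k (y ∘ g) by rewrite -e; exists v.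
  move=> /sep_bin [u' [u1' [u2']]]; suff -> : u' = u ∘ g by [].
  by apply: (@ten_monic _ L); rewrite ?u1' ?u2' compA ?u1 ?u2.
have := app_adjunct (acounit (box w) x ∘ nabla_decomp L e (box w x)) r.
rewrite [ten1 _ _ _ ∘ r]r1 [ten2 _ _ _ ∘ r]r2 -/h compA.
suff -> : shom (acounit (box w) x ∘ nabla_decomp L e (box w x)) ∘ r = c by [].
rewrite -vc /= -compA; congr comp.
apply: (@ten_monic _ L); rewrite !projE; first by rewrite r1 v1.
by rewrite -compA r2 compA u2 v2.
Qed.

Section BoxStrength.
Variable M : ProjProduct L.

(** The strength acts pointwise and keeps the parameter in [K]. The argument must be separated from
    the whole pair [z], parameter included, and not merely from its second component. *)
Lemma app_box_strength (E B K : C) (p : E ~> B) (x : slice E) (Z : C) (e : Z ~> E)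
    (z : Z ~> mten M K (dom (box p x))) (c : Z ~> dom x) :
  sep L p (arr (box p x) ∘ mp2 M K _) e z ->
  @App _ _ p x _ e (mp2 M K _ ∘ z) c ->
  exists c' : Z ~> mten M K (dom x), mp1 M K _ ∘ c' = mp1 M K _ ∘ z /\ mp2 M K _ ∘ c' = c /\
    @App _ _ p (act M K x) _ e (shom (st (box_strength box M p) K x) ∘ z) c'.
Proof.
move=> [u [u1 u2]] [v [v1 [v2 vc]]].
rewrite /box_strength; cbn [st]; set h := (_ ∘ act_nabla _ _ _ _).
have := @app_adjunct _ _ p _ _ h _ u; rewrite [_ ∘ u]u1 [ten2 _ _ _ ∘ u]u2 => ha.
exists (shom h ∘ u); split; last split; last exact: ha.
  by rewrite /h /= -compA !projE u2.
rewrite /h /= -compA !projE -vc; congr comp.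
apply: (@ten_monic _ L); rewrite ?projE; first by rewrite u1 v1.
by rewrite u2 v2.
Qed.

End BoxStrength.

End Application.

(** * Elements of polynomial functors *)

Section PolynomialApplication.
Variables (C : Category) (PB : Pullbacks C) (T : Terminal C) (L : LocallySubcartesian C).
Variable box : forall (X Y : C) (f : X ~> Y), RightAdjoint (nabla L f).

Notation cart := (cartesian_product PB T L).
Notation "⟦ P ⟧" := (poly_functor PB T box P) (at level 0, format "⟦ P ⟧").

Definition pdom (I J : C) (P : Poly I J) (a : slice I) : C :=
  dom (box (pp P) (Delta PB (ps P) a)).

Definition pidx (I J : C) (P : Poly I J) (a : slice I) : pdom P a ~> pB P :=
  arr (box (pp P) (Delta PB (ps P) a)).

(* Elements M ~> dom (⟦P⟧ a) are pairs (v : M ~> pB P, φ : ten p v ~> dom a) with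
   a ∘ φ = s ∘ ten1; [pidx] is the first component and [PApp] applies the second. *)
Definition PApp (I J : C) (P : Poly I J) (a : slice I) (Z : C)
    (e : Z ~> pE P) (y : Z ~> pdom P a) (c : Z ~> dom a) : Prop :=
  exists c' : Z ~> pb PB (ps P) (arr a),
    @App _ _ box _ _ (pp P) (Delta PB (ps P) a) _ e y c' /\ pb2 PB (ps P) (arr a) ∘ c' = c.

(* The components below are locked so that associativity rewriting does not unfold them. *)
Definition pmap (I J : C) (P : Poly I J) (a b : slice I) (f : a ~> b) :
  pdom P a ~> pdom P b := locked (shom (fmap ⟦P⟧ f)).

Lemma pmapE (I J : C) (P : Poly I J) (a b : slice I) (f : a ~> b) :
  pmap P f = shom (fmap ⟦P⟧ f).
Proof. by rewrite /pmap -lock. Qed.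

Definition pst (I J : C) (P : Poly I J) (K : C) (a : slice I) :
  mten cart K (pdom P a) ~> pdom P (act cart K a) :=
  locked (shom (st (cartesian_strength ⟦P⟧) K a)).

Lemma pstE (I J : C) (P : Poly I J) (K : C) (a : slice I) :
  pst P K a = shom (st (cartesian_strength ⟦P⟧) K a).
Proof. by rewrite /pst -lock. Qed.

Definition pcell (I J : C) (P Q : Poly I J) (α : PolyCell L P Q) (a : slice I) :
  pdom P a ~> pdom Q a := locked (shom (cell_trans PB T box α a)).

Lemma pcellE (I J : C) (P Q : Poly I J) (α : PolyCell L P Q) (a : slice I) :
  pcell α a = shom (cell_trans PB T box α a).
Proof. by rewrite /pcell -lock. Qed.

Definition pcomp (I J K : C) (Q : Poly J K) (P : Poly I J) (x : slice I) :
  pdom (poly_comp PB box Q P) x ~> pdom Q (⟦P⟧ x) := locked (shom (comp_compare PB T box Q P x)).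

Lemma pcompE (I J K : C) (Q : Poly J K) (P : Poly I J) (x : slice I) :
  pcomp Q P x = shom (comp_compare PB T box Q P x).
Proof. by rewrite /pcomp -lock. Qed.

Definition punit (I : C) (x : slice I) : pdom (poly_id I) x ~> dom x :=
  locked (shom (unit_compare PB T box x)).

Lemma punitE (I : C) (x : slice I) : punit x = shom (unit_compare PB T box x).
Proof. by rewrite /punit -lock. Qed.

Section Basics.
Variables (I J : C) (P : Poly I J).

Lemma papp_total (a : slice I) (Z : C) (e : Z ~> pE P) (y : Z ~> pdom P a) :
  sep L (pp P) (pidx P a) e y -> exists c, PApp e y c.
Proof. by move=> /(@app_total C L box) [c Hc]; exists (pb2 PB _ _ ∘ c), c. Qed.

Lemma papp_fun (a : slice I) (Z : C) (e : Z ~> pE P) (y : Z ~> pdom P a) (c c' : Z ~> dom a) :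
  PApp e y c -> PApp e y c' -> c = c'.
Proof. by move=> [d [Hd <-]] [d' [Hd' <-]]; rewrite (app_fun Hd Hd'). Qed.

Lemma papp_arr (a : slice I) (Z : C) (e : Z ~> pE P) (y : Z ~> pdom P a) (c : Z ~> dom a) :
  PApp e y c -> arr a ∘ c = ps P ∘ e.
Proof. by move=> [d [/app_arr <- <-]]; rewrite !compA pb_comm. Qed.

Lemma papp_pre (a : slice I) (Z W : C) (e : Z ~> pE P) (y : Z ~> pdom P a) (c : Z ~> dom a)
    (g : W ~> Z) : PApp e y c -> PApp (e ∘ g) (y ∘ g) (c ∘ g).
Proof. by move=> [d [Hd <-]]; exists (d ∘ g); rewrite compA; split=> //; apply: app_pre. Qed.

(** The values lie in the pullback of [ps P] and [arr a]; their first projection is forced to be the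
    argument, so comparing the components in [a] is enough. *)
Lemma papp_ext (a : slice I) (M : C) (y y' : M ~> pdom P a) :
  pidx P a ∘ y = pidx P a ∘ y' ->
  (forall (Z : C) (e : Z ~> pE P) (m : Z ~> M) (c c' : Z ~> dom a),
    sep L (pp P) (pidx P a ∘ y) e m -> PApp e (y ∘ m) c -> PApp e (y' ∘ m) c' -> c = c') ->
  y = y'.
Proof.
move=> ei H; apply: (app_ext ei) => Z e m c s Hc.
have /(@app_total C L box) [c' Hc'] : sep L (pp P) (pidx P a) e (y' ∘ m).
  by rewrite ei in s; apply: sep_post2.
suff -> : c = c' by [].
apply: pb_ext; last by apply: (H _ _ _ _ _ s); [exists c | exists c'].
by have := app_arr Hc; have := app_arr Hc' => /= -> ->.
Qed.

Lemma papp_abs (a : slice I) (M : C) (v : M ~> pB P) (phi : ten L (pp P) v ~> dom a) :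
  arr a ∘ phi = ps P ∘ ten1 L (pp P) v ->
  exists y : M ~> pdom P a, pidx P a ∘ y = v /\
    forall (Z : C) (u : Z ~> ten L (pp P) v),
      PApp (ten1 L (pp P) v ∘ u) (y ∘ (ten2 L (pp P) v ∘ u)) (phi ∘ u).
Proof.
move=> /esym e; pose phi' := pb_lift PB e.
have [|y [y1 y2]] := @app_abs C L box _ _ (pp P) (Delta PB (ps P) a) _ v phi'.
  by rewrite /= pb_lift1.
exists y; split=> // Z u; exists (phi' ∘ u); split; first exact: y2.
by rewrite compA pb_lift2.
Qed.

Lemma pidx_fmap (a b : slice I) (f : a ~> b) (Z : C) (y : Z ~> pdom P a) :
  pidx P b ∘ (pmap P f ∘ y) = pidx P a ∘ y.
Proof.
have e : pidx P b ∘ pmap P f = pidx P a :=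
  etrans (f_equal _ (pmapE P f)) (shom_arr (fmap (box (pp P)) (fmap (Delta PB (ps P)) f))).
by rewrite compA e.
Qed.

Lemma papp_fmap (a b : slice I) (f : a ~> b) (Z : C) (e : Z ~> pE P) (y : Z ~> pdom P a)
    (c : Z ~> dom a) :
  PApp e y c -> @PApp _ _ P b _ e (pmap P f ∘ y) (shom f ∘ c).
Proof.
rewrite pmapE; move=> [d [Hd <-]]; exists (shom (fmap (Delta PB (ps P)) f) ∘ d); split.
  exact: (app_fmap (fmap (Delta PB (ps P)) f) Hd).
by rewrite /= !projE compA.
Qed.

Lemma poly_strength_eq (K : C) (a : slice I) :
  pst P K a =
  shom (fmap (box (pp P)) (st (delta_strength PB cart (ps P)) K a)) ∘
  shom (st (box_strength box cart (pp P)) K (Delta PB (ps P) a)).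
Proof. by rewrite pstE; exact: compm1. Qed.

Lemma pidx_strength (K : C) (a : slice I) (Z : C) (z : Z ~> mten cart K (pdom P a)) :
  pidx P (act cart K a) ∘ (pst P K a ∘ z) =
  pidx P a ∘ (mp2 cart K (pdom P a) ∘ z).
Proof.
have e1 := shom_arr (st (box_strength box cart (pp P)) K (Delta PB (ps P) a)).
have e2 := shom_arr (fmap (box (pp P)) (st (delta_strength PB cart (ps P)) K a)).
rewrite poly_strength_eq [RHS]compA.
exact: comp_chain e2 e1.
Qed.

Lemma papp_strength (K : C) (a : slice I) (Z : C) (e : Z ~> pE P)
    (z : Z ~> mten cart K (pdom P a)) (c : Z ~> dom a) :
  sep L (pp P) (pidx P a ∘ mp2 cart K (pdom P a)) e z ->
  PApp e (mp2 cart K (pdom P a) ∘ z) c ->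
  exists c' : Z ~> mten cart K (dom a),
    mp1 cart K (dom a) ∘ c' = mp1 cart K (pdom P a) ∘ z /\
    mp2 cart K (dom a) ∘ c' = c /\
    @PApp _ _ P (act cart K a) _ e (pst P K a ∘ z) c'.
Proof.
move=> s [d [Hd ed]].
have [d' [d1 [d2 /(app_fmap (st (delta_strength PB cart (ps P)) K a)) Hd']]] :=
  app_box_strength s Hd.
exists (mmap cart (idm K) (pb2 PB (ps P) (arr a)) ∘ d'); split; last split.
- by rewrite mmap1r comp1m d1.
- by rewrite mmap2r d2 ed.
- exists (shom (st (delta_strength PB cart (ps P)) K a) ∘ d'); split.
    by rewrite poly_strength_eq -compA.
  by cbn [st delta_strength shom]; rewrite pb_lift2r.
Qed.

End Basics.

(** * The action of a polynomial 2-cell on elements *)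

Section Cells.
Variables (I J : C) (P Q : Poly I J) (α : PolyCell L P Q).

Lemma pidx_cell (a : slice I) (Z : C) (y : Z ~> pdom P a) :
  pidx Q a ∘ (pcell α a ∘ y) = ck α ∘ (pidx P a ∘ y).
Proof.
have e : pb1 PB (ck α) (pidx Q a) ∘ shom (cell_map PB box α a) = pidx P a :=
  shom_arr (cell_map PB box α a).
have e' : ck α ∘ pb1 PB (ck α) (pidx Q a) ∘ shom (cell_map PB box α a) = ck α ∘ pidx P a.
  by rewrite -compA e.
by rewrite pcellE [RHS]compA; apply: comp_chain (esym (pb_comm _ _ _)) e'.
Qed.

(** A 2-cell acts by precomposition: the image of [y], asked at [ch α ∘ w], answers what [y] answers
    at [cj α ∘ w]. The proof follows one value through the five factors of [cell_map]. *)
Lemma papp_cell (a : slice I) (Z : C) (w : Z ~> apex α) (y : Z ~> pdom P a) (c : Z ~> dom a) :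
  sep L (pp P ∘ cj α) (pidx P a) w y -> PApp (cj α ∘ w) y c ->
  @PApp _ _ Q a _ (ch α ∘ w) (pcell α a ∘ y) c.
Proof.
move=> s [c1 [Hc1 <-]].
(* The unit and the inclusion of ∇ in Δ need [w] separated from the value [c1]. Decomposing [s]
   separates [w] from the point ([cj α ∘ w], [y]), and [c1] is the image of that point under the
   counit. *)
have s1 : sep L (cj α) (arr (Delta PB (ps P) a)) w c1.
  have [u [u1 [u2 us]]] := sep_bin s.
  have := shom_arr (acounit (box (pp P)) (Delta PB (ps P) a)).
  move=> e; change (arr (nabla L (pp P) (box (pp P) (Delta PB (ps P) a)))) with
    (ten1 L (pp P) (pidx P a)) in e.
  rewrite -e in us; have := sep_post2 us.
  have [v [v1 [v2 <-]]] := Hc1.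
  suff -> : u = v by [].
  by apply: (@ten_monic _ L); [rewrite u1 -v1 | rewrite u2 -v2].
have [u [u1 u2]] := s1.
(* The unit is the adjunct of the identity, so it sends [c1] to the function [w ↦ (w, c1)]. *)
have Hu : @App _ _ box _ _ (cj α) (nabla L (cj α) (Delta PB (ps P) a)) _ w
    (shom (aunit (box (cj α)) (Delta PB (ps P) a)) ∘ c1) u.
  have := app_adjunct box (idm (nabla L (cj α) (Delta PB (ps P) a))) u.
  by rewrite /adjunct fmap_id comp1m u1 u2 comp1m.
have H1 := app_fmap (aunit (box (cj α)) (Delta PB (ps P) a)) Hc1.
have H2 := app_fmap (fmap (box (cj α)) (nabla_delta L PB (cj α) (Delta PB (ps P) a))) H1.
have H2' := app_fmap (nabla_delta L PB (cj α) (Delta PB (ps P) a)) Hu.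
have := app_box_comp (erefl (pp P ∘ cj α)) _ H2 H2'.
set y2 := _ ∘ (_ ∘ y) => H3.
(* Both maps applied to [y] lie over [pB P], so the index and hence the separation are unchanged. *)
have {}s : sep L (pp P ∘ cj α)
    (arr (box (pp P) (box (cj α) (Delta PB (cj α) (Delta PB (ps P) a))))) w y2.
  apply: sep_post2; apply: sep_post2.
  rewrite (shom_arr (fmap (box (pp P)) (fmap (box (cj α)) (nabla_delta L PB (cj α) (Delta PB (ps P) a))))).
  by rewrite (shom_arr (fmap (box (pp P)) (aunit (box (cj α)) (Delta PB (ps P) a)))).
have {s} H3 := H3 s.
have H4 := app_fmap (delta_square PB (cell_s α) a) H3.
have H5 := app_box_delta (cell_subpullback α) H4.
eexists; split.
  move: H5; rewrite /y2 pcellE /cell_trans /cell_map; cbn [shom sigma_delta_counit comp slice].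
  by rewrite -!compA; apply.
by rewrite /= !projE -compA projE u2.
Qed.

End Cells.

(** * Elements of composite polynomials and their curried form *)

Section Composites.
Variables (I J K : C) (Q : Poly J K) (P : Poly I J).

Local Notation b := (pc_b PB box Q P).
Local Notation w' := (pc_w' PB box Q P).
Local Notation d := (pc_e PB box Q P).
Local Notation p' := (pc_p' PB box Q P).
Local Notation a' := (pc_a PB box Q P).
Local Notation m' := (pc_m' PB Q P).
Local Notation t' := (pc_t' PB Q P).
Local Notation QP := (poly_comp PB box Q P).

(** An argument [e] of [Q] together with the index in R is a point [τ] of T = X ⊗_Y R, and the
    element over R is applied at [τ]. *)
Lemma app_dist_map (x : slice (pc_S PB Q P)) (Z : C) (e : Z ~> pE Q)
    (y : Z ~> dom (box w' (Delta PB d x))) :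
  sep L (pp Q) (b ∘ arr (box w' (Delta PB d x))) e y ->
  exists (τ : Z ~> pc_T PB box Q P) (c : Z ~> pb PB d (arr x)),
    ten1 L (pp Q) b ∘ τ = e /\
    ten2 L (pp Q) b ∘ τ = arr (box w' (Delta PB d x)) ∘ y /\
    @App _ _ box _ _ w' (Delta PB d x) _ τ y c /\
    @App _ _ box _ _ (pp Q) (Sigma t' x) _ e (shom (dist_map box x) ∘ y)
      (pb2 PB d (arr x) ∘ c).
Proof.
move=> [u [u1 u2]].
have := app_adjunct box (dist_collapse box x
     ∘ fmap (Sigma (ten1 L (pp Q) b)) (acounit (box w') (Delta PB d x))
     ∘ nabla_sigma (is_subpullback_ten L (pp Q) b) (box w' (Delta PB d x))) u.
rewrite [ten1 _ _ _ ∘ u]u1 [ten2 _ _ _ ∘ u]u2 -/(dist_map box x).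
case E: (nabla_sigma_sep (is_subpullback_ten L (pp Q) b) (box w' (Delta PB d x))) => [i [i1 i2]].
set h := (_ ∘ _ ∘ nabla_sigma _ _) => H.
have eh : shom h = pb2 PB d (arr x) ∘ shom (acounit (box w') (Delta PB d x)) ∘ i.
  by rewrite /h /= E.
exists (ten1 L w' (arr (box w' (Delta PB d x))) ∘ (i ∘ u)),
  (shom (acounit (box w') (Delta PB d x)) ∘ (i ∘ u)).
have j2 : ten2 L w' (arr (box w' (Delta PB d x))) ∘ (i ∘ u) = y.
  by rewrite compA -u2; congr (_ ∘ u).
split; first by rewrite -u1 compA compA -i1 -!compA.
split.
  by rewrite -[in RHS]j2 !compA; congr (_ ∘ _ ∘ _); apply: ten_comm.
split; first by exists (i ∘ u).
by move: H; rewrite eh -!compA.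
Qed.

Lemma pidx_comp_compare (x : slice I) (Z : C) (y : Z ~> pdom QP x) :
  pidx Q (⟦P⟧ x) ∘ (pcomp Q P x ∘ y) = b ∘ (pidx QP x ∘ y).
Proof.
have e : pidx Q (⟦P⟧ x) ∘ pcomp Q P x = b ∘ pidx QP x :=
  etrans (f_equal _ (pcompE Q P x)) (shom_arr (comp_compare_over PB box Q P x)).
by rewrite compA e -compA.
Qed.

(** The comparison is currying: an argument [κ] of the composite consists of an argument of [Q],
    giving [τ], and an argument [a' ∘ κ] of [P]. Applying [y] at [κ] is applying its image first at
    [e] and then at [a' ∘ κ]; the last clause produces [κ] from a separated second argument. *)
Lemma papp_comp_compare (x : slice I) (Z : C) (e : Z ~> pE Q) (y : Z ~> pdom QP x) :
  sep L (pp Q) (b ∘ pidx QP x) e y ->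
  exists (τ : Z ~> pc_T PB box Q P) (z : Z ~> pdom P x),
    ten1 L (pp Q) b ∘ τ = e /\
    ten2 L (pp Q) b ∘ τ = pidx QP x ∘ y /\
    @PApp _ _ Q (⟦P⟧ x) _ e (pcomp Q P x ∘ y) z /\
    pidx P x ∘ z = m' ∘ d ∘ τ /\
    (forall (W : C) (g : W ~> Z) (κ : W ~> pc_A PB box Q P) (c : W ~> dom x),
      p' ∘ κ = τ ∘ g -> @PApp _ _ QP x _ κ (y ∘ g) c -> PApp (a' ∘ κ) (z ∘ g) c) /\
    (forall (W : C) (g : W ~> Z) (e2 : W ~> pE P),
      sep L (pp P) (m' ∘ d ∘ τ) e2 g ->
      exists κ : W ~> pc_A PB box Q P,
        a' ∘ κ = e2 /\ p' ∘ κ = τ ∘ g /\ sep L (w' ∘ p') (pidx QP x) κ (y ∘ g)).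
Proof.
move=> s; pose G : slice (pB P) := box (pp P) (Delta PB (ps P) x).
pose F1 := fmap (box p') (delta_decomp PB (ps P) a' x).
pose F2 := box_delta PB box (is_subpullback_ten L (pp P) (m' ∘ d)) (Delta PB (ps P) x).
pose F3 := delta_decomp PB m' d G.
pose D := box_decomp box (erefl (w' ∘ p')) (Delta PB (ps P ∘ a') x).
pose N := fmap (box w') (F3 ∘ F2 ∘ F1).
have eN : arr (box w' (Delta PB d (Delta PB m' G))) ∘ (shom N ∘ (shom D ∘ y)) = pidx QP x ∘ y.
  have eN1 := shom_arr N; have eD := shom_arr D.
  by rewrite !(comp_pre1 _ eN1) (comp_pre1 _ eD).
have [|τ [c [t1 [t2 [H1 H2]]]]] := @app_dist_map (Delta PB m' G) _ e (shom N ∘ (shom D ∘ y)).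
  have eN1 := shom_arr N; have eD := shom_arr D.
  apply: sep_post2; rewrite -[b ∘ _ ∘ _]compA eN1; apply: sep_post2.
  by rewrite -[b ∘ _ ∘ _]compA eD.
rewrite eN in t2.
(* Pasting lifts [e] to a point of T separated from [y]; joint monicity of the projections of T
   identifies it with [τ]. *)
have sw : sep L w' (pidx QP x) τ y.
  have [u [u1 u2]] := s.
  have [v [v1 [v2 vs]]] := sep_paste (is_subpullback_ten L (pp Q) b) s.
  suff -> : τ = v by [].
  by apply: (@ten_monic _ L); rewrite ?t1 ?t2 ?v1 ?v2.
have [d0 Hd0] : exists d0, @App _ _ box _ _ w' (box p' (Delta PB (ps P ∘ a') x)) _ τ (shom D ∘ y) d0.
  by apply: app_total; apply: sep_post2; rewrite (shom_arr D).
have Hd1 := app_fmap (F3 ∘ F2 ∘ F1) Hd0.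
have ec := app_fun H1 Hd1; subst c.
exists τ, (pb2 PB m' (arr G) ∘ (pb2 PB d _ ∘ (shom (F3 ∘ F2 ∘ F1) ∘ d0))).
split=> //; split=> //; split.
  have H3 := app_fmap (sigma_delta_pb PB (ps Q) (pt P) G) H2.
  have e3 : pb2 PB (ps Q) (pt P ∘ arr G) ∘ shom (sigma_delta_pb PB (ps Q) (pt P) G) =
    pb2 PB m' (arr G) by rewrite /= pb_lift2.
  have ecc : pcomp Q P x ∘ y =
      shom (fmap (box (pp Q)) (sigma_delta_pb PB (ps Q) (pt P) G)) ∘
        (shom (dist_map box (Delta PB m' G)) ∘ (shom N ∘ (shom D ∘ y))).
    have E (X1 X2 X3 X4 X5 X6 : C) (f1 : X1 ~> X2) (f2 : X3 ~> X1) (f3 : X4 ~> X3)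
        (f4 : X5 ~> X4) (f5 : X6 ~> X5) : f1 ∘ f2 ∘ (f3 ∘ f4) ∘ f5 = f1 ∘ (f2 ∘ (f3 ∘ (f4 ∘ f5))).
      by rewrite -!compA.
    by rewrite pcompE; exact: E.
  by rewrite ecc; eexists; split; [exact: H3 | rewrite (comp_pre1 _ e3)].
split.
  move: (app_arr H1); move: (shom _ ∘ d0) => q /= eq.
  rewrite [LHS](comp_pre _ (esym (pb_comm PB m' (pidx P x)))).
  by rewrite (comp_pre _ (esym (pb_comm PB d (pb1 PB m' (pidx P x))))) eq compA.
split.
- move=> W g κ c pk [c0 [H4 <-]].
  have H5 := app_box_decomp Hd0 sw (esym pk) H4.
  have H6 := app_fmap (delta_decomp PB (ps P) a' x) H5.
  have H7 := app_box_delta (is_subpullback_ten L (pp P) (m' ∘ d)) H6.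
  have e5 : pb2 PB m' (arr G) ∘ (pb2 PB d (pb1 PB m' (arr G)) ∘ shom F3) = pb2 PB (m' ∘ d) (arr G).
    by rewrite /= !projE.
  have e6 : pb2 PB (ps P) (arr x) ∘ (pb2 PB a' (pb1 PB (ps P) (arr x)) ∘
      shom (delta_decomp PB (ps P) a' x)) = pb2 PB (ps P ∘ a') (arr x).
    by rewrite /= !projE.
  have E (X1 X2 X3 X4 X5 X6 X7 X8 : C) (g1 : X1 ~> X2) (g2 : X3 ~> X1) (f3 : X4 ~> X3) (f2 : X5 ~> X4)
      (f1 : X6 ~> X5) (r : X7 ~> X6) (h : X8 ~> X7) (k : X4 ~> X2) :
      g1 ∘ (g2 ∘ f3) = k ->
      g1 ∘ (g2 ∘ (f3 ∘ f2 ∘ f1 ∘ r)) ∘ h = k ∘ (f2 ∘ (f1 ∘ (r ∘ h))).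
    by move=> <-; rewrite -!compA.
  exists (pb2 PB a' (pb1 PB (ps P) (arr x)) ∘ (shom (delta_decomp PB (ps P) a' x) ∘ c0)); split.
    have -> : pb2 PB m' (arr G) ∘ (pb2 PB d (arr (Delta PB m' G)) ∘ (shom (F3 ∘ F2 ∘ F1) ∘ d0)) ∘ g =
      pb2 PB (m' ∘ d) (arr G) ∘ (shom F2 ∘ (shom F1 ∘ (d0 ∘ g))) by apply: E.
    exact: H7.
  by rewrite (compA _ _ c0) (comp_pre1 _ e6).
- move=> W g e2 /(sep_paste (is_subpullback_ten L (pp P) (m' ∘ d))) [κ [k1 [k2 ks]]].
  exists κ; split=> //; split=> //.
  have [v [v1 v2]] := sw; rewrite -v1 in ks.
  by rewrite -v2 -compA; apply: sep_bin_inv; apply: sep_post2.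
Qed.

End Composites.

(** Along an identity every point over the base is separated from its own index, so an element may
    be applied to its index; the unit comparison does exactly this. *)
Lemma papp_unit (I : C) (x : slice I) (Z : C) (y : Z ~> pdom (poly_id I) x) :
  PApp (P := poly_id I) (pidx (poly_id I) x ∘ y) y (punit x ∘ y).
Proof.
exists (shom (acounit (box (idm I)) (Delta PB (idm I) x)) ∘
  (shom (nabla_unit L (box (idm I) (Delta PB (idm I) x))) ∘ y)); split; last by rewrite punitE -!compA.
exists (shom (nabla_unit L (box (idm I) (Delta PB (idm I) x))) ∘ y).
by rewrite /= !projE.
Qed.

End PolynomialApplication.

Arguments pdom {C} PB {L} box {I J} P a.
Arguments pidx {C} PB {L} box {I J} P a.
Arguments pmap {C} PB T {L} box {I J} P {a b} f.
Arguments pst {C} PB T {L} box {I J} P K a.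
Arguments pcell {C} PB T {L} box {I J P Q} α a.
Arguments pcomp {C} PB T {L} box {I J K} Q P x.
Arguments punit {C} PB T {L} box {I} x.
Arguments PApp {C} PB {L} box {I J} P {a Z} e y c.

(** * Polynomial 2-cells as strong transformations *)

Section StrongTransformations.
Variables (C : Category) (PB : Pullbacks C) (T : Terminal C) (L : LocallySubcartesian C).
Variable box : forall (X Y : C) (f : X ~> Y), RightAdjoint (nabla L f).

Notation cart := (cartesian_product PB T L).
Notation "⟦ P ⟧" := (poly_functor PB T box P) (at level 0, format "⟦ P ⟧").

Section CellTransformation.
Variables (I J : C) (P Q : Poly I J) (α : PolyCell L P Q).

(** The subpullback condition on [α] lifts every admissible argument of the image to the apex, so
    [papp_cell] accounts for all of its values. *)
Lemma pcell_elim (a : slice I) (M Z : C) (y : M ~> pdom PB box P a) (e : Z ~> pE Q) (m : Z ~> M) :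
  sep L (pp Q) (ck α ∘ (pidx PB box P a ∘ y)) e m ->
  exists (w : Z ~> apex α) (c : Z ~> dom a),
    ch α ∘ w = e /\ sep L (pp P ∘ cj α) (pidx PB box P a ∘ y) w m /\
    PApp PB box P (cj α ∘ w) (y ∘ m) c /\ PApp PB box Q e (pcell PB T box α a ∘ (y ∘ m)) c.
Proof.
move=> /(sep_paste (cell_subpullback α)) [w [w1 [w2 ws]]].
have s := sep_post2 ws.
have [c Hc] := papp_total (sep_post1 s).
exists w, c; split=> //; split=> //; split=> //.
by rewrite -w1; apply: papp_cell.
Qed.

Lemma pcell_natural (a b : slice I) (u : a ~> b) :
  pmap PB T box Q u ∘ pcell PB T box α a = pcell PB T box α b ∘ pmap PB T box P u.
Proof.
have E1 Z y := @pidx_fmap _ PB T _ box _ _ P _ _ u Z y.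
have E2 Z y := @pidx_fmap _ PB T _ box _ _ Q _ _ u Z y.
apply: papp_ext.
  by rewrite E2 -(compm1 (pmap PB T box P u)) pidx_cell E1 -(pidx_cell T) compm1.
move=> Z e m c c'; rewrite E2 -(compm1 (pcell PB T box α a)) (pidx_cell T) -!compA.
move=> /pcell_elim [w [c0 [<- [s [H1 H2]]]]].
rewrite comp1m in H2 *; move=> H3 H4.
rewrite (papp_fun H3 (papp_fmap T u H2)).
have H5 := papp_fmap T u H1.
rewrite comp1m in H5; apply: papp_fun H4.
apply: papp_cell => //.
by apply: sep_post2; rewrite -(compm1 (pmap PB T box P u)) E1.
Qed.

Lemma pcell_strong (K : C) (a : slice I) :
  pcell PB T box α (act cart K a) ∘ pst PB T box P K a =
  pst PB T box Q K a ∘ mmap cart (idm K) (pcell PB T box α a).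
Proof.
have ei : pidx PB box P (act cart K a) ∘ pst PB T box P K a =
    pidx PB box P a ∘ mp2 cart K (pdom PB box P a).
  by rewrite -(compm1 (pst PB T box P K a)) pidx_strength compm1.
apply: papp_ext.
  rewrite -(compm1 (pst PB T box P K a)) pidx_cell compm1 ei.
  by rewrite pidx_strength mmap2 pidx_cell.
move=> Z e m c c'; rewrite pidx_cell ei => s.
have [w [c0 [w1 [s' [H1 H2]]]]] := pcell_elim s; subst e.
have [c1 [d1 [d2 H3]]] := papp_strength (sep_post1 s') H1.
have s2 : sep L (pp P ∘ cj α) (pidx PB box P (act cart K a)) w (pst PB T box P K a ∘ m).
  by apply: sep_post2; rewrite ei.
have H4 := papp_cell T s2 H3.
rewrite -!compA => /(papp_fun H4) <- {H4}.
have [||c2 [f1 [f2 H5]]] := @papp_strength _ PB T L box _ _ Q K a Z (ch α ∘ w)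
    (mmap cart (idm K) (pcell PB T box α a) ∘ m) c0.
- by apply: sep_post2; rewrite -compA mmap2 pidx_cell.
- by rewrite mmap2r.
- move=> /(papp_fun H5) <-; apply: (@mp_monic _ _ cart).
  by rewrite d1 f1 mmap1r comp1m.
by rewrite d2.
Qed.

Definition cell_strong : StrongTrans ⟦P⟧ ⟦Q⟧.
Proof.
refine (@Build_StrongTrans _ _ _ _ _ _ ⟦P⟧ ⟦Q⟧ (cell_trans PB T box α) _ _).
- by move=> a b u; apply: slice_hom_eq; have := pcell_natural u; rewrite !pmapE !pcellE.
- by move=> K a; apply: slice_hom_eq; have := pcell_strong K a; rewrite !pstE !pcellE.
Defined.

End CellTransformation.

(** * The generic element and determination of strong transformations *)

Section GenericElement.
Variables (I J : C) (P : Poly I J).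

Lemma generic_exists : {y : pB P ~> pdom PB box P (MkSlice (ps P)) |
  pidx PB box P (MkSlice (ps P)) ∘ y = idm (pB P) /\
  forall (Z : C) (e : Z ~> pE P), PApp PB box P (a := MkSlice (ps P)) e (y ∘ (pp P ∘ e)) e}.
Proof.
apply: constructive_indefinite_description.
have [|y [y1 y2]] := @papp_abs _ PB L box _ _ P (MkSlice (ps P)) (pB P) (idm _)
  (ten1 L (pp P) (idm _)) => //.
exists y; split=> // Z e.
have [u [u1 u2]] := sep_id L (pp P) e.
by have := y2 _ u; rewrite u1 u2.
Qed.

(* The element (id, id) of ⟦P⟧ at s itself. *)
Definition generic : pB P ~> pdom PB box P (MkSlice (ps P)) := sval generic_exists.

Lemma pidx_generic : pidx PB box P (MkSlice (ps P)) ∘ generic = idm (pB P).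
Proof. by rewrite /generic; case: generic_exists => y []. Qed.

Lemma papp_generic (Z : C) (e : Z ~> pE P) :
  PApp PB box P (a := MkSlice (ps P)) e (generic ∘ (pp P ∘ e)) e.
Proof. by rewrite /generic; case: generic_exists => y []. Qed.

(** Polynomial functors preserve monomorphisms. Used on the target functor, to cancel the embedding
    of E ⊗_B M in M × E. *)
Lemma pmap_monic (a b : slice I) (f : a ~> b) :
  (forall (Z : C) (u v : Z ~> dom a), shom f ∘ u = shom f ∘ v -> u = v) ->
  forall (M : C) (y y' : M ~> pdom PB box P a),
    pmap PB T box P f ∘ y = pmap PB T box P f ∘ y' -> y = y'.
Proof.
move=> mon M y y' e; apply: papp_ext.
  by rewrite -(pidx_fmap T f y) -(pidx_fmap T f y') e.
move=> Z z m c c' _ /(papp_fmap T f) H1 /(papp_fmap T f) H2; apply: mon.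
by apply: papp_fun H1 _; rewrite compA e -compA.
Qed.

End GenericElement.

Section Determination.
Variables (I J : C) (P : Poly I J).
Variables (M : C) (v : M ~> pB P).

(* An element over v is the image of (v, id) at s ∘ ten1; the monomorphism
   ten p v -> M × E sends (v, id) to the strength applied to (id_M, generic ∘ v).  Hence a
   strong transformation is determined by its value at the generic element. *)
Lemma generic_over_element :
  let a : slice I := MkSlice (ps P ∘ ten1 L (pp P) v) in
  exists (i : a ~> act cart M (MkSlice (ps P))) (y : M ~> pdom PB box P a) (k : M ~> mten cart M (pB P)),
    (forall (Z : C) (u u' : Z ~> dom a), shom i ∘ u = shom i ∘ u' -> u = u') /\
    pidx PB box P a ∘ y = v /\
    (forall (Z : C) (u : Z ~> ten L (pp P) v),
      PApp PB box P (a := a) (ten1 L (pp P) v ∘ u) (y ∘ (ten2 L (pp P) v ∘ u)) u) /\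
    mp1 cart M (pB P) ∘ k = idm M /\ mp2 cart M (pB P) ∘ k = v /\
    pmap PB T box P i ∘ y =
      pst PB T box P M (MkSlice (ps P)) ∘ (mmap cart (idm M) (generic P) ∘ k).
Proof.
set a := MkSlice _ => a'.
pose i0 : ten L (pp P) v ~> mten cart M (pE P) :=
  @pb_lift _ PB _ _ _ (bang T M) (bang T (pE P)) _ (ten2 L (pp P) v) (ten1 L (pp P) v) (bang_ext _ _).
have i1 : mp1 cart M (pE P) ∘ i0 = ten2 L (pp P) v by apply: pb_lift1.
have i2 : mp2 cart M (pE P) ∘ i0 = ten1 L (pp P) v by apply: pb_lift2.
have ei : arr (act cart M (MkSlice (ps P))) ∘ i0 = arr a by rewrite /= -compA i2.
pose i : a' ~> act cart M (MkSlice (ps P)) := @MkSliceHom C I a (act cart M (MkSlice (ps P))) i0 ei.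
pose k : M ~> mten cart M (pB P) :=
  @pb_lift _ PB _ _ _ (bang T M) (bang T (pB P)) _ (idm M) v (bang_ext _ _).
have k1 : mp1 cart M (pB P) ∘ k = idm M by apply: pb_lift1.
have k2 : mp2 cart M (pB P) ∘ k = v by apply: pb_lift2.
have [|y [y1 y2]] := @papp_abs _ PB L box _ _ P a' M v (idm _); first by rewrite compm1.
have {}y2 Z (u : Z ~> ten L (pp P) v) :
    PApp PB box P (a := a') (ten1 L (pp P) v ∘ u) (y ∘ (ten2 L (pp P) v ∘ u)) u.
  by have := y2 Z u; rewrite comp1m.
exists i, y, k; split; last split=> //; last split=> //; last split=> //; last split=> //.
  move=> Z u u' e; apply: (@ten_monic _ L).
    by rewrite -i2 -!compA; congr comp.
  by rewrite -i1 -!compA; congr comp.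
apply: papp_ext.
  rewrite pidx_fmap pidx_strength y1 (comp_pre _ (mmap2 _ _ _)) k2.
  by rewrite compA pidx_generic comp1m.
move=> Z e m c c'; rewrite pidx_fmap y1 => -[u [u1 u2]].
have := papp_fmap T i (y2 _ u); rewrite u1 u2 compA => /papp_fun H /H <- {H}.
have g1 : mp2 cart M _ ∘ (mmap cart (idm M) (generic P) ∘ (k ∘ m)) = generic P ∘ (pp P ∘ e).
  by rewrite mmap2r (compA _ k) k2 -u1 -u2 -!(comp_pre _ (ten_comm L _ _)).
have [|| c1 [d1 [d2 H]]] := @papp_strength _ PB T L box _ _ P M (MkSlice (ps P)) Z e
    (mmap cart (idm M) (generic P) ∘ (k ∘ m)) e.
- apply: sep_post2; rewrite -compA mmap2 (comp_pre1 _ (pidx_generic P)) comp1m.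
  by apply: sep_post2; rewrite k2; exists u.
- by rewrite g1; apply: papp_generic.
- rewrite -!compA => /(papp_fun H) <-; apply: (@mp_monic _ _ cart).
  by rewrite d1 mmap1r comp1m (compA _ k) k1 comp1m /= compA i1.
by rewrite d2 /= compA i2.
Qed.

End Determination.

Lemma strong_trans_ext (I J : C) (P Q : Poly I J) (θ ζ : StrongTrans ⟦P⟧ ⟦Q⟧) :
  shom (θ (MkSlice (ps P))) ∘ generic P = shom (ζ (MkSlice (ps P))) ∘ generic P ->
  forall a : slice I, θ a = ζ a.
Proof.
move=> eg a; apply: slice_hom_eq.
suff H (M : C) (y : M ~> pdom PB box P a) : shom (θ a) ∘ y = shom (ζ a) ∘ y.
  by have := H _ (idm _); rewrite !compm1.
pose v := pidx PB box P a ∘ y.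
have [i [y0 [k [mon [y1 [y2 [k1 [k2 ek]]]]]]]] := generic_over_element v.
have [c Hc] : exists c, PApp PB box P (ten1 L (pp P) v) (y ∘ ten2 L (pp P) v) c.
  by apply: papp_total; apply: sep_post2; apply: sep_ten0.
(* A Yoneda argument: the universal value [c] of [y], seen as a morphism over [I], carries the
   element (v, id) to [y]. *)
pose f : (MkSlice (ps P ∘ ten1 L (pp P) v) : slice I) ~> a :=
  @MkSliceHom _ _ (MkSlice (ps P ∘ ten1 L (pp P) v)) a c (papp_arr Hc).
have -> : y = pmap PB T box P f ∘ y0.
  apply: papp_ext; first by rewrite pidx_fmap y1.
  move=> Z e m d d' [u [<- <-]] H1.
  have H2 := papp_fmap T f (y2 _ u); rewrite -compA => /papp_fun /(_ H2) ->.
  by apply: (papp_fun H1); rewrite compA; apply: papp_pre.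
have nat (θ' : StrongTrans ⟦P⟧ ⟦Q⟧) (b b' : slice I) (h : b ~> b') :
    shom (θ' b') ∘ pmap PB T box P h = pmap PB T box Q h ∘ shom (θ' b).
  by rewrite !pmapE; exact: esym (f_equal (@shom _ _ _ _) (tr_nat θ' h)).
rewrite !compA !nat -!compA; congr comp.
(* After composing with [i], naturality and strength leave only the values at the generic
   element. *)
apply: (pmap_monic mon).
rewrite !compA -!nat -!compA ek.
have str (θ' : StrongTrans ⟦P⟧ ⟦Q⟧) :
    shom (θ' (act cart M (MkSlice (ps P)))) ∘ pst PB T box P M (MkSlice (ps P)) =
    pst PB T box Q M (MkSlice (ps P)) ∘ mmap cart (idm M) (shom (θ' (MkSlice (ps P)))).
  by rewrite !pstE; exact: (f_equal (@shom _ _ _ _) (tr_strong θ' M (MkSlice (ps P)))).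
rewrite !(comp_pre _ (str _)); congr comp; rewrite !compA; congr (_ ∘ k).
apply: (@mp_monic _ _ cart); rewrite -?compA ?mmap1r ?mmap1 ?mmap2r ?mmap2 //.
by rewrite !compA eg.
Qed.

End StrongTransformations.

(** * Local full faithfulness and cartesian transformations *)

Section LocalEquivalence.
Variables (C : Category) (PB : Pullbacks C) (T : Terminal C) (L : LocallySubcartesian C).
Variable box : forall (X Y : C) (f : X ~> Y), RightAdjoint (nabla L f).

Notation cart := (cartesian_product PB T L).
Notation "⟦ P ⟧" := (poly_functor PB T box P) (at level 0, format "⟦ P ⟧").
Notation gen := (generic PB box).

Section Cells.
Variables (I J : C) (P Q : Poly I J).

Lemma pidx_pcell_generic (α : PolyCell L P Q) :
  pidx PB box Q (MkSlice (ps P)) ∘ (pcell PB T box α (MkSlice (ps P)) ∘ gen P) = ck α.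
Proof. by rewrite pidx_cell pidx_generic compm1. Qed.

Lemma papp_pcell_generic (α : PolyCell L P Q) (Z : C) (w : Z ~> apex α) :
  PApp PB box Q (a := MkSlice (ps P)) (ch α ∘ w)
    (pcell PB T box α (MkSlice (ps P)) ∘ (gen P ∘ (pp P ∘ (cj α ∘ w)))) (cj α ∘ w).
Proof.
apply: papp_cell; last exact: papp_generic.
apply: sep_post2; rewrite pidx_generic compA.
exact: sep_id.
Qed.

(** The image of the generic element has index [ck] and value [cj ∘ w] at [ch ∘ w]. Equal images
    give equal [ck], so both apexes are subpullbacks of one cospan; evaluating then shows that their
    isomorphism also respects [cj]. *)
Lemma poly_cell_eq_of_generic (α β : PolyCell L P Q) :
  pcell PB T box α (MkSlice (ps P)) ∘ gen P = pcell PB T box β (MkSlice (ps P)) ∘ gen P ->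
  poly_cell_eq α β.
Proof.
move=> eg.
have ek : ck α = ck β by rewrite -!pidx_pcell_generic eg.
split=> //; have := cell_subpullback α; rewrite ek => H.
have [i [iso [i1 i2]]] := subpb_unique H (cell_subpullback β).
exists i; split=> //; split=> //.
have H1 := @papp_pcell_generic α _ (idm _); have H2 := @papp_pcell_generic β _ i.
rewrite !compm1 in H1; apply: papp_fun H2 _.
by rewrite i1 (compA _ _ i) i2 !(compA _ (gen P)) -eg -!compA.
Qed.

Lemma pcell_eq (α β : PolyCell L P Q) (a : slice I) :
  poly_cell_eq α β -> pcell PB T box α a = pcell PB T box β a.
Proof.
move=> [ek [i [_ [i1 i2]]]]; apply: papp_ext.
  by rewrite -(compm1 (pcell _ _ _ α _)) -(compm1 (pcell _ _ _ β _)) !pidx_cell ek.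
move=> Z e m c c'; rewrite -{1}(compm1 (pcell _ _ _ α _)) pidx_cell.
move=> /(pcell_elim T) [w [c0 [w1 [s [H1 H2]]]]]; subst e.
rewrite comp1m in H1 H2; rewrite compm1 in s.
move=> /(papp_fun H2) <- H3.
have s' : sep L (pp P ∘ cj β) (pidx PB box P a) (i ∘ w) m.
  by apply: sep_post1; rewrite -compA i1.
have H4 : PApp PB box P (cj β ∘ (i ∘ w)) m c0 by rewrite compA i1.
by have := papp_cell T s' H4; rewrite compA i2 => /papp_fun /(_ H3).
Qed.

(* Applied to a strong transformation with value (k, φ) at the generic element, this forces
   p ∘ φ = ten2, which is the subpullback condition on 2-cells. *)
Lemma generic_diagonal :
  exists D : (MkSlice (ps P) : slice I) ~> act cart (pB P) (MkSlice (ps P)),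
    mp1 cart (pB P) (pE P) ∘ shom D = pp P /\
    exists k : pB P ~> mten cart (pB P) (pB P),
      mp1 cart (pB P) (pB P) ∘ k = idm _ /\ mp2 cart (pB P) (pB P) ∘ k = idm _ /\
      pmap PB T box P D ∘ gen P =
      pst PB T box P (pB P) (MkSlice (ps P)) ∘ (mmap cart (idm _) (gen P) ∘ k).
Proof.
pose d : pE P ~> mten cart (pB P) (pE P) :=
  @pb_lift _ PB _ _ _ (bang T (pB P)) (bang T (pE P)) _ (pp P) (idm _) (bang_ext _ _).
have d1 : mp1 cart (pB P) (pE P) ∘ d = pp P by apply: pb_lift1.
have d2 : mp2 cart (pB P) (pE P) ∘ d = idm _ by apply: pb_lift2.
have ed : arr (act cart (pB P) (MkSlice (ps P))) ∘ d = ps P by rewrite /= -compA d2 compm1.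
pose D : (MkSlice (ps P) : slice I) ~> act cart (pB P) (MkSlice (ps P)) :=
  @MkSliceHom C I (MkSlice (ps P)) (act cart (pB P) (MkSlice (ps P))) d ed.
exists D; split=> //.
pose k : pB P ~> mten cart (pB P) (pB P) :=
  @pb_lift _ PB _ _ _ (bang T (pB P)) (bang T (pB P)) _ (idm _) (idm _) (bang_ext _ _).
have k1 : mp1 cart (pB P) (pB P) ∘ k = idm _ by apply: pb_lift1.
have k2 : mp2 cart (pB P) (pB P) ∘ k = idm _ by apply: pb_lift2.
exists k; split=> //; split=> //; apply: papp_ext.
  by rewrite pidx_fmap pidx_strength (comp_pre _ (mmap2 _ _ _)) k2 compm1.
move=> Z e m c c'; rewrite pidx_fmap pidx_generic => s.
have em : m = pp P ∘ e by rewrite (sep_eq s) comp1m.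
rewrite em -!compA => /papp_fun H.
have {H} -> := H _ (papp_fmap T D (papp_generic PB box e)).
have [|| c1 [f1 [f2 H]]] := @papp_strength _ PB T L box _ _ P (pB P) (MkSlice (ps P)) Z e
    (mmap cart (idm _) (gen P) ∘ (k ∘ (pp P ∘ e))) e.
- apply: sep_post2; rewrite -compA mmap2 (comp_pre1 _ (pidx_generic _ _ P)) comp1m.
  by apply: sep_post2; rewrite k2 -em.
- by rewrite mmap2r (compA _ k) k2 comp1m; apply: papp_generic.
- move=> /(papp_fun H) <-; apply: (@mp_monic _ _ cart).
    by rewrite f1 mmap1r comp1m (compA _ k) k1 comp1m /= compA d1.
  by rewrite f2 /= compA d2 comp1m.
Qed.

Lemma cell_strong_full (θ : StrongTrans ⟦P⟧ ⟦Q⟧) :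
  exists α : PolyCell L P Q, forall a : slice I, cell_trans PB T box α a = θ a.
Proof.
pose s := MkSlice (ps P) : slice I.
pose g := shom (θ s) ∘ gen P.
pose k := pidx PB box Q s ∘ g.
have [φ Hφ] : exists c, PApp PB box Q (a := s) (ten1 L (pp Q) k) (g ∘ ten2 L (pp Q) k) c.
  by apply: papp_total; apply: sep_post2; apply: sep_ten0.
have [D [D1 [d [d1 [d2 eD]]]]] := generic_diagonal.
(* The diagonal identity for the generic element of [P], transported along [θ] by naturality at [D]
   and strength at [pB P]. *)
have eg : pmap PB T box Q D ∘ g =
    pst PB T box Q (pB P) s ∘ (mmap cart (idm _) g ∘ d).
  have nat : pmap PB T box Q D ∘ shom (θ s) = shom (θ (act cart (pB P) s)) ∘ pmap PB T box P D.
    by rewrite !pmapE; exact: (f_equal (@shom _ _ _ _) (tr_nat θ D)).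
  have str : shom (θ (act cart (pB P) s)) ∘ pst PB T box P (pB P) s =
      pst PB T box Q (pB P) s ∘ mmap cart (idm _) (shom (θ s)).
    by rewrite !pstE; exact: (f_equal (@shom _ _ _ _) (tr_strong θ (pB P) s)).
  rewrite /g (comp_pre _ nat) eD (comp_pre _ str) (compA (mmap _ _ _)).
  congr (_ ∘ (_ ∘ _)); apply: (@mp_monic _ _ cart).
    by rewrite mmap1r !mmap1 !comp1m.
  by rewrite mmap2r !mmap2 -compA.
(* Evaluate both sides of [eg] and compare first components: the left gives [pp P ∘ φ], while the
   strength on the right returns the stage [ten2] itself. *)
have pφ : pp P ∘ φ = ten2 L (pp Q) k.
{ have H1 := papp_fmap T D Hφ.
  have [|| c [f1 [f2 H2]]] := @papp_strength _ PB T L box _ _ Q (pB P) s _ (ten1 L (pp Q) k)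
    (mmap cart (idm _) g ∘ (d ∘ ten2 L (pp Q) k)) φ.
  - apply: sep_post2; rewrite -compA mmap2 compA; apply: sep_post2.
    by rewrite -compA d2 compm1; apply: sep_ten0.
  - by rewrite mmap2r (compA _ d) d2 comp1m.
  - have := f1; rewrite mmap1r comp1m (compA _ d) d1 comp1m => <-.
    rewrite -D1 -compA; congr comp; apply: papp_fun H1 _.
    by rewrite compA eg -!compA. }
have es : ps P ∘ φ = ps Q ∘ ten1 L (pp Q) k by rewrite -(papp_arr Hφ).
have et : pt P = pt Q ∘ k.
  have e : pt Q ∘ pidx PB box Q s ∘ shom (θ s) = pt P ∘ pidx PB box P s := shom_arr (θ s).
  by rewrite /k /g compA (comp_pre1 _ e) -compA pidx_generic compm1.
have esub : is_subpullback L (pp Q) k (ten1 L (pp Q) k) (pp P ∘ φ).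
  by rewrite pφ; apply: is_subpullback_ten.
pose α : PolyCell L P Q := @MkPolyCell C L I J P Q (@MkPolyCellData C I J P Q _ φ (ten1 L (pp Q) k) k) es et esub.
exists α; apply: (@strong_trans_ext _ PB T L box _ _ P Q (cell_strong PB T box α) θ).
have -> : shom (cell_strong PB T box α (MkSlice (ps P))) = pcell PB T box α s by rewrite pcellE.
apply: papp_ext; first by rewrite pidx_pcell_generic.
move=> Z e m c c'; rewrite pidx_pcell_generic => -[u [u1 u2]].
have := @papp_pcell_generic α _ u.
have -> : pp P ∘ (cj α ∘ u) = m by rewrite compA [pp P ∘ _]pφ.
have -> : ch α ∘ u = e by [].
rewrite compA => H /(papp_fun H) <-.
by move: (papp_pre u Hφ); rewrite -compA [ten1 _ _ _ ∘ u]u1 [ten2 _ _ _ ∘ u]u2; apply: papp_fun.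
Qed.

(** With [r] inverse to [cj α], an argument [e] of [P] is [cj α ∘ (r ∘ e)], so its value can be read
    off after the 2-cell at [ch α ∘ (r ∘ e)]. The lift of a cone therefore takes its index from [z2]
    and its values from [z1]. *)
Lemma cartesian_of_subcartesian (α : PolyCell L P Q) :
  is_subcartesian_cell α -> is_cartesian_trans (cell_strong PB T box α).
Proof.
move=> [r [rj jr]] a b u; split; first exact: tr_nat.
have uniq M (y y' : M ~> pdom PB box P a) :
    pcell PB T box α a ∘ y = pcell PB T box α a ∘ y' ->
    pmap PB T box P u ∘ y = pmap PB T box P u ∘ y' -> y = y'.
  move=> e1 e2; apply: papp_ext; first by rewrite -!(pidx_fmap T u) e2.
  move=> Z e m c c' s H1 H2.
  have ee : cj α ∘ (r ∘ e) = e by rewrite compA jr comp1m.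
  have s1 := sep_precomp_iso jr s; rewrite -ee in H1 H2.
  have H3 := papp_cell T (sep_post2 s1) H1.
  have e3 : pidx PB box P a ∘ y = pidx PB box P a ∘ y' by rewrite -!(pidx_fmap T u) e2.
  rewrite e3 in s1; have H4 := papp_cell T (sep_post2 s1) H2.
  by apply: papp_fun H3 _; rewrite (compA _ y) e1 -(compA _ y').
move=> Z z1 z2 ez.
have {}ez : pmap PB T box Q u ∘ shom z1 = pcell PB T box α b ∘ shom z2.
  by rewrite pmapE pcellE; exact: (f_equal (@shom _ _ _ _) ez).
pose v := pidx PB box P b ∘ shom z2.
have ev : pidx PB box Q a ∘ shom z1 = ck α ∘ v.
  by rewrite -(pidx_fmap T u) ez pidx_cell.
have key W (e : W ~> pE P) m : sep L (pp P) v e m ->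
    sep L (pp Q) (pidx PB box Q a) (ch α ∘ (r ∘ e)) (shom z1 ∘ m).
  move=> /(sep_precomp_iso jr) /(sep_paste_inv (cell_subpullback α)).
  by rewrite -ev => /sep_post2.
have [φ Hφ] := papp_total (key _ _ _ (sep_ten0 L (pp P) v)).
have [|y [y1 y2]] := @papp_abs _ PB L box _ _ P a _ v φ.
  by rewrite (papp_arr Hφ) compA -(cell_s α) -compA (compA _ r) jr comp1m.
have mapy : pmap PB T box P u ∘ y = shom z2.
  apply: papp_ext; first by rewrite pidx_fmap y1.
  move=> W e m c c'; rewrite pidx_fmap y1 => s.
  have [x [x1 x2]] := s.
  have := y2 _ x; rewrite x1 x2 => /(papp_fmap T u); rewrite compA => H /(papp_fun H) <- H'.
  have s1 := sep_post2 (sep_precomp_iso jr s).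
  rewrite -(comp1m e) -jr -compA in H'; have H1 := papp_cell T s1 H'.
  have := papp_fmap T u (papp_pre x Hφ).
  rewrite -!compA x1 x2 => H2; apply: papp_fun H2 _.
  by rewrite (compA _ (shom z1)) ez -(compA _ (shom z2)).
have celly : pcell PB T box α a ∘ y = shom z1.
  apply: papp_ext; first by rewrite pidx_cell y1.
  move=> W e m c c'; rewrite pidx_cell => /(pcell_elim T) [w [c0 [w1 [s [H1 H2]]]]].
  rewrite -compA => /(papp_fun H2) <-.
  rewrite y1 in s; have [x [x1 x2]] := sep_post1 s.
  have := y2 _ x; rewrite x1 x2 => /(papp_fun H1) ->.
  have := papp_pre x Hφ; rewrite -!compA x1 x2 (compA r) rj comp1m w1 => H3.
  exact: papp_fun H3.
have ey : arr (⟦P⟧ a) ∘ y = arr Z.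
  have e2 : pt P ∘ pidx PB box P b ∘ shom z2 = arr Z := shom_arr z2.
  have -> : arr (⟦P⟧ a) = pt P ∘ pidx PB box P a by [].
  by rewrite -compA y1 compA.
exists (@MkSliceHom C J Z (⟦P⟧ a) y ey); split.
  split; apply: slice_hom_eq.
    by rewrite pcellE in celly.
  by rewrite pmapE in mapy.
move=> y' [c1 c2]; apply: slice_hom_eq => /=; apply: uniq.
  by rewrite celly pcellE; exact: esym (f_equal (@shom _ _ _ _) c1).
by rewrite mapy pmapE; exact: esym (f_equal (@shom _ _ _ _) c2).
Qed.

(** Cartesianness is used only at maps into the terminal object of the slice over [I]. The inverse
    of [cj α] is the value of a lifted element whose image under the 2-cell is the tautological
    element at the apex. *)
Lemma subcartesian_of_cartesian (α : PolyCell L P Q) :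
  is_cartesian_trans (cell_strong PB T box α) -> is_subcartesian_cell α.
Proof.
move=> cart_α.
pose one_I : slice I := MkSlice (idm I).
pose bng (a : slice I) : a ~> one_I := @MkSliceHom C I a one_I (arr a) (comp1m _).
(* At the terminal object values are forced, so an element there is just an index and a cone amounts
   to one equation between indices. *)
have lift (a : slice I) M (z1 : M ~> pdom PB box Q a) (z2 : M ~> pdom PB box P one_I) :
    pidx PB box Q a ∘ z1 = ck α ∘ (pidx PB box P one_I ∘ z2) ->
    exists y : M ~> pdom PB box P a, pcell PB T box α a ∘ y = z1 /\
      pmap PB T box P (bng a) ∘ y = z2 /\
      forall y' : M ~> pdom PB box P a, pcell PB T box α a ∘ y' = z1 ->
        pmap PB T box P (bng a) ∘ y' = z2 -> y' = y.
{ move=> ei.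
  have ez : pmap PB T box Q (bng a) ∘ z1 = pcell PB T box α one_I ∘ z2.
    apply: papp_ext; first by rewrite pidx_fmap pidx_cell.
    by move=> Z e m c c' _ /papp_arr /= + /papp_arr /=; rewrite !comp1m => -> ->.
  have [_ univ] := cart_α a one_I (bng a).
  pose MM : slice J := MkSlice (pt P ∘ (pidx PB box P one_I ∘ z2)).
  have e1 : arr (⟦Q⟧ a) ∘ z1 = arr MM.
    have -> : arr (⟦Q⟧ a) = pt Q ∘ pidx PB box Q a by [].
    by rewrite -compA ei /= (cell_t α) -!compA.
  have e2 : arr (⟦P⟧ one_I) ∘ z2 = arr MM.
    have -> : arr (⟦P⟧ one_I) = pt P ∘ pidx PB box P one_I by [].
    by rewrite -compA.
  have [|y [[c1 c2] uq]] := univ MM (@MkSliceHom C J MM (⟦Q⟧ a) z1 e1)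
    (@MkSliceHom C J MM (⟦P⟧ one_I) z2 e2).
    by apply: slice_hom_eq; rewrite pmapE pcellE in ez.
  exists (shom y); split; last split.
  - by rewrite pcellE; exact: (f_equal (@shom _ _ _ _) c1).
  - by rewrite pmapE; exact: (f_equal (@shom _ _ _ _) c2).
  - move=> y' c1' c2'.
    have ey : arr (⟦P⟧ a) ∘ y' = arr MM.
      have -> : arr (⟦P⟧ a) = pt P ∘ pidx PB box P a by [].
      by rewrite -compA -(pidx_fmap T (bng a)) c2'.
    have -> // : y = @MkSliceHom C J MM (⟦P⟧ a) y' ey.
    apply: uq; split; apply: slice_hom_eq.
      by rewrite pcellE in c1'.
    by rewrite pmapE in c2'. }
pose s : slice I := MkSlice (ps P).
pose x : slice I := MkSlice (ps Q ∘ ch α).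
pose j : x ~> s := @MkSliceHom C I x s (cj α) (cell_s α).
have subpb := cell_subpullback α.
have [i [i1 i2]] := sep_subpullback subpb (sep_ten0 L (pp Q) (ck α)).
(* The tautological element: index [ck α], and value [w] at the argument [ch α ∘ w]. *)
have [|z1 [z11 z12]] := @papp_abs _ PB L box _ _ Q x _ (ck α) i; first by rewrite /= -compA i1.
have {}z12 Z (w : Z ~> apex α) :
    PApp PB box Q (a := x) (ch α ∘ w) (z1 ∘ (pp P ∘ (cj α ∘ w))) w.
  have [u [u1 u2]] := sep_pre w (subpb_sep subpb).
  have := z12 _ u; rewrite u1 u2.
  have -> : i ∘ u = w.
    by apply: (subpb_monic subpb); rewrite compA ?i1 ?i2 ?u1 ?u2.
  by rewrite -compA.
pose z2 := pmap PB T box P (bng s) ∘ gen P.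
have iz2 : pidx PB box P one_I ∘ z2 = idm _ by rewrite pidx_fmap pidx_generic.
have [|y [y1 [y2 _]]] := lift x _ z1 z2; first by rewrite z11 iz2 compm1.
have iy : pidx PB box P x ∘ y = idm _ by rewrite -(pidx_fmap T (bng x)) y2 iz2.
have sepy Z (e : Z ~> pE P) : sep L (pp P) (pidx PB box P x) e (y ∘ (pp P ∘ e)).
  by apply: sep_post2; rewrite iy; apply: sep_id.
(* The lift [y] has identity index, so at stage [pp P] it can be applied to the identity of
   [pE P]. *)
have [r Hr] := papp_total (sepy _ (idm _)); rewrite compm1 in Hr.
(* Both are lifts at [s] of the same cone, so uniqueness applies. Evaluating this equation gives
   [cj α ∘ r = id]; evaluating [y1] gives [r ∘ cj α = id]. *)
have jy : pmap PB T box P j ∘ y = gen P.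
  have [|y0 [_ [_ uq]]] := lift s _ (pcell PB T box α s ∘ gen P) z2.
    by rewrite pidx_pcell_generic iz2 compm1.
  rewrite (uq (gen P)) //; apply: uq.
    rewrite (comp_pre _ (esym (pcell_natural PB T box α j))) y1.
    apply: papp_ext; first by rewrite pidx_fmap z11 pidx_pcell_generic.
    move=> Z e m c c'; rewrite pidx_fmap z11 => /(sep_subpullback subpb) [w [w1 w2]].
    rewrite -compA in w2; rewrite -w1 -w2.
    have := papp_fmap T j (z12 _ w); rewrite compA => H /(papp_fun H) <-.
    by apply: papp_fun; rewrite -compA; apply: papp_pcell_generic.
  apply: papp_ext; first by rewrite !pidx_fmap iy pidx_generic.
  by move=> Z e m c c' _ /papp_arr /= + /papp_arr /=; rewrite !comp1m => -> ->.
exists r; split.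
  have H1 := papp_pre (cj α) Hr; rewrite comp1m -compA in H1.
  have := @papp_cell _ PB T _ box _ _ P Q α x _ (idm _) (y ∘ (pp P ∘ cj α)) (r ∘ cj α).
  rewrite !compm1 => H2.
  have {H1}H2 := fun s => H2 s H1.
  have s1 : sep L (pp P ∘ cj α) (pidx PB box P x) (idm _) (y ∘ (pp P ∘ cj α)).
    apply: sep_post2; rewrite iy.
    by have := sep_id L (pp P ∘ cj α) (idm _); rewrite compm1.
  have := H2 s1; rewrite compA y1 => H3; apply: papp_fun H3 _.
  by have := z12 _ (idm _); rewrite !compm1.
have := papp_fmap T j Hr; rewrite compA jy => H1; apply: papp_fun H1 _.
by have := papp_generic PB box (idm (pE P)); rewrite compm1.
Qed.

End Cells.
End LocalEquivalence.

Lemma slice_iso (C : Category) (X : C) (a b : slice X) (u : a ~> b) :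
  is_iso (shom u) -> is_iso u.
Proof.
move=> [v [vu uv]].
have e : arr a ∘ v = arr b by rewrite -(shom_arr u) -compA uv compm1.
by exists (@MkSliceHom C X b a v e); split; apply: slice_hom_eq.
Qed.

(** * Composites and identities *)

Section Composition.
Variables (C : Category) (PB : Pullbacks C) (T : Terminal C) (L : LocallySubcartesian C).
Variable box : forall (X Y : C) (f : X ~> Y), RightAdjoint (nabla L f).

Notation cart := (cartesian_product PB T L).
Notation "⟦ P ⟧" := (poly_functor PB T box P) (at level 0, format "⟦ P ⟧").
Notation gen := (generic PB box).

Section Comparison.
Variables (I J K : C) (Q : Poly J K) (P : Poly I J).

Local Notation b := (pc_b PB box Q P).
Local Notation w' := (pc_w' PB box Q P).
Local Notation d := (pc_e PB box Q P).
Local Notation p' := (pc_p' PB box Q P).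
Local Notation a' := (pc_a PB box Q P).
Local Notation m' := (pc_m' PB Q P).
Local Notation QP := (poly_comp PB box Q P).

(** By definition R is the domain of ⟦Q⟧ at the slice object [pt P], with [b] as index. Points of R
    can therefore be compared by extensionality, their values being the maps [m' ∘ d ∘ τ] into the
    base of [P]. *)
Lemma papp_dist (Z : C) (τ : Z ~> pc_T PB box Q P) :
  PApp PB box Q (a := MkSlice (pt P)) (ten1 L (pp Q) b ∘ τ) (ten2 L (pp Q) b ∘ τ)
    (m' ∘ d ∘ τ).
Proof. by exists (d ∘ τ); rewrite compA; split=> //; exists τ. Qed.

(* a' ∘ κ is separated from the generic stage V = ten w' v, but in general not from the identity
   of Z; values of pcomp therefore have to be taken at V. *)
Lemma sep_composite_elim (M Z : C) (v : M ~> pc_R PB box Q P) (κ : Z ~> pc_A PB box Q P)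
    (m : Z ~> M) :
  sep L (w' ∘ p') v κ m ->
  exists (V : C) (τ : V ~> pc_T PB box Q P) (n : V ~> M) (u : Z ~> V),
    sep L (pp Q) (b ∘ v) (ten1 L (pp Q) b ∘ τ) n /\ ten2 L (pp Q) b ∘ τ = v ∘ n /\
    n ∘ u = m /\ τ ∘ u = p' ∘ κ /\ sep L (pp P) (m' ∘ d ∘ τ) (a' ∘ κ) u.
Proof.
move=> /sep_bin [u [u1 [u2 us]]].
exists (ten L w' v), (ten1 L w' v), (ten2 L w' v), u; split.
  by apply: (sep_paste_inv (is_subpullback_ten L (pp Q) b)); apply: sep_ten0.
split; first exact: ten_comm.
split=> //; split=> //.
exact: (sep_paste_inv (is_subpullback_ten L (pp P) (m' ∘ d)) us).
Qed.

(** Combines [papp_comp_compare] with totality, so that the value at every admissible second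
    argument comes with the corresponding value of [y] at [κ]. *)
Lemma pcomp_elim (x : slice I) (M Z : C) (y : M ~> pdom PB box QP x) (e : Z ~> pE Q)
    (m : Z ~> M) :
  sep L (pp Q) (b ∘ (pidx PB box QP x ∘ y)) e m ->
  exists (τ : Z ~> pc_T PB box Q P) (z : Z ~> pdom PB box P x),
    ten1 L (pp Q) b ∘ τ = e /\
    ten2 L (pp Q) b ∘ τ = pidx PB box QP x ∘ (y ∘ m) /\
    PApp PB box Q (a := ⟦P⟧ x) e (pcomp PB T box Q P x ∘ (y ∘ m)) z /\
    pidx PB box P x ∘ z = m' ∘ d ∘ τ /\
    forall (W : C) (g : W ~> Z) (e2 : W ~> pE P),
      sep L (pp P) (m' ∘ d ∘ τ) e2 g ->
      exists (κ : W ~> pc_A PB box Q P) (c : W ~> dom x),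
        a' ∘ κ = e2 /\ p' ∘ κ = τ ∘ g /\
        sep L (w' ∘ p') (pidx PB box QP x ∘ y) κ (m ∘ g) /\
        PApp PB box QP κ (y ∘ (m ∘ g)) c /\ PApp PB box P e2 (z ∘ g) c.
Proof.
move=> s.
have [τ0 [t1 [t2 ts]]] := sep_paste (is_subpullback_ten L (pp Q) b) s.
have s' : sep L (pp Q) (b ∘ pidx PB box QP x) e (y ∘ m).
  by apply: sep_post2; rewrite -compA.
have [τ [z [z1 [z2 [z3 [z4 [z5 _]]]]]]] := papp_comp_compare T s'.
have eτ : τ = τ0.
  by apply: (@ten_monic _ L); rewrite ?t1 ?z1 // z2 t2 compA.
subst τ0; exists τ, z; split=> //; split=> //; split=> //; split=> //.
move=> W g e2 /(sep_paste (is_subpullback_ten L (pp P) (m' ∘ d))) [κ [k1 [k2 ks]]].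
have sk : sep L (w' ∘ p') (pidx PB box QP x ∘ y) κ (m ∘ g).
  have [v [v1 v2]] := ts; rewrite -v1 in ks.
  by rewrite -v2 -compA; apply: sep_bin_inv; apply: sep_post2.
have [c Hc] := @papp_total _ PB L box _ _ QP x W κ _ (sep_post2 sk).
exists κ, c; split=> //; split=> //; split=> //; split=> //.
by rewrite -k1; apply: z5; rewrite // -compA.
Qed.

Lemma pp_ext (x : slice I) (M : C) (y y' : M ~> pdom PB box Q (⟦P⟧ x)) :
  pidx PB box Q (⟦P⟧ x) ∘ y = pidx PB box Q (⟦P⟧ x) ∘ y' ->
  (forall (Z : C) (e : Z ~> pE Q) (m : Z ~> M) (z z' : Z ~> pdom PB box P x),
    sep L (pp Q) (pidx PB box Q (⟦P⟧ x) ∘ y) e m ->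
    PApp PB box Q (a := ⟦P⟧ x) e (y ∘ m) z -> PApp PB box Q (a := ⟦P⟧ x) e (y' ∘ m) z' ->
    pidx PB box P x ∘ z = pidx PB box P x ∘ z' /\
    forall (W : C) (g : W ~> Z) (e2 : W ~> pE P) (c c' : W ~> dom x),
      sep L (pp P) (pidx PB box P x ∘ z) e2 g ->
      PApp PB box P e2 (z ∘ g) c -> PApp PB box P e2 (z' ∘ g) c' -> c = c') ->
  y = y'.
Proof.
move=> ei H; apply: papp_ext ei _ => Z e m z z' s H1 H2.
have [e1 e2] := H _ _ _ _ _ s H1 H2.
by apply: papp_ext e1 _ => W e' g c c'; apply: e2.
Qed.

Lemma pcomp_natural (a c : slice I) (f : a ~> c) :
  pmap PB T box Q (fmap ⟦P⟧ f) ∘ pcomp PB T box Q P a =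
  pcomp PB T box Q P c ∘ pmap PB T box QP f.
Proof.
have ei z : pidx PB box QP c ∘ pmap PB T box QP f ∘ z = pidx PB box QP a ∘ z.
  by move=> *; rewrite -compA pidx_fmap.
have e0 : pidx PB box QP c ∘ pmap PB T box QP f = pidx PB box QP a.
  by have := ei _ (idm _); rewrite !compm1.
have e1 : pidx PB box Q (⟦P⟧ a) ∘ pcomp PB T box Q P a = b ∘ pidx PB box QP a.
  by rewrite -(compm1 (pcomp _ _ _ _ _ _)) pidx_comp_compare compm1.
apply: pp_ext; first by rewrite pidx_fmap pidx_comp_compare e0 e1.
move=> Z e m z z'; rewrite pidx_fmap e1 => s.
have [|τ [z1 [t1 [t2 [H1 [i1 U1]]]]]] := @pcomp_elim a _ _ (idm _) e m; first by rewrite compm1.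
have [|τ2 [z2 [t12 [t22 [H2 [i2 U2]]]]]] := @pcomp_elim c _ _ (pmap PB T box QP f) e m.
  by rewrite e0.
have eτ : τ2 = τ.
  by apply: (@ten_monic _ L); rewrite ?t1 ?t12 // t2 t22 compA e0 comp1m.
subst τ2; rewrite comp1m in H1; rewrite -!compA => H3 H4.
have := papp_fmap T (fmap ⟦P⟧ f) H1; rewrite -pmapE => /(papp_fun H3) -> {H3}.
rewrite (papp_fun H4 H2) {H4}; split; first by rewrite pidx_fmap i1 i2.
move=> W g e2 k k'; rewrite pidx_fmap i1 => s2.
have [κ [c1 [k1 [k2 [_ [H3 H4]]]]]] := U1 _ _ _ s2.
have [κ' [c2 [k1' [k2' [_ [H3' H4']]]]]] := U2 _ _ _ s2.
have ek : κ' = κ by apply: (@ten_monic _ L); rewrite ?[LHS]k1' ?[LHS]k2' ?[RHS]k1 ?[RHS]k2.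
subst κ'; rewrite -compA => H5 /(papp_fun H4') <-.
rewrite (papp_fun H5 (papp_fmap T f H4)).
rewrite comp1m in H3; exact: papp_fun (papp_fmap T f H3) H3'.
Qed.

Lemma pcomp_strong (X : C) (a : slice I) :
  pcomp PB T box Q P (act cart X a) ∘ pst PB T box QP X a =
  pmap PB T box Q (st (cartesian_strength ⟦P⟧) X a) ∘ pst PB T box Q X (⟦P⟧ a) ∘
    mmap cart (idm X) (pcomp PB T box Q P a).
Proof.
have e0 : pidx PB box QP (act cart X a) ∘ pst PB T box QP X a =
    pidx PB box QP a ∘ mp2 cart X (pdom PB box QP a).
  by rewrite -(compm1 (pst _ _ _ _ _ _)) pidx_strength compm1.
apply: pp_ext.
  by rewrite pidx_comp_compare -compA pidx_fmap pidx_strength mmap2 pidx_comp_compare e0.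
move=> Z e m z z'; rewrite pidx_comp_compare => s.
have [τ [z1 [t1 [t2 [H1 [i1 U1]]]]]] := pcomp_elim s.
have [|τ2 [z2 [t12 [t22 [H2 [i2 U2]]]]]] := @pcomp_elim a _ _ (mp2 cart X _) e m.
  by rewrite -e0.
have eτ : τ2 = τ.
  by apply: (@ten_monic _ L); rewrite ?t1 ?t12 // t2 t22 !compA e0.
subst τ2; rewrite -!compA => /(papp_fun H1) <-.
have [|| z3 [f1 [f2 H3]]] := @papp_strength _ PB T L box _ _ Q X (⟦P⟧ a) Z e
    (mmap cart (idm X) (pcomp PB T box Q P a) ∘ m) z2.
- apply: sep_post2; rewrite -compA mmap2 pidx_comp_compare.
  by rewrite e0 in s.
- by rewrite mmap2r.
- rewrite mmap1r comp1m in f1.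
  have := papp_fmap T (st (cartesian_strength ⟦P⟧) X a) H3; rewrite -pstE.
  move=> H4 /(papp_fun H4) <-; split.
    by rewrite pidx_strength [mp2 _ _ _ ∘ z3]f2 i1 i2.
  move=> W g e2 c c'; rewrite i1 => s2.
  have [κ [c1 [k1 [k2 [ks [H5 H6]]]]]] := U1 _ _ _ s2.
  have [κ' [c2 [k1' [k2' [ks' [H5' H6']]]]]] := U2 _ _ _ s2.
  have ek : κ' = κ by apply: (@ten_monic _ L); rewrite ?[LHS]k1' ?[LHS]k2' ?[RHS]k1 ?[RHS]k2.
  subst κ'; move=> /(papp_fun H6) <-.
  have [c3 [g1 [g2 H7]]] := @papp_strength _ PB T L box _ _ QP X a W κ (m ∘ g) c2 ks' H5'.
  rewrite (papp_fun H5 H7).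
  have [|| c4 [h1 [h2 H8]]] := @papp_strength _ PB T L box _ _ P X a W e2 (z3 ∘ g) c2.
  + apply: sep_post2; rewrite -compA.
    by rewrite [mp2 _ _ _ ∘ z3]f2 i2.
  + by rewrite compA [mp2 _ _ _ ∘ z3]f2.
  + rewrite -compA => /(papp_fun H8) <-.
    apply: (@mp_monic _ _ cart); last by rewrite g2 h2.
    by rewrite g1 h1 compA [in RHS]compA f1.
Qed.

(** The curried element determines the index in R through the indices of its values, and then the
    values at all [κ]. *)
Lemma pcomp_injective (x : slice I) (M : C) (y y' : M ~> pdom PB box QP x) :
  pcomp PB T box Q P x ∘ y = pcomp PB T box Q P x ∘ y' -> y = y'.
Proof.
move=> ey.
have eb : b ∘ (pidx PB box QP x ∘ y) = b ∘ (pidx PB box QP x ∘ y').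
  by rewrite -!(pidx_comp_compare T) ey.
(* The equality [τ = τ'] is a premise of the last clause: it is available only once the indices in R
   agree, which is deduced from the preceding clauses. *)
have key (Z : C) (e : Z ~> pE Q) (m : Z ~> M) :
    sep L (pp Q) (b ∘ (pidx PB box QP x ∘ y)) e m ->
    exists (τ τ' : Z ~> pc_T PB box Q P) (z : Z ~> pdom PB box P x),
      ten1 L (pp Q) b ∘ τ = e /\ ten1 L (pp Q) b ∘ τ' = e /\
      ten2 L (pp Q) b ∘ τ = pidx PB box QP x ∘ (y ∘ m) /\
      ten2 L (pp Q) b ∘ τ' = pidx PB box QP x ∘ (y' ∘ m) /\
      m' ∘ d ∘ τ = m' ∘ d ∘ τ' /\
      forall (W : C) (g : W ~> Z) (κ : W ~> pc_A PB box Q P) (c c' : W ~> dom x),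
        τ = τ' -> p' ∘ κ = τ ∘ g -> sep L (pp P) (m' ∘ d ∘ τ) (a' ∘ κ) g ->
        PApp PB box QP κ (y ∘ (m ∘ g)) c -> PApp PB box QP κ (y' ∘ (m ∘ g)) c' -> c = c'.
  move=> s; have s' := s; rewrite eb in s'.
  have [τ [z [t1 [t2 [H1 [i1 U1]]]]]] := pcomp_elim s.
  have [τ' [z' [t1' [t2' [H1' [i1' U1']]]]]] := pcomp_elim s'.
  have ez : z' = z by apply: papp_fun H1' _; rewrite compA -ey -compA.
  subst z'; exists τ, τ', z; do 4!split=> //; split; first by rewrite -i1 -i1'.
  move=> W g κ c c' eτ kτ s2 H2 H3; subst τ'.
  have [κ1 [c1 [k1 [k2 [_ [H5 H6]]]]]] := U1 _ _ _ s2.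
  have [κ2 [c2 [k1' [k2' [_ [H5' H6']]]]]] := U1' _ _ _ s2.
  have ek1 : κ1 = κ by apply: (@ten_monic _ L); rewrite ?[LHS]k1 ?[LHS]k2.
  have ek2 : κ2 = κ by apply: (@ten_monic _ L); rewrite ?[LHS]k1' ?[LHS]k2'.
  subst κ1 κ2; rewrite (papp_fun H2 H5) (papp_fun H3 H5'); exact: papp_fun H6 H6'.
(* Points of R are elements of ⟦Q⟧ at [pt P], hence extensionality for [Q]. *)
have ei : pidx PB box QP x ∘ y = pidx PB box QP x ∘ y'.
  apply: (@papp_ext _ PB L box _ _ Q (MkSlice (pt P))); first exact: eb.
  move=> Z e m c c' s.
  have [τ [τ' [z [t1 [t1' [t2 [t2' [et _]]]]]]]] := key _ _ _ s.
  have := papp_dist τ; rewrite t1 t2 compA => H /(papp_fun H) <-.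
  by have := papp_dist τ'; rewrite t1' t2' compA => H' /(papp_fun H') <-.
apply: (papp_ext ei) => Z κ m c c' /sep_composite_elim [V [τ0 [n [u [s [nv [nu [τu s2]]]]]]]].
have [τ [τ' [z [t1 [t1' [t2 [t2' [et U]]]]]]]] := key _ _ _ s.
have eτ : τ = τ' by apply: (@ten_monic _ L); rewrite ?t1 ?t1' // t2 t2' !compA ei.
have eτ0 : τ = τ0 by apply: (@ten_monic _ L); rewrite ?t1 // t2 nv compA.
rewrite -nu; apply: U => //; by rewrite eτ0.
Qed.

(** Uncurrying. [ζ] is the value of [z] at its universal argument; the index [ρ] into R records the
    indices of [ζ], and [φ] applies [ζ] to the second argument. *)
Lemma pcomp_surjective (x : slice I) (M : C) (z : M ~> pdom PB box Q (⟦P⟧ x)) :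
  exists y : M ~> pdom PB box QP x, pcomp PB T box Q P x ∘ y = z.
Proof.
pose v := pidx PB box Q (⟦P⟧ x) ∘ z.
have [ζ Hζ] : exists ζ, PApp PB box Q (a := ⟦P⟧ x) (ten1 L (pp Q) v) (z ∘ ten2 L (pp Q) v) ζ.
  by apply: papp_total; apply: sep_post2; apply: sep_ten0.
have [|ρ [ρ1 ρ2]] := @papp_abs _ PB L box _ _ Q (MkSlice (pt P)) M v (pidx PB box P x ∘ ζ).
  by have := papp_arr Hζ => /= <-; rewrite compA.
have bρ : b ∘ ρ = v by [].
have value (Z : C) (τ : Z ~> pc_T PB box Q P) (n : Z ~> M) (u : Z ~> ten L (pp Q) v) :
    ten2 L (pp Q) b ∘ τ = ρ ∘ n -> ten1 L (pp Q) v ∘ u = ten1 L (pp Q) b ∘ τ ->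
    ten2 L (pp Q) v ∘ u = n -> m' ∘ d ∘ τ = pidx PB box P x ∘ (ζ ∘ u).
  move=> e1 e2 e3; have := papp_dist τ; rewrite e1.
  by have := ρ2 _ u; rewrite e2 e3 -(compA _ ζ) => H1 H2; apply: papp_fun H2 H1.
(* [φ] is defined at the universal argument of the composite, through the stage V of
   [sep_composite_elim]. The second clause frees it from that stage: any other splitting of [κ]
   gives the same point of [ten L (pp Q) v]. *)
have [φ [Hφ1 Hφ2]] : exists φ : ten L (w' ∘ p') ρ ~> dom x,
    arr x ∘ φ = ps P ∘ a' ∘ ten1 L (w' ∘ p') ρ /\
    forall (Z V : C) (κ : Z ~> pc_A PB box Q P) (n : V ~> M) (τ : V ~> pc_T PB box Q P)
      (u : V ~> ten L (pp Q) v) (g : Z ~> V) (t : Z ~> ten L (w' ∘ p') ρ),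
      ten1 L (pp Q) v ∘ u = ten1 L (pp Q) b ∘ τ -> ten2 L (pp Q) v ∘ u = n ->
      p' ∘ κ = τ ∘ g ->
      ten1 L (w' ∘ p') ρ ∘ t = κ -> ten2 L (w' ∘ p') ρ ∘ t = n ∘ g ->
      PApp PB box P (a' ∘ κ) (ζ ∘ (u ∘ g)) (φ ∘ t).
  have [V [τ0 [n [u [s0 [nv [nu [τu s2]]]]]]]] :=
    sep_composite_elim (sep_ten0 L (w' ∘ p') ρ).
  rewrite bρ in s0; have [u0 [u01 u02]] := s0.
  have [φ Hφ] : exists φ, PApp PB box P (a' ∘ ten1 L (w' ∘ p') ρ) (ζ ∘ (u0 ∘ u)) φ.
    apply: papp_total; rewrite compA; apply: sep_post2.
    by rewrite -(value _ τ0 n).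
  exists φ; split; first by rewrite (papp_arr Hφ) compA.
  move=> Z V' κ n' τ u' g t e1 e2 e3 e4 e5.
  have := papp_pre t Hφ; rewrite -!compA e4.
  suff -> : u' ∘ g = u0 ∘ (u ∘ t) by [].
  apply: (@ten_monic _ L).
    by rewrite !compA e1 u01 -!compA (compA τ0) τu -e3 -compA e4.
  by rewrite !compA e2 u02 nu.
have [y [y1 y2]] := @papp_abs _ PB L box _ _ QP x M ρ φ Hφ1.
exists y; have iy : b ∘ (pidx PB box QP x ∘ y) = v by rewrite y1.
apply: pp_ext; first by rewrite pidx_comp_compare iy.
move=> Z e m z1 z2; rewrite pidx_comp_compare iy => s.
have [|τ [z3 [t1 [t2 [H1 [i1 U]]]]]] := @pcomp_elim x _ _ y e m; first by rewrite iy.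
rewrite -compA => /(papp_fun H1) <-.
have [u [u1 u2]] := s.
have := papp_pre u Hζ; rewrite -compA u1 u2 => H2 /(papp_fun H2) <-.
have ev : m' ∘ d ∘ τ = pidx PB box P x ∘ (ζ ∘ u).
  apply: (value _ τ m u) => //; last by rewrite u1 t1.
  by rewrite t2 compA y1.
split; first by rewrite i1 ev.
move=> W g e2 c c'; rewrite i1 => /U [κ [c1 [k1 [k2 [ks [H3 H4]]]]]] /(papp_fun H4) <-.
rewrite y1 in ks; have [t [t3 t4]] := ks.
have := Hφ2 _ _ κ m τ u g t; rewrite u1 t1 k1 -compA => H5.
have {H5} := H5 erefl u2 k2 t3 t4 => /papp_fun H5 /H5 <-.
by have := y2 _ t; rewrite t3 t4; apply: papp_fun.
Qed.

(** Surjectivity at the identity gives a right inverse, and injectivity makes it two-sided. *)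
Lemma pcomp_iso (x : slice I) : is_iso (comp_compare PB T box Q P x).
Proof.
apply: slice_iso; rewrite -pcompE.
have [y ey] := pcomp_surjective (idm (pdom PB box Q (⟦P⟧ x))).
exists y; split=> //; apply: pcomp_injective.
by rewrite compA ey comp1m compm1.
Qed.

Definition comp_strong : StrongTrans ⟦QP⟧ (comp_bunched ⟦Q⟧ ⟦P⟧).
Proof.
refine (@Build_StrongTrans _ _ _ _ _ _ ⟦QP⟧ (comp_bunched ⟦Q⟧ ⟦P⟧) (comp_compare PB T box Q P) _ _).
- by move=> x y u; apply: slice_hom_eq; have := pcomp_natural u; rewrite !pmapE !pcompE.
- by move=> X x; apply: slice_hom_eq; have := pcomp_strong X x; rewrite pmapE !pstE !pcompE.
Defined.

End Comparison.

Section Unit.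
Variable I : C.

Lemma punit_natural (a c : slice I) (f : a ~> c) :
  shom f ∘ punit PB T box a = punit PB T box c ∘ pmap PB T box (poly_id I) f.
Proof.
have H1 := papp_unit T (idm (pdom PB box (poly_id I) a)).
have := papp_unit T (pmap PB T box (poly_id I) f).
have := papp_fmap T f H1; rewrite !compm1.
have -> : pidx PB box (poly_id I) c ∘ pmap PB T box (poly_id I) f = pidx PB box (poly_id I) a.
  by rewrite -(compm1 (pmap _ _ _ _ _)) pidx_fmap compm1.
exact: papp_fun.
Qed.

Lemma punit_strong (X : C) (a : slice I) :
  punit PB T box (act cart X a) ∘ pst PB T box (poly_id I) X a =
  mmap cart (idm X) (punit PB T box a).
Proof.
have s : sep L (pp (poly_id I)) (pidx PB box (poly_id I) a ∘ mp2 cart X _)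
    (pidx PB box (poly_id I) a ∘ mp2 cart X _) (idm _).
  by have := sep_sym (sep_id L (pidx PB box (poly_id I) a ∘ mp2 cart X _) (idm _)); rewrite compm1.
have H : PApp PB box (poly_id I) (pidx PB box (poly_id I) a ∘ mp2 cart X _)
    (mp2 cart X (pdom PB box (poly_id I) a) ∘ idm _) (punit PB T box a ∘ mp2 cart X _).
  by rewrite compm1; exact: papp_unit.
have [c [c1 [c2 Hc]]] := @papp_strength _ PB T L box _ _ (poly_id I) X a _ _ _ _ s H.
have := papp_unit T (pst PB T box (poly_id I) X a ∘ idm _).
rewrite pidx_strength compm1 => /papp_fun /(_ Hc); rewrite !compm1 => ->.
rewrite !compm1 in c1 c2.
by apply: (@mp_monic _ _ cart); rewrite ?mmap1 ?mmap2 ?comp1m.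
Qed.

Lemma punit_iso (x : slice I) : is_iso (unit_compare PB T box x).
Proof.
apply: slice_iso; rewrite -punitE.
(* The inverse sends a point of [x] to the function constantly equal to it, indexed by its image in
   [I]. *)
have [|y [y1 y2]] := @papp_abs _ PB L box _ _ (poly_id I) x (dom x) (arr x) (ten2 L (idm I) (arr x)).
  by rewrite /= -ten_comm.
have e1 : punit PB T box x ∘ y = idm _.
  have := papp_unit T y; rewrite y1.
  have [u [u1 u2]] := sep_sym (sep_id L (arr x) (idm _)); rewrite compm1 in u1.
  have := y2 _ u; rewrite [ten1 _ _ _ ∘ u]u1 [ten2 _ _ _ ∘ u]u2 compm1 => H1 H2.
  exact: papp_fun H2 H1.
exists y; split=> //.
have inj M (z z' : M ~> pdom PB box (poly_id I) x) :
    punit PB T box x ∘ z = punit PB T box x ∘ z' -> z = z'.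
  move=> ez; have H1 := papp_unit T z; have H2 := papp_unit T z'.
  have ei : pidx PB box (poly_id I) x ∘ z = pidx PB box (poly_id I) x ∘ z'.
    by have := papp_arr H1; have := papp_arr H2; rewrite /= !comp1m ez => -> <-.
  apply: (papp_ext ei) => Z e m c c' /sep_eq /=; rewrite comp1m => ->.
  rewrite -ei -ez in H2 => /(papp_fun (papp_pre m H1)) <-.
  exact: papp_fun (papp_pre m H2).
by apply: inj; rewrite compA e1 comp1m compm1.
Qed.

Definition unit_strong : StrongTrans ⟦poly_id I⟧ (id_bunched PB T L I).
Proof.
refine (@Build_StrongTrans _ _ _ _ _ _ ⟦poly_id I⟧ (id_bunched PB T L I) (@unit_compare C PB T L box I) _ _).
- by move=> x y u; apply: slice_hom_eq; have := punit_natural u; rewrite !pmapE !punitE.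
- move=> X x; rewrite [st _ X x]/= [RHS]comp1m; apply: slice_hom_eq.
  by have := punit_strong X x; rewrite !pstE !punitE.
Defined.

End Unit.

Lemma strong_trans_inverse (X Y : C) (F G : BunchedFunctor PB T L X Y) (θ : StrongTrans F G) :
  (forall a : slice X, is_iso (θ a)) ->
  exists ζ : StrongTrans G F, forall a : slice X,
    ζ a ∘ θ a = idm (F a) /\ θ a ∘ ζ a = idm (G a).
Proof.
move=> H.
have inv a : {g : G a ~> F a | g ∘ θ a = idm (F a) /\ θ a ∘ g = idm (G a)}.
  by apply: constructive_indefinite_description; exact: (H a).
pose g a := sval (inv a).
have g1 a : g a ∘ θ a = idm (F a) by rewrite /g; case: (inv a) => h [].
have g2 a : θ a ∘ g a = idm (G a) by rewrite /g; case: (inv a) => h [].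
have n1 (a b : slice X) (u : a ~> b) : fmap F u ∘ g a = g b ∘ fmap G u.
  by rewrite -(comp1m (fmap F u)) -(g1 b) -(compA (g b)) -(tr_nat θ) -!compA g2 compm1.
have n2 (K : C) (a : slice X) :
    g (act cart K a) ∘ st (cartesian_strength G) K a =
    st (cartesian_strength F) K a ∘ act_map cart (idm K) (g a).
  rewrite -(compm1 (st (cartesian_strength G) K a)) -act_map_id -(g2 a).
  rewrite -{1}(comp1m (idm K)) -act_map_comp (compA (st _ _ _)) -(tr_strong θ).
  by rewrite !compA g1 comp1m.
by exists (Build_StrongTrans n1 n2).
Qed.

Lemma identity_polynomial (I : C) : is_subcartesian_polynomial box (id_bunched PB T L I).
Proof.
have [ζ Hζ] := strong_trans_inverse (θ := unit_strong I) (@punit_iso I).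
exists (poly_id I), ζ => a; exists (unit_strong I a); have [] := Hζ a; split=> //.
Qed.

Lemma composite_polynomial (I J K : C) (G : BunchedFunctor PB T L J K)
    (F : BunchedFunctor PB T L I J) :
  is_subcartesian_polynomial box G -> is_subcartesian_polynomial box F ->
  is_subcartesian_polynomial box (comp_bunched G F).
Proof.
move=> [Q [θ Hθ]] [P [χ Hχ]].
have [ζ Hζ] := strong_trans_inverse (θ := comp_strong Q P) (@pcomp_iso _ _ _ Q P).
exists (poly_comp PB box Q P).
exists (st_vcomp ζ (st_vcomp (st_pre θ ⟦P⟧) (st_post G χ))) => a.
have [c [c1 c2]] := Hχ a; have [t [t1 t2]] := Hθ (⟦P⟧ a); have [z1 z2] := Hζ a.
exists (fmap G c ∘ t ∘ comp_strong Q P a).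
change (st_vcomp ζ (st_vcomp (st_pre θ ⟦P⟧) (st_post G χ)) a)
  with (ζ a ∘ (θ (⟦P⟧ a) ∘ fmap G (χ a))).
have Gc1 : fmap G c ∘ fmap G (χ a) = idm (G (F a)) by rewrite -fmap_comp c1 fmap_id.
have Gc2 : fmap G (χ a) ∘ fmap G c = idm (G (⟦P⟧ a)) by rewrite -fmap_comp c2 fmap_id.
split; rewrite -!compA.
  by rewrite (comp_pre1 _ z2) comp1m (comp_pre1 _ t1) comp1m.
by rewrite (comp_pre1 _ Gc2) comp1m (comp_pre1 _ t2) comp1m.
Qed.

End Composition.

(** * Vertical composition and whiskering of 2-cells *)

Section CellOperations.
Variables (C : Category) (PB : Pullbacks C) (T : Terminal C) (L : LocallySubcartesian C).
Variable box : forall (X Y : C) (f : X ~> Y), RightAdjoint (nabla L f).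

Notation "⟦ P ⟧" := (poly_functor PB T box P) (at level 0, format "⟦ P ⟧").
Notation gen := (generic PB box).

Section Vertical.
Variables (I J : C).

Definition id_cell (P : Poly I J) : PolyCell L P P.
Proof.
refine (@MkPolyCell C L I J P P (MkPolyCellData (idm (pE P)) (idm (pE P)) (idm (pB P))) erefl _ _).
- by rewrite /= compm1.
- by rewrite /= compm1; apply: subpb_identity.
Defined.

Lemma pcell_id (P : Poly I J) (a : slice I) :
  pcell PB T box (id_cell P) a = idm (pdom PB box P a).
Proof.
apply: papp_ext.
  by rewrite -(compm1 (pcell _ _ _ _ _)) pidx_cell /= comp1m.
move=> Z e m c c'; rewrite -{1}(compm1 (pcell _ _ _ _ _)) pidx_cell.
move=> /(pcell_elim T) [w [c0 [w1 [_ [H1 H2]]]]].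
rewrite !comp1m in H1 H2; rewrite comp1m => /(papp_fun H2) <- H3.
by move: w1; rewrite /= comp1m => ew; subst w; apply: papp_fun H1 H3.
Qed.

Definition vcomp_cell (P Q R : Poly I J) (β : PolyCell L Q R) (α : PolyCell L P Q) :
  PolyCell L P R.
Proof.
refine (@MkPolyCell C L I J P R
  (@MkPolyCellData C I J P R (ten L (ch α) (cj β))
    (cj α ∘ ten1 L (ch α) (cj β)) (ch β ∘ ten2 L (ch α) (cj β)) (ck β ∘ ck α)) _ _ _).
- by rewrite /= !compA (cell_s α) -(cell_s β) -!compA ten_comm.
- by rewrite /= compA -(cell_t β) -(cell_t α).
- rewrite /= compA; apply: (subpb_paste (cell_subpullback β)).
  apply: subpb_sym; apply: (subpb_paste (subpb_sym (cell_subpullback α))).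
  exact: is_subpullback_ten.
Defined.

Lemma pcell_vcomp (P Q R : Poly I J) (β : PolyCell L Q R) (α : PolyCell L P Q) (a : slice I) :
  pcell PB T box (vcomp_cell β α) a = pcell PB T box β a ∘ pcell PB T box α a.
Proof.
have ea : pidx PB box Q a ∘ pcell PB T box α a = ck α ∘ pidx PB box P a.
  by rewrite -(compm1 (pcell _ _ _ _ _)) pidx_cell compm1.
have ev : pidx PB box R a ∘ pcell PB T box (vcomp_cell β α) a =
    ck β ∘ (ck α ∘ pidx PB box P a).
  by rewrite -(compm1 (pcell _ _ _ _ _)) pidx_cell compm1 compA.
apply: papp_ext; first by rewrite ev pidx_cell ea.
move=> Z e m c c' s; have s' := s; rewrite ev -ea in s'.
have [w [c0 [w1 [sw [H1 H2]]]]] := pcell_elim T s'; subst e.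
rewrite -compA => H3 /(papp_fun H2) <-.
rewrite ea in sw.
have [w2 [c1 [ew [sw2 [H4 H5]]]]] := @pcell_elim _ PB T L box _ _ P Q α a _ _ (idm _) (cj β ∘ w) m
  ltac:(by rewrite compm1; apply: sep_post1 sw).
rewrite comp1m in H5; rewrite -(papp_fun H5 H1).
rewrite comp1m compm1 in H4 sw2.
(* Separation of [w2] from [w] is not at hand. The point of the composite apex comes instead from
   the pasted subpullback, and its projections are then identified by joint monicity, first for [β]
   and then for [α]. *)
have [u [u1 [u2 us]]] : exists u : Z ~> ten L (ch α) (cj β),
    ten1 L (ch α) (cj β) ∘ u = w2 /\ ten2 L (ch α) (cj β) ∘ u = w /\
    sep L (pp P ∘ (cj α ∘ ten1 L (ch α) (cj β))) (pidx PB box P a) u m.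
  rewrite ev in s.
  have [v [v1 [v2 vs]]] := @pcell_elim _ PB T L box _ _ P R (vcomp_cell β α) a _ _ (idm _) (ch β ∘ w) m
    ltac:(by rewrite compm1 -compA).
  have [vs' _] := vs; rewrite compm1 in vs'.
  exists v; have vb : pp Q ∘ (cj β ∘ (ten2 L (ch α) (cj β) ∘ v)) = ck α ∘ (pidx PB box P a ∘ m).
    rewrite -(comp_pre _ (ten_comm L (ch α) (cj β))) compA (subpb_comm (cell_subpullback α)).
    by rewrite -compA -(sep_eq vs') -!compA.
  have e2 : ten2 L (ch α) (cj β) ∘ v = w.
    apply: (subpb_monic (cell_subpullback β)); first by rewrite -v2 /= -compA.
    by rewrite -compA vb -[in RHS]compA (sep_eq (sep_post1 sw)) -compA.
  split; last split=> //.
  apply: (subpb_monic (cell_subpullback α)).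
    by rewrite compA ten_comm -compA e2 ew.
  by have := sep_eq vs'; rewrite /= -!compA => ->; have := sep_eq sw2; rewrite -!compA.
have H6 : PApp PB box P (cj (vcomp_cell β α) ∘ u) m c1 by rewrite /= -compA u1.
have := @papp_cell _ PB T L box _ _ P R (vcomp_cell β α) a _ u m c1 us H6; rewrite /= -compA u2; exact: papp_fun.
Qed.

End Vertical.
End CellOperations.

Section Whiskering.
Variables (C : Category) (PB : Pullbacks C) (T : Terminal C) (L : LocallySubcartesian C).
Variable box : forall (X Y : C) (f : X ~> Y), RightAdjoint (nabla L f).

Notation "⟦ P ⟧" := (poly_functor PB T box P) (at level 0, format "⟦ P ⟧").

(** * Whiskering a 2-cell with an outer polynomial *)

Section Post.
Variables (I J K : C) (Q : Poly J K) (P1 P2 : Poly I J) (α : PolyCell L P1 P2).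

Local Notation T_ P := (pc_T PB box Q P).
Local Notation b P := (pc_b PB box Q P).
Local Notation w' P := (pc_w' PB box Q P).
Local Notation d P := (pc_e PB box Q P).
Local Notation p' P := (pc_p' PB box Q P).
Local Notation a' P := (pc_a PB box Q P).
Local Notation m' P := (pc_m' PB Q P).
Local Notation QP P := (poly_comp PB box Q P).

Definition post_base : (MkSlice (pt P1) : slice J) ~> MkSlice (pt P2) :=
  @MkSliceHom C J (MkSlice (pt P1)) (MkSlice (pt P2)) (ck α) (esym (cell_t α)).

(** As R is ⟦Q⟧ at [pt P], the map induced by [ck α] is the functorial action of ⟦Q⟧ on it. *)
Definition post_r : pc_R PB box Q P1 ~> pc_R PB box Q P2 := pmap PB T box Q post_base.

Lemma post_r_arr : b P2 ∘ post_r = b P1.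
Proof. by have := pidx_fmap T post_base (idm (pdom PB box Q _)); rewrite !compm1. Qed.

Definition post_T : T_ P1 ~> T_ P2 :=
  shom (fmap (nabla L (pp Q)) (fmap (box (pp Q)) (fmap (Delta PB (ps Q)) post_base))).

Lemma post_T1 : ten1 L (pp Q) (b P2) ∘ post_T = ten1 L (pp Q) (b P1).
Proof. exact: ten_lift1. Qed.

Lemma post_T2 : ten2 L (pp Q) (b P2) ∘ post_T = post_r ∘ ten2 L (pp Q) (b P1).
Proof. by rewrite /post_r pmapE; exact: ten_lift2. Qed.

(** Functoriality of application: [post_r] postcomposes values with [ck α], and [papp_dist]
    identifies the values. *)
Lemma post_dist (Z : C) (τ : Z ~> T_ P1) :
  m' P2 ∘ d P2 ∘ (post_T ∘ τ) = ck α ∘ (m' P1 ∘ d P1 ∘ τ).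
Proof.
have H1 := papp_fmap T post_base (papp_dist τ).
have := papp_dist (post_T ∘ τ); rewrite (comp_pre1 _ post_T1) (comp_pre _ post_T2) => H2.
exact: papp_fun H2 H1.
Qed.

Local Notation πT := (ten1 L (m' P1 ∘ d P1) (pp P1 ∘ cj α)).
Local Notation πP := (ten2 L (m' P1 ∘ d P1) (pp P1 ∘ cj α)).

Lemma post_j_sep : sep L (pp P1) (m' P1 ∘ d P1) (cj α ∘ πP) πT.
Proof. by apply: sep_post1; apply: sep_sym; apply: sep_ten0. Qed.

Lemma post_subpullback :
  is_subpullback L (pp P2) (m' P2 ∘ d P2 ∘ post_T) (ch α ∘ πP) πT.
Proof.
have -> : m' P2 ∘ d P2 ∘ post_T = ck α ∘ (m' P1 ∘ d P1).
  by have := post_dist (idm _); rewrite !compm1.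
apply: (subpb_paste (cell_subpullback α)); apply: subpb_sym; exact: is_subpullback_ten.
Qed.

Lemma post_h_sep : sep L (pp P2) (m' P2 ∘ d P2) (ch α ∘ πP) (post_T ∘ πT).
Proof. exact: sep_post2 (subpb_sep post_subpullback). Qed.

Definition post_j : ten L (m' P1 ∘ d P1) (pp P1 ∘ cj α) ~> pc_A PB box Q P1 := ten_lift post_j_sep.
Definition post_h : ten L (m' P1 ∘ d P1) (pp P1 ∘ cj α) ~> pc_A PB box Q P2 := ten_lift post_h_sep.

Lemma post_j1 : a' P1 ∘ post_j = cj α ∘ πP. Proof. exact: ten_lift1. Qed.
Lemma post_j2 : p' P1 ∘ post_j = πT. Proof. exact: ten_lift2. Qed.
Lemma post_h1 : a' P2 ∘ post_h = ch α ∘ πP. Proof. exact: ten_lift1. Qed.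
Lemma post_h2 : p' P2 ∘ post_h = post_T ∘ πT. Proof. exact: ten_lift2. Qed.

(** Since [post_r] lies over the base of [Q], pasting this square onto the chosen square of T for
    [P2] gives the chosen square for [P1]; then cancel. *)
Lemma post_T_subpullback : is_subpullback L (w' P2) post_r post_T (w' P1).
Proof.
apply: (subpb_cancel (is_subpullback_ten L (pp Q) (b P2))); last exact: post_T2.
rewrite post_r_arr post_T1; exact: is_subpullback_ten.
Qed.

Lemma post_A_subpullback : is_subpullback L (p' P2) post_T post_h πT.
Proof.
apply: (subpb_cancel (is_subpullback_ten L (pp P2) (m' P2 ∘ d P2))); last exact: post_h2.
by rewrite [ten1 _ _ _ ∘ post_h]post_h1; exact: post_subpullback.
Qed.

Definition post_cell : PolyCell L (QP P1) (QP P2).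
Proof.
refine (@MkPolyCell C L I K (QP P1) (QP P2)
  (@MkPolyCellData C I K (QP P1) (QP P2) _ post_j post_h post_r) _ _ _).
- by rewrite /= -!compA post_j1 post_h1 !compA (cell_s α).
- by rewrite /= -compA post_r_arr.
- rewrite /= -compA post_j2; apply: subpb_sym.
  apply: (subpb_paste (subpb_sym post_T_subpullback)).
  exact: subpb_sym post_A_subpullback.
Defined.

Lemma post_cell_whiskering : is_post_whiskering α post_cell.
Proof.
split; first by rewrite /= /post_r pmapE.
exists πT, πP; split; first exact: is_subpullback_ten.
split; first exact: post_j2.
split; first exact: post_j1.
split; first exact: post_h2.
exact: post_h1.
Qed.

Lemma pcell_post (x : slice I) :
  pcomp PB T box Q P2 x ∘ pcell PB T box post_cell x =
  pmap PB T box Q (cell_trans PB T box α x) ∘ pcomp PB T box Q P1 x.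
Proof.
have ec : pidx PB box Q (⟦P1⟧ x) ∘ pcomp PB T box Q P1 x = b P1 ∘ pidx PB box (QP P1) x.
  by rewrite -(compm1 (pcomp _ _ _ _ _ _)) pidx_comp_compare compm1.
have eβ : pidx PB box (QP P2) x ∘ pcell PB T box post_cell x = post_r ∘ pidx PB box (QP P1) x.
  by rewrite -(compm1 (pcell _ _ _ _ _)) pidx_cell compm1.
apply: pp_ext.
  by rewrite pidx_comp_compare pidx_fmap ec eβ compA post_r_arr.
move=> Z e m z z' s.
have eb : pidx PB box Q (⟦P2⟧ x) ∘ (pcomp PB T box Q P2 x ∘ pcell PB T box post_cell x) =
    b P1 ∘ pidx PB box (QP P1) x.
  by rewrite pidx_comp_compare eβ compA post_r_arr.
rewrite eb in s.
have [|τ [z1 [t1 [t2 [H1 [i1 U1]]]]]] := @pcomp_elim _ PB T L box _ _ _ Q P1 x _ _ (idm _) e m.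
  by rewrite compm1.
have [|τ2 [z2 [t12 [t22 [H2 [i2 U2]]]]]] :=
    @pcomp_elim _ PB T L box _ _ _ Q P2 x _ _ (pcell PB T box post_cell x) e m.
  by rewrite eβ compA post_r_arr.
have eτ : τ2 = post_T ∘ τ.
  apply: (@ten_monic _ L).
    by rewrite t12 (comp_pre1 _ post_T1) t1.
  by rewrite t22 (comp_pre _ post_T2) t2 comp1m compA eβ -compA.
subst τ2; rewrite comp1m in H1 t2; rewrite -!compA => /(papp_fun H2) <-.
have := papp_fmap T (cell_trans PB T box α x) H1; rewrite -pcellE => H3 /(papp_fun H3) <-.
split; first by rewrite i2 pidx_cell i1 post_dist.
move=> W g e2 c c'; rewrite i2 post_dist -i1 => s2.
have [ω [c0 [w1 [sw [H4 H5]]]]] := pcell_elim T s2; subst e2.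
rewrite i1 in sw.
have [κ [c1 [k1 [k2 [_ [H6 H7]]]]]] := U1 _ _ _ (sep_post1 sw).
rewrite -compA => + /(papp_fun H5) <-; rewrite (papp_fun H4 H7).
have s3 : sep L (pp P2) (m' P2 ∘ d P2 ∘ (post_T ∘ τ)) (ch α ∘ ω) g.
  by rewrite post_dist -i1.
have [κ2 [c2 [l1 [l2 [ls [H8 H9]]]]]] := U2 _ _ _ s3; move=> /(papp_fun H9) <-.
rewrite eβ in ls.
have [|v [c3 [v1 [vs [H10 H11]]]]] :=
  @pcell_elim _ PB T L box _ _ _ _ post_cell x _ _ (idm _) κ2 (m ∘ g); first by rewrite compm1.
rewrite comp1m in H11; rewrite -(papp_fun H11 H8).
rewrite comp1m in H10 H6; apply: papp_fun H10 _.
(* The apex is T ⊗_B (apex α), so the apex point [v] over [κ2] is pinned down by its projections to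
   T and to the apex of [α]. *)
have eT : πT ∘ v = τ ∘ g.
  apply: (subpb_monic post_T_subpullback).
    by rewrite -(comp_pre _ post_h2) [post_h ∘ v]v1 [p' P2 ∘ κ2]l2 compA.
  have := sep_eq vs; rewrite compm1 /= => E.
  have -> : w' P1 ∘ (πT ∘ v) = w' P1 ∘ p' P1 ∘ post_j ∘ v.
    by rewrite -[w' P1 ∘ p' P1 ∘ _]compA post_j2 compA.
  by rewrite E (compA _ m) (compA _ τ) -t2.
have eP : πP ∘ v = ω.
  apply: (subpb_monic (cell_subpullback α)).
    by rewrite compA -post_h1 -compA [post_h ∘ v]v1 [a' P2 ∘ κ2]l1.
  by rewrite -(comp_pre _ (ten_comm L _ _)) eT (sep_eq sw) compA.
suff -> : cj post_cell ∘ v = κ by [].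
apply: (@ten_monic _ L).
  by rewrite [RHS]k1 (comp_pre _ post_j1) eP.
by rewrite [RHS]k2 (comp_pre1 _ post_j2) eT.
Qed.

End Post.

(** * Whiskering a 2-cell between outer polynomials *)

Section Pre.
Variables (I J K : C) (Q1 Q2 : Poly J K) (α : PolyCell L Q1 Q2) (P : Poly I J).

Local Notation T_ Q := (pc_T PB box Q P).
Local Notation b Q := (pc_b PB box Q P).
Local Notation w' Q := (pc_w' PB box Q P).
Local Notation d Q := (pc_e PB box Q P).
Local Notation p' Q := (pc_p' PB box Q P).
Local Notation a' Q := (pc_a PB box Q P).
Local Notation m' Q := (pc_m' PB Q P).
Local Notation QP Q := (poly_comp PB box Q P).

(** R being the value at [pt P], the map between the two objects R is the component of the canonical
    transformation of [α] there. *)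
Definition pre_r : pc_R PB box Q1 P ~> pc_R PB box Q2 P := pcell PB T box α (MkSlice (pt P)).

Lemma pre_r_arr : b Q2 ∘ pre_r = ck α ∘ b Q1.
Proof. by have := pidx_cell T α (idm (pdom PB box Q1 (MkSlice (pt P)))); rewrite !compm1. Qed.

Local Notation U := (ten L (b Q1) (pp Q1 ∘ cj α)).
Local Notation πR := (ten1 L (b Q1) (pp Q1 ∘ cj α)).
Local Notation πP := (ten2 L (b Q1) (pp Q1 ∘ cj α)).

Lemma pre_apex_sep : sep L (pp Q1 ∘ cj α) (b Q1) πP πR.
Proof. by apply: sep_sym; apply: sep_ten0. Qed.

Lemma pre_τ1_sep : sep L (pp Q1) (b Q1) (cj α ∘ πP) πR.
Proof. exact: sep_post1 pre_apex_sep. Qed.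

Lemma pre_subpullback : is_subpullback L (pp Q2) (b Q2 ∘ pre_r) (ch α ∘ πP) πR.
Proof.
rewrite pre_r_arr; apply: (subpb_paste (cell_subpullback α)).
by apply: subpb_sym; apply: is_subpullback_ten.
Qed.

Lemma pre_τ2_sep : sep L (pp Q2) (b Q2) (ch α ∘ πP) (pre_r ∘ πR).
Proof. exact: sep_post2 (subpb_sep pre_subpullback). Qed.

Definition pre_τ1 : U ~> T_ Q1 := ten_lift pre_τ1_sep.
Definition pre_τ2 : U ~> T_ Q2 := ten_lift pre_τ2_sep.

Lemma pre_τ11 : ten1 L (pp Q1) (b Q1) ∘ pre_τ1 = cj α ∘ πP. Proof. exact: ten_lift1. Qed.
Lemma pre_τ12 : ten2 L (pp Q1) (b Q1) ∘ pre_τ1 = πR. Proof. exact: ten_lift2. Qed.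
Lemma pre_τ21 : ten1 L (pp Q2) (b Q2) ∘ pre_τ2 = ch α ∘ πP. Proof. exact: ten_lift1. Qed.
Lemma pre_τ22 : ten2 L (pp Q2) (b Q2) ∘ pre_τ2 = pre_r ∘ πR. Proof. exact: ten_lift2. Qed.

(** A 2-cell changes the argument but not the value; here the value is the index of the inner
    polynomial. *)
Lemma pre_dist (Z : C) (w : Z ~> apex α) (τ1 : Z ~> T_ Q1) (τ2 : Z ~> T_ Q2) :
  sep L (pp Q1 ∘ cj α) (b Q1) w (ten2 L (pp Q1) (b Q1) ∘ τ1) ->
  ten1 L (pp Q1) (b Q1) ∘ τ1 = cj α ∘ w ->
  ten1 L (pp Q2) (b Q2) ∘ τ2 = ch α ∘ w ->
  ten2 L (pp Q2) (b Q2) ∘ τ2 = pre_r ∘ (ten2 L (pp Q1) (b Q1) ∘ τ1) ->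
  m' Q2 ∘ d Q2 ∘ τ2 = m' Q1 ∘ d Q1 ∘ τ1.
Proof.
move=> s e1 e2 e3; have H1 := papp_dist τ1; rewrite e1 in H1.
have := papp_dist τ2; rewrite e2 e3 => H2.
have H3 := @papp_cell _ PB T L box _ _ Q1 Q2 α (MkSlice (pt P)) _ w _ _ s H1.
exact: papp_fun H2 H3.
Qed.

(** As both composites from U to the base of [P] agree, the single apex U ⊗_B E maps to A for [Q1]
    and for [Q2]. *)
Lemma pre_dist_τ : m' Q2 ∘ d Q2 ∘ pre_τ2 = m' Q1 ∘ d Q1 ∘ pre_τ1.
Proof.
apply: (pre_dist (w := πP)).
- by rewrite pre_τ12; exact: pre_apex_sep.
- exact: pre_τ11.
- exact: pre_τ21.
- by rewrite pre_τ12; exact: pre_τ22.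
Qed.

Local Notation πU := (ten1 L (m' Q1 ∘ d Q1 ∘ pre_τ1) (pp P)).
Local Notation πE := (ten2 L (m' Q1 ∘ d Q1 ∘ pre_τ1) (pp P)).

Lemma pre_E_subpullback :
  is_subpullback L (pp P) (m' Q1 ∘ d Q1 ∘ pre_τ1) πE πU.
Proof. by apply: subpb_sym; apply: is_subpullback_ten. Qed.

Lemma pre_j_sep : sep L (pp P) (m' Q1 ∘ d Q1) πE (pre_τ1 ∘ πU).
Proof. exact: sep_post2 (subpb_sep pre_E_subpullback). Qed.

Lemma pre_h_sep : sep L (pp P) (m' Q2 ∘ d Q2) πE (pre_τ2 ∘ πU).
Proof. by apply: sep_post2; rewrite pre_dist_τ; exact: subpb_sep pre_E_subpullback. Qed.

Definition pre_j : ten L (m' Q1 ∘ d Q1 ∘ pre_τ1) (pp P) ~> pc_A PB box Q1 P := ten_lift pre_j_sep.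
Definition pre_h : ten L (m' Q1 ∘ d Q1 ∘ pre_τ1) (pp P) ~> pc_A PB box Q2 P := ten_lift pre_h_sep.

Lemma pre_j1 : a' Q1 ∘ pre_j = πE. Proof. exact: ten_lift1. Qed.
Lemma pre_j2 : p' Q1 ∘ pre_j = pre_τ1 ∘ πU. Proof. exact: ten_lift2. Qed.
Lemma pre_h1 : a' Q2 ∘ pre_h = πE. Proof. exact: ten_lift1. Qed.
Lemma pre_h2 : p' Q2 ∘ pre_h = pre_τ2 ∘ πU. Proof. exact: ten_lift2. Qed.

Lemma pre_T_subpullback : is_subpullback L (w' Q2) pre_r pre_τ2 πR.
Proof.
apply: (subpb_cancel (is_subpullback_ten L (pp Q2) (b Q2))); last exact: pre_τ22.
by rewrite pre_τ21; exact: pre_subpullback.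
Qed.

Lemma pre_A_subpullback : is_subpullback L (p' Q2) pre_τ2 pre_h πU.
Proof.
apply: (subpb_cancel (is_subpullback_ten L (pp P) (m' Q2 ∘ d Q2))); last exact: pre_h2.
by rewrite [ten1 _ _ _ ∘ pre_h]pre_h1 pre_dist_τ; exact: pre_E_subpullback.
Qed.

Lemma pre_w'j : w' Q1 ∘ (p' Q1 ∘ pre_j) = πR ∘ πU.
Proof. by rewrite pre_j2; exact: (comp_pre1 _ pre_τ12). Qed.

Definition pre_cell : PolyCell L (QP Q1) (QP Q2).
Proof.
refine (@MkPolyCell C L I K (QP Q1) (QP Q2)
  (@MkPolyCellData C I K (QP Q1) (QP Q2) _ pre_j pre_h pre_r) _ _ _).
- by rewrite /= -[LHS]compA -[RHS]compA pre_j1 pre_h1.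
- by rewrite /= -compA pre_r_arr compA -(cell_t α).
- rewrite /= -(compA _ _ pre_j) pre_w'j; apply: subpb_sym.
  apply: (subpb_paste (subpb_sym pre_T_subpullback)).
  exact: subpb_sym pre_A_subpullback.
Defined.

Lemma pre_cell_whiskering : is_pre_whiskering α pre_cell.
Proof.
have er : shom (sigma_delta_counit PB (ck α) (box (pp Q2) (Delta PB (ps Q2) (MkSlice (pt P)))))
    ∘ shom (cell_map PB box α (MkSlice (pt P))) = pre_r by rewrite /pre_r pcellE.
split; first by rewrite er.
exists pre_τ1, pre_τ2, πU, πE.
split; first exact: pre_τ11.
split; first exact: pre_τ12.
split; first exact: pre_τ21.
split; first by rewrite er; exact: pre_τ22.
split; first exact: is_subpullback_ten.
split; first exact: pre_j2.
split; first exact: pre_j1.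
split; first exact: pre_h2.
exact: pre_h1.
Qed.

Lemma pcell_pre (x : slice I) :
  pcomp PB T box Q2 P x ∘ pcell PB T box pre_cell x =
  pcell PB T box α (⟦P⟧ x) ∘ pcomp PB T box Q1 P x.
Proof.
have ec : pidx PB box Q1 (⟦P⟧ x) ∘ pcomp PB T box Q1 P x = b Q1 ∘ pidx PB box (QP Q1) x.
  by rewrite -(compm1 (pcomp _ _ _ _ _ _)) pidx_comp_compare compm1.
have eβ : pidx PB box (QP Q2) x ∘ pcell PB T box pre_cell x = pre_r ∘ pidx PB box (QP Q1) x.
  by rewrite -(compm1 (pcell _ _ _ _ _)) pidx_cell compm1.
have eb : b Q2 ∘ (pidx PB box (QP Q2) x ∘ pcell PB T box pre_cell x) =
    ck α ∘ (pidx PB box Q1 (⟦P⟧ x) ∘ pcomp PB T box Q1 P x).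
  by rewrite eβ ec !compA pre_r_arr.
apply: pp_ext; first by rewrite pidx_comp_compare pidx_cell eb.
move=> Z e m z z'; rewrite pidx_comp_compare => s; have s' := s; rewrite eb in s'.
have [w [z0 [w1 [sw [H1 H2]]]]] := pcell_elim T s'; subst e.
rewrite -[in X in _ -> X]compA => + /(papp_fun H2) <-.
rewrite ec in sw.
have [|τ1 [z1 [t1 [t2 [H3 [i1 U1]]]]]] :=
    @pcomp_elim _ PB T L box _ _ _ Q1 P x _ _ (idm _) (cj α ∘ w) m.
  by rewrite compm1; apply: sep_post1 sw.
rewrite comp1m in H3 t2; have ez := papp_fun H1 H3; subst z0.
have [τ2 [z2 [t12 [t22 [H4 [i2 U2]]]]]] := pcomp_elim T s.
rewrite -compA => /(papp_fun H4) <-.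
have ed : m' Q2 ∘ d Q2 ∘ τ2 = m' Q1 ∘ d Q1 ∘ τ1.
  apply: (pre_dist (w := w)) => //.
    by rewrite t2; apply: sep_post2.
  by rewrite t22 t2 !compA eβ.
split; first by rewrite i1 i2 ed.
move=> W g e2 c c'; rewrite i2 => s2; have s3 := s2; rewrite ed in s3.
have [κ [c1 [k1 [k2 [_ [H5 H6]]]]]] := U1 _ _ _ s3.
have [κ2 [c2 [l1 [l2 [ls [H7 H8]]]]]] := U2 _ _ _ s2.
move=> /(papp_fun H8) <- /(papp_fun H6) <-.
rewrite eβ in ls.
have [|v [c3 [v1 [vs [H9 H10]]]]] :=
  @pcell_elim _ PB T L box _ _ _ _ pre_cell x _ _ (idm _) κ2 (m ∘ g); first by rewrite compm1.
rewrite comp1m in H10; rewrite -(papp_fun H10 H7).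
rewrite comp1m in H9 H5; apply: papp_fun H9 _.
(* The image of [v] in U = R ⊗_Y (apex α) is controlled by [eR] and [eP]; the component in E comes
   from [k1] and [l1]. *)
have eR : πR ∘ (πU ∘ v) = pidx PB box (QP Q1) x ∘ (m ∘ g).
  have := sep_eq vs; rewrite compm1 /= => <-.
  by rewrite (compA πR) -pre_w'j (compA (w' Q1)).
have eP : πP ∘ (πU ∘ v) = w ∘ g.
  apply: (subpb_monic (cell_subpullback α)).
    rewrite (comp_pre _ (esym pre_τ21)) -(comp_pre _ pre_h2) [pre_h ∘ v]v1.
    by rewrite [p' Q2 ∘ κ2]l2 (compA _ τ2) t12 -(compA _ w).
  rewrite -(comp_pre _ (ten_comm L _ _)) eR (compA _ w g) (sep_eq sw).
  by rewrite (compA _ m) (compA (b Q1)) (compA (b Q1)).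
suff -> : cj pre_cell ∘ v = κ by [].
apply: (@ten_monic _ L).
  by rewrite [RHS]k1 (comp_pre1 _ pre_j1) -pre_h1 -(compA _ pre_h) [pre_h ∘ v]v1 [LHS]l1.
rewrite [RHS]k2 (comp_pre _ pre_j2).
apply: (@ten_monic _ L).
  by rewrite (comp_pre _ pre_τ11) eP (compA _ τ1) t1 -(compA _ w).
by rewrite (comp_pre1 _ pre_τ12) eR (compA _ τ1) t2 -(compA _ m).
Qed.

End Pre.

End Whiskering.

(** * Transport of bicategory structure along a locally faithful action on categories *)

Section Transport.
Variables (A : Cells) (Kat : cell0 A -> Category).
Variable Φ : forall I J : cell0 A, cell1 I J -> Functor (Kat I) (Kat J).
Arguments Φ {I J} _.
Variable t : forall (I J : cell0 A) (f g : cell1 I J), (f ==> g) -> forall x : Kat I, Φ f x ~> Φ g x.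
Arguments t {I J f g} _ x.
Hypothesis t_nat : forall (I J : cell0 A) (f g : cell1 I J) (a : f ==> g) (x y : Kat I) (u : x ~> y),
  fmap (Φ g) u ∘ t a x = t a y ∘ fmap (Φ f) u.
Hypothesis t_eq2 : forall (I J : cell0 A) (f g : cell1 I J) (a b : f ==> g),
  a ≈ b <-> forall x, t a x = t b x.

Variable c : forall (I J K : cell0 A) (g : cell1 J K) (f : cell1 I J) (x : Kat I),
  Φ (g ⊙ f) x ~> Φ g (Φ f x).
Arguments c {I J K} g f x.
Variable d : forall (I J K : cell0 A) (g : cell1 J K) (f : cell1 I J) (x : Kat I),
  Φ g (Φ f x) ~> Φ (g ⊙ f) x.
Arguments d {I J K} g f x.
Hypothesis c_nat : forall (I J K : cell0 A) (g : cell1 J K) (f : cell1 I J) (x y : Kat I) (u : x ~> y),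
  fmap (Φ g) (fmap (Φ f) u) ∘ c g f x = c g f y ∘ fmap (Φ (g ⊙ f)) u.
Hypothesis dc : forall (I J K : cell0 A) (g : cell1 J K) (f : cell1 I J) (x : Kat I),
  d g f x ∘ c g f x = idm _.
Hypothesis cd : forall (I J K : cell0 A) (g : cell1 J K) (f : cell1 I J) (x : Kat I),
  c g f x ∘ d g f x = idm _.

Variable u : forall (I : cell0 A) (x : Kat I), Φ (id1 I) x ~> x.
Arguments u {I} x.
Variable v : forall (I : cell0 A) (x : Kat I), x ~> Φ (id1 I) x.
Arguments v {I} x.
Hypothesis u_nat : forall (I : cell0 A) (x y : Kat I) (k : x ~> y),
  k ∘ u x = u y ∘ fmap (Φ (id1 I)) k.
Hypothesis vu : forall (I : cell0 A) (x : Kat I), v x ∘ u x = idm _.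
Hypothesis uv : forall (I : cell0 A) (x : Kat I), u x ∘ v x = idm _.

Variable id' : forall (I J : cell0 A) (f : cell1 I J), f ==> f.
Hypothesis t_id : forall (I J : cell0 A) (f : cell1 I J) (x : Kat I), t (id' f) x = idm _.

Variable vcomp' : forall (I J : cell0 A) (f g h : cell1 I J), (g ==> h) -> (f ==> g) -> (f ==> h).
Hypothesis t_vcomp : forall (I J : cell0 A) (f g h : cell1 I J) (b : g ==> h) (a : f ==> g) (x : Kat I),
  t (vcomp' b a) x = t b x ∘ t a x.

Variable post' : forall (I J K : cell0 A) (g : cell1 J K) (f f' : cell1 I J),
  (f ==> f') -> (g ⊙ f ==> g ⊙ f').
Arguments post' {I J K} g {f f'} _.
Hypothesis c_post : forall (I J K : cell0 A) (g : cell1 J K) (f f' : cell1 I J) (a : f ==> f') (x : Kat I),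
  c g f' x ∘ t (post' g a) x = fmap (Φ g) (t a x) ∘ c g f x.

Variable pre' : forall (I J K : cell0 A) (g g' : cell1 J K),
  (g ==> g') -> forall f : cell1 I J, g ⊙ f ==> g' ⊙ f.
Arguments pre' {I J K g g'} _ f.
Hypothesis c_pre : forall (I J K : cell0 A) (g g' : cell1 J K) (b : g ==> g') (f : cell1 I J) (x : Kat I),
  c g' f x ∘ t (pre' b f) x = t b (Φ f x) ∘ c g f x.

Variable assoc' : forall (I J K M : cell0 A) (f : cell1 I J) (g : cell1 J K) (h : cell1 K M),
  h ⊙ (g ⊙ f) ==> h ⊙ g ⊙ f.
Arguments assoc' {I J K M} f g h.
Hypothesis t_assoc : forall (I J K M : cell0 A) (f : cell1 I J) (g : cell1 J K) (h : cell1 K M) (x : Kat I),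
  t (assoc' f g h) x =
  d (h ⊙ g) f x ∘ (d h g (Φ f x) ∘ (fmap (Φ h) (c g f x) ∘ c h (g ⊙ f) x)).
Variable assoc_inv' : forall (I J K M : cell0 A) (f : cell1 I J) (g : cell1 J K) (h : cell1 K M),
  h ⊙ g ⊙ f ==> h ⊙ (g ⊙ f).
Arguments assoc_inv' {I J K M} f g h.
Hypothesis t_assoc_inv : forall (I J K M : cell0 A) (f : cell1 I J) (g : cell1 J K) (h : cell1 K M) (x : Kat I),
  t (assoc_inv' f g h) x =
  d h (g ⊙ f) x ∘ (fmap (Φ h) (d g f x) ∘ (c h g (Φ f x) ∘ c (h ⊙ g) f x)).

Variable lunit' : forall (I J : cell0 A) (f : cell1 I J), id1 J ⊙ f ==> f.
Hypothesis t_lunit : forall (I J : cell0 A) (f : cell1 I J) (x : Kat I),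
  t (lunit' f) x = u (Φ f x) ∘ c (id1 J) f x.
Variable lunit_inv' : forall (I J : cell0 A) (f : cell1 I J), f ==> id1 J ⊙ f.
Hypothesis t_lunit_inv : forall (I J : cell0 A) (f : cell1 I J) (x : Kat I),
  t (lunit_inv' f) x = d (id1 J) f x ∘ v (Φ f x).
Variable runit' : forall (I J : cell0 A) (f : cell1 I J), f ⊙ id1 I ==> f.
Hypothesis t_runit : forall (I J : cell0 A) (f : cell1 I J) (x : Kat I),
  t (runit' f) x = fmap (Φ f) (u x) ∘ c f (id1 I) x.
Variable runit_inv' : forall (I J : cell0 A) (f : cell1 I J), f ==> f ⊙ id1 I.
Hypothesis t_runit_inv : forall (I J : cell0 A) (f : cell1 I J) (x : Kat I),
  t (runit_inv' f) x = d f (id1 I) x ∘ fmap (Φ f) (v x).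

Let dcK (I J K : cell0 A) (g : cell1 J K) (f : cell1 I J) (x : Kat I) Z (w : Z ~> Φ (g ⊙ f) x) :
  d g f x ∘ (c g f x ∘ w) = w.
Proof. by rewrite compA dc comp1m. Qed.
Let cdK (I J K : cell0 A) (g : cell1 J K) (f : cell1 I J) (x : Kat I) Z (w : Z ~> Φ g (Φ f x)) :
  c g f x ∘ (d g f x ∘ w) = w.
Proof. by rewrite compA cd comp1m. Qed.

Lemma t_post (I J K : cell0 A) (g : cell1 J K) (f f' : cell1 I J) (a : f ==> f') (x : Kat I) :
  t (post' g a) x = d g f' x ∘ (fmap (Φ g) (t a x) ∘ c g f x).
Proof. by rewrite -c_post dcK. Qed.

Lemma t_pre (I J K : cell0 A) (g g' : cell1 J K) (b : g ==> g') (f : cell1 I J) (x : Kat I) :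
  t (pre' b f) x = d g' f x ∘ (t b (Φ f x) ∘ c g f x).
Proof. by rewrite -c_pre dcK. Qed.

Let d_nat (I J K : cell0 A) (g : cell1 J K) (f : cell1 I J) (x y : Kat I) (k : x ~> y) :
  fmap (Φ (g ⊙ f)) k ∘ d g f x = d g f y ∘ fmap (Φ g) (fmap (Φ f) k).
Proof. by rewrite -[LHS]dcK (comp_pre _ (esym (c_nat _ _ _))) cd compm1. Qed.

Let t_natK (I J : cell0 A) (f g : cell1 I J) (a : f ==> g) (x y : Kat I) (k : x ~> y) Z
    (w : Z ~> Φ f x) :
  fmap (Φ g) k ∘ (t a x ∘ w) = t a y ∘ (fmap (Φ f) k ∘ w).
Proof. exact: comp_pre (t_nat a k). Qed.
Let d_natK (I J K : cell0 A) (g : cell1 J K) (f : cell1 I J) (x y : Kat I) (k : x ~> y) Z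
    (w : Z ~> Φ g (Φ f x)) :
  fmap (Φ (g ⊙ f)) k ∘ (d g f x ∘ w) = d g f y ∘ (fmap (Φ g) (fmap (Φ f) k) ∘ w).
Proof. exact: comp_pre (d_nat g f k). Qed.
Let fm (C D : Category) (F : Functor C D) (x y z : C) (g : y ~> z) (f : x ~> y) Z (w : Z ~> F x) :
  fmap F g ∘ (fmap F f ∘ w) = fmap F (g ∘ f) ∘ w.
Proof. by rewrite fmap_comp compA. Qed.

(** On components every operation is conjugated by the comparisons, so adjacent [c] and [d] cancel
    and what remains is functoriality, naturality or the inverse laws. Only the laws are opaque: the
    operations must stay computable, so that the explicit composites and whiskerings can be read
    off. *)
Definition transported_bicategory : Bicategory A.
Proof.
refine (@Build_Bicategory A id' vcomp' (@post') (@pre') (@assoc') (@assoc_inv') lunit' lunit_inv'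
  runit' runit_inv' _ _ _ _ _ _ _ _ _ _ _ _ _ _ _ _ _ _ _ _ _ _ _ _ _ _ _).
- abstract by move=> *; apply/t_eq2.
- abstract by move=> I J f g a b /t_eq2 H; apply/t_eq2.
- abstract by move=> I J f g a b e /t_eq2 H1 /t_eq2 H2; apply/t_eq2 => x; rewrite H1 H2.
- abstract by move=> I J f g h b b' a a' /t_eq2 H1 /t_eq2 H2; apply/t_eq2 => x; rewrite !t_vcomp H1 H2.
- abstract by move=> I J K g f f' a a' /t_eq2 H; apply/t_eq2 => x; rewrite !t_post H.
- abstract by move=> I J K g g' b b' f /t_eq2 H; apply/t_eq2 => x; rewrite !t_pre H.
- abstract by move=> *; apply/t_eq2 => x; rewrite !t_vcomp compA.
- abstract by move=> *; apply/t_eq2 => x; rewrite !t_vcomp t_id comp1m.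
- abstract by move=> *; apply/t_eq2 => x; rewrite !t_vcomp t_id compm1.
- abstract by move=> *; apply/t_eq2 => x; rewrite t_post !t_id fmap_id comp1m dc.
- abstract by move=> *; apply/t_eq2 => x; rewrite t_vcomp !t_post t_vcomp -!compA cdK fmap_comp -!compA.
- abstract by move=> *; apply/t_eq2 => x; rewrite t_pre !t_id comp1m dc.
- abstract by move=> *; apply/t_eq2 => x; rewrite t_vcomp !t_pre t_vcomp -!compA cdK.
- abstract by move=> *; apply/t_eq2 => x; rewrite !t_vcomp !t_post !t_pre -!compA !cdK t_natK.
- abstract (by move=> *; apply/t_eq2 => x;
    rewrite !t_vcomp !t_assoc !t_post -!compA !cdK !fm !cdK d_natK fm).
- abstract (by move=> *; apply/t_eq2 => x;
    rewrite !t_vcomp !t_assoc !t_pre !t_post -!compA !cdK !fm c_pre).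
- abstract (by move=> *; apply/t_eq2 => x;
    rewrite !t_vcomp !t_assoc !t_pre -!compA !cdK -t_natK).
- abstract (by move=> *; apply/t_eq2 => x;
    rewrite t_vcomp t_assoc t_assoc_inv t_id -!compA !cdK fm dc fmap_id comp1m dc).
- abstract (by move=> *; apply/t_eq2 => x;
    rewrite t_vcomp t_assoc t_assoc_inv t_id -!compA !cdK fm cd fmap_id comp1m !dcK dc).
- abstract (by move=> *; apply/t_eq2 => x;
    rewrite !t_vcomp !t_lunit -compA c_post !compA u_nat).
- abstract (by move=> *; apply/t_eq2 => x;
    rewrite t_vcomp t_lunit t_lunit_inv t_id -!compA (comp_pre1 _ (vu _)) comp1m dc).
- abstract (by move=> *; apply/t_eq2 => x;
    rewrite t_vcomp t_lunit t_lunit_inv t_id -!compA cdK uv).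
- abstract (by move=> *; apply/t_eq2 => x;
    rewrite !t_vcomp !t_runit -compA c_pre t_natK).
- abstract (by move=> *; apply/t_eq2 => x;
    rewrite t_vcomp t_runit t_runit_inv t_id -!compA fm vu fmap_id comp1m dc).
- abstract (by move=> *; apply/t_eq2 => x;
    rewrite t_vcomp t_runit t_runit_inv t_id -!compA cdK -fmap_comp uv fmap_id).
- abstract (by move=> *; apply/t_eq2 => x;
    rewrite !t_vcomp !t_pre !t_post !t_assoc -!compA !cdK !fm -!compA !cdK d_natK fm).
- abstract (by move=> *; apply/t_eq2 => x;
    rewrite !t_vcomp !t_pre !t_post !t_assoc t_runit t_lunit -!compA !cdK fm).
Defined.

End Transport.

(** * The biequivalence *)

(** The sub-bicategory is full on 2-cells and has the same operations, so the data and the laws are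
    reused verbatim. *)
Definition corestricted_pseudofunctor (A B : Cells) (bA : Bicategory A) (bB : Bicategory B)
    (F0 : cell0 A -> cell0 B) (F1 : forall I J : cell0 A, cell1 I J -> cell1 (F0 I) (F0 J))
    (F : Pseudofunctor bA bB F1) (P : forall I J : cell0 B, cell1 I J -> Prop)
    (P_id : forall I : cell0 B, P I I (id1 I))
    (P_comp : forall (I J K : cell0 B) (g : cell1 J K) (f : cell1 I J),
      P J K g -> P I J f -> P I K (g ⊙ f))
    (HP : forall (I J : cell0 A) (f : cell1 I J), P _ _ (F1 I J f)) :
  @Pseudofunctor A (sub_cells B P P_id P_comp) bA (sub_bicategory bB P_id P_comp) F0
    (fun I J f => exist _ (F1 I J f) (HP I J f)) :=
  @Build_Pseudofunctor A (sub_cells B P P_id P_comp) bA (sub_bicategory bB P_id P_comp) F0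
    (fun I J f => exist _ (F1 I J f) (HP I J f))
    (@ps2 _ _ _ _ _ _ F) (@ps_comp _ _ _ _ _ _ F) (@ps_comp_inv _ _ _ _ _ _ F)
    (@ps_unit _ _ _ _ _ _ F) (@ps_unit_inv _ _ _ _ _ _ F)
    (@ps2_eq2 _ _ _ _ _ _ F) (@ps2_id _ _ _ _ _ _ F) (@ps2_vcomp _ _ _ _ _ _ F)
    (@ps_compK _ _ _ _ _ _ F) (@ps_comp_invK _ _ _ _ _ _ F)
    (@ps_unitK _ _ _ _ _ _ F) (@ps_unit_invK _ _ _ _ _ _ F)
    (@ps_comp_post _ _ _ _ _ _ F) (@ps_comp_pre _ _ _ _ _ _ F)
    (@ps_associator _ _ _ _ _ _ F) (@ps_left_unitor _ _ _ _ _ _ F)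
    (@ps_right_unitor _ _ _ _ _ _ F).

Section Biequivalence.
Variables (C : Category) (PB : Pullbacks C) (T : Terminal C) (L : LocallySubcartesian C).
Variable box : forall (X Y : C) (f : X ~> Y), RightAdjoint (nabla L f).

Notation "⟦ P ⟧" := (poly_functor PB T box P) (at level 0, format "⟦ P ⟧").
Notation "Q • P" := (poly_comp PB box Q P) (at level 40, left associativity).
Notation tc := (cell_trans PB T box).

Definition comp_strong_inverse_sig (I J K : C) (Q : Poly J K) (P : Poly I J) :
  {ζ : StrongTrans (comp_bunched ⟦Q⟧ ⟦P⟧) ⟦Q • P⟧ | forall a : slice I,
    ζ a ∘ comp_strong PB T box Q P a = idm _ /\ comp_strong PB T box Q P a ∘ ζ a = idm _}.
Proof.
apply: constructive_indefinite_description; apply: strong_trans_inverse => a.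
exact: pcomp_iso.
Qed.

Definition comp_inv (I J K : C) (Q : Poly J K) (P : Poly I J) := sval (comp_strong_inverse_sig Q P).

Lemma comp_invK (I J K : C) (Q : Poly J K) (P : Poly I J) (a : slice I) :
  comp_inv Q P a ∘ comp_strong PB T box Q P a = idm (⟦Q • P⟧ a).
Proof. by rewrite /comp_inv; case: (comp_strong_inverse_sig Q P) => ζ Hζ; case: (Hζ a). Qed.

Lemma comp_strongK (I J K : C) (Q : Poly J K) (P : Poly I J) (a : slice I) :
  comp_strong PB T box Q P a ∘ comp_inv Q P a = idm (⟦Q⟧ (⟦P⟧ a)).
Proof. by rewrite /comp_inv; case: (comp_strong_inverse_sig Q P) => ζ Hζ; case: (Hζ a). Qed.

Definition unit_strong_inverse_sig (I : C) :
  {ζ : StrongTrans (id_bunched PB T L I) ⟦poly_id I⟧ | forall a : slice I,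
    ζ a ∘ unit_strong PB T box I a = idm _ /\ unit_strong PB T box I a ∘ ζ a = idm _}.
Proof.
apply: constructive_indefinite_description; apply: strong_trans_inverse => a.
exact: punit_iso.
Qed.

Definition unit_inv (I : C) := sval (unit_strong_inverse_sig I).

Lemma unit_invK (I : C) (a : slice I) :
  unit_inv I a ∘ unit_strong PB T box I a = idm (⟦poly_id I⟧ a).
Proof. by rewrite /unit_inv; case: (unit_strong_inverse_sig I) => ζ Hζ; case: (Hζ a). Qed.

Lemma unit_strongK (I : C) (a : slice I) : unit_strong PB T box I a ∘ unit_inv I a = idm a.
Proof. by rewrite /unit_inv; case: (unit_strong_inverse_sig I) => ζ Hζ; case: (Hζ a). Qed.

Definition cell_of_sig (I J : C) (P Q : Poly I J) (θ : StrongTrans ⟦P⟧ ⟦Q⟧) :=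
  constructive_indefinite_description _ (cell_strong_full θ).

Definition cell_of (I J : C) (P Q : Poly I J) (θ : StrongTrans ⟦P⟧ ⟦Q⟧) : PolyCell L P Q :=
  sval (cell_of_sig θ).

Lemma cell_ofE (I J : C) (P Q : Poly I J) (θ : StrongTrans ⟦P⟧ ⟦Q⟧) (a : slice I) :
  tc (cell_of θ) a = θ a.
Proof. by rewrite /cell_of; case: (cell_of_sig θ) => α. Qed.

(** Chosen by fullness as the 2-cell whose transformation is the identity associator conjugated by
    the comparisons; this makes coherence of the pseudofunctor a cancellation. *)
Definition associator_cell (I J K M : C) (P : Poly I J) (Q : Poly J K) (R : Poly K M) :
    PolyCell L (R • (Q • P)) (R • Q • P) :=
  cell_of (st_vcomp (comp_inv (R • Q) P) (st_vcomp (st_pre (comp_inv R Q) ⟦P⟧)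
    (st_vcomp (st_assoc2 ⟦P⟧ ⟦Q⟧ ⟦R⟧)
      (st_vcomp (st_post ⟦R⟧ (comp_strong PB T box Q P)) (comp_strong PB T box R (Q • P)))))).

Definition associator_inv_cell (I J K M : C) (P : Poly I J) (Q : Poly J K) (R : Poly K M) :
    PolyCell L (R • Q • P) (R • (Q • P)) :=
  cell_of (st_vcomp (comp_inv R (Q • P)) (st_vcomp (st_post ⟦R⟧ (comp_inv Q P))
    (st_vcomp (st_assoc2_inv ⟦P⟧ ⟦Q⟧ ⟦R⟧)
      (st_vcomp (st_pre (comp_strong PB T box R Q) ⟦P⟧) (comp_strong PB T box (R • Q) P))))).

Definition left_unitor_cell (I J : C) (P : Poly I J) : PolyCell L (poly_id J • P) P :=
  cell_of (st_vcomp (st_lunit ⟦P⟧)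
    (st_vcomp (st_pre (unit_strong PB T box J) ⟦P⟧) (comp_strong PB T box (poly_id J) P))).

Definition left_unitor_inv_cell (I J : C) (P : Poly I J) : PolyCell L P (poly_id J • P) :=
  cell_of (st_vcomp (comp_inv (poly_id J) P)
    (st_vcomp (st_pre (unit_inv J) ⟦P⟧) (st_lunit_inv ⟦P⟧))).

Definition right_unitor_cell (I J : C) (P : Poly I J) : PolyCell L (P • poly_id I) P :=
  cell_of (st_vcomp (st_runit ⟦P⟧)
    (st_vcomp (st_post ⟦P⟧ (unit_strong PB T box I)) (comp_strong PB T box P (poly_id I)))).

Definition right_unitor_inv_cell (I J : C) (P : Poly I J) : PolyCell L P (P • poly_id I) :=
  cell_of (st_vcomp (comp_inv P (poly_id I))
    (st_vcomp (st_post ⟦P⟧ (unit_inv I)) (st_runit_inv ⟦P⟧))).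

Lemma associator_cellE (I J K M : C) (P : Poly I J) (Q : Poly J K) (R : Poly K M) (x : slice I) :
  tc (associator_cell P Q R) x =
  comp_inv (R • Q) P x ∘ (comp_inv R Q (⟦P⟧ x) ∘
    (fmap ⟦R⟧ (comp_strong PB T box Q P x) ∘ comp_strong PB T box R (Q • P) x)).
Proof.
rewrite cell_ofE.
change (comp_inv (R • Q) P x ∘ (comp_inv R Q (⟦P⟧ x) ∘ (idm (⟦R⟧ (⟦Q⟧ (⟦P⟧ x))) ∘
  (fmap ⟦R⟧ (comp_strong PB T box Q P x) ∘ comp_strong PB T box R (Q • P) x))) =
  comp_inv (R • Q) P x ∘ (comp_inv R Q (⟦P⟧ x) ∘
  (fmap ⟦R⟧ (comp_strong PB T box Q P x) ∘ comp_strong PB T box R (Q • P) x))).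
by rewrite comp1m.
Qed.

Lemma associator_inv_cellE (I J K M : C) (P : Poly I J) (Q : Poly J K) (R : Poly K M)
    (x : slice I) :
  tc (associator_inv_cell P Q R) x =
  comp_inv R (Q • P) x ∘ (fmap ⟦R⟧ (comp_inv Q P x) ∘
    (comp_strong PB T box R Q (⟦P⟧ x) ∘ comp_strong PB T box (R • Q) P x)).
Proof.
rewrite cell_ofE.
change (comp_inv R (Q • P) x ∘ (fmap ⟦R⟧ (comp_inv Q P x) ∘ (idm (⟦R⟧ (⟦Q⟧ (⟦P⟧ x))) ∘
  (comp_strong PB T box R Q (⟦P⟧ x) ∘ comp_strong PB T box (R • Q) P x))) =
  comp_inv R (Q • P) x ∘ (fmap ⟦R⟧ (comp_inv Q P x) ∘
  (comp_strong PB T box R Q (⟦P⟧ x) ∘ comp_strong PB T box (R • Q) P x))).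
by rewrite comp1m.
Qed.

Lemma cell_trans_eq (I J : C) (P Q : Poly I J) (α β : PolyCell L P Q) :
  poly_cell_eq α β <-> forall x : slice I, tc α x = tc β x.
Proof.
split=> [e x | e].
  by apply: slice_hom_eq; have := pcell_eq PB T box x e; rewrite !pcellE.
by apply: (@poly_cell_eq_of_generic _ PB T L box); rewrite !pcellE e.
Qed.

Lemma cell_trans_id (I J : C) (P : Poly I J) (x : slice I) :
  tc (id_cell L P) x = idm (⟦P⟧ x).
Proof. by apply: slice_hom_eq; have := pcell_id PB T box P x; rewrite pcellE. Qed.

Lemma cell_trans_vcomp (I J : C) (P Q R : Poly I J) (β : PolyCell L Q R) (α : PolyCell L P Q)
    (x : slice I) :
  tc (vcomp_cell β α) x = tc β x ∘ tc α x.
Proof. by apply: slice_hom_eq; have := pcell_vcomp PB T box β α x; rewrite !pcellE. Qed.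

Lemma cell_trans_post (I J K : C) (Q : Poly J K) (P P' : Poly I J) (α : PolyCell L P P')
    (x : slice I) :
  comp_strong PB T box Q P' x ∘ tc (post_cell PB T box Q α) x =
  fmap ⟦Q⟧ (tc α x) ∘ comp_strong PB T box Q P x.
Proof. by apply: slice_hom_eq; have := pcell_post PB T box Q α x; rewrite !pcellE !pcompE !pmapE. Qed.

Lemma cell_trans_pre (I J K : C) (Q Q' : Poly J K) (β : PolyCell L Q Q') (P : Poly I J)
    (x : slice I) :
  comp_strong PB T box Q' P x ∘ tc (pre_cell PB T box β P) x =
  tc β (⟦P⟧ x) ∘ comp_strong PB T box Q P x.
Proof. by apply: slice_hom_eq; have := pcell_pre PB T box β P x; rewrite !pcellE !pcompE. Qed.

Definition poly_bicategory : Bicategory (poly_cells PB box).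
Proof.
refine (@transported_bicategory (poly_cells PB box) (fun I : C => slice I)
  (fun (I J : C) (P : Poly I J) => ⟦P⟧) (fun I J P Q α x => tc α x) _ (@cell_trans_eq)
  (fun I J K Q P x => comp_strong PB T box Q P x) (fun I J K Q P x => comp_inv Q P x)
  _ _ _ (fun I x => unit_strong PB T box I x) (fun I x => unit_inv I x) _ _ _
  (@id_cell C L) (@cell_trans_id) (@vcomp_cell C L) (@cell_trans_vcomp)
  (fun I J K Q P P' α => post_cell PB T box Q α) (@cell_trans_post)
  (fun I J K Q Q' β P => pre_cell PB T box β P) (@cell_trans_pre)
  (@associator_cell) _ (@associator_inv_cell) _
  (@left_unitor_cell) _ (@left_unitor_inv_cell) _
  (@right_unitor_cell) _ (@right_unitor_inv_cell) _).
- by move=> I J P Q α x y k; exact: tr_nat (cell_strong PB T box α) x y k.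
- by move=> I J K Q P x y k; exact: tr_nat (comp_strong PB T box Q P) x y k.
- by move=> *; exact: comp_invK.
- by move=> *; exact: comp_strongK.
- by move=> I x y k; exact: tr_nat (unit_strong PB T box I) x y k.
- by move=> *; exact: unit_invK.
- by move=> *; exact: unit_strongK.
- by move=> I J K M P Q R x; exact: associator_cellE.
- by move=> I J K M P Q R x; exact: associator_inv_cellE.
- by move=> I J P x; rewrite cell_ofE; exact: comp1m.
- move=> I J P x; rewrite cell_ofE.
  change (comp_inv (poly_id J) P x ∘ (unit_inv J (⟦P⟧ x) ∘ idm (⟦P⟧ x)) =
    comp_inv (poly_id J) P x ∘ unit_inv J (⟦P⟧ x)).
  by rewrite compm1.
- by move=> I J P x; rewrite cell_ofE; exact: comp1m.
- move=> I J P x; rewrite cell_ofE.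
  change (comp_inv P (poly_id I) x ∘ (fmap ⟦P⟧ (unit_inv I x) ∘ idm (⟦P⟧ x)) =
    comp_inv P (poly_id I) x ∘ fmap ⟦P⟧ (unit_inv I x)).
  by rewrite compm1.
Defined.

(** The whiskering squares are proved for [comp_strong], whereas the compositor of the pseudofunctor
    is its inverse. *)
Lemma inverse_square (D : Category) (X Y X' Y' : D) (f : X ~> Y) (f' : X' ~> Y') (g : Y ~> X)
    (g' : Y' ~> X') (h : X ~> X') (k : Y ~> Y') :
  f ∘ g = idm Y -> g' ∘ f' = idm X' -> f' ∘ h = k ∘ f -> g' ∘ k = h ∘ g.
Proof.
move=> fg gf e; rewrite -(compm1 k) -fg (compA k) -e -compA (compA g').
by rewrite gf comp1m.
Qed.

Definition poly_pseudofunctor :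
  Pseudofunctor poly_bicategory (strong_bicategory PB T L) (F0 := fun I : C => I)
    (fun I J (P : Poly I J) => ⟦P⟧).
Proof.
refine (@Build_Pseudofunctor _ _ poly_bicategory (strong_bicategory PB T L) (fun I : C => I)
  (fun I J (P : Poly I J) => ⟦P⟧) (fun I J P Q α => cell_strong PB T box α)
  (fun I J K Q P => comp_inv Q P) (fun I J K Q P => comp_strong PB T box Q P)
  unit_inv (unit_strong PB T box) _ _ _ _ _ _ _ _ _ _ _ _).
- by move=> I J P Q α β /cell_trans_eq.
- by move=> I J P x; exact: cell_trans_id.
- by move=> I J P Q R β α x; exact: cell_trans_vcomp.
- by move=> I J K Q P x; exact: comp_strongK.
- by move=> I J K Q P x; exact: comp_invK.
- by move=> I x; exact: unit_strongK.
- by move=> I x; exact: unit_invK.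
- move=> I J K Q P P' α x.
  exact: inverse_square (comp_strongK Q P x) (comp_invK Q P' x) (cell_trans_post Q α x).
- move=> I J K Q Q' β P x.
  exact: inverse_square (comp_strongK Q P x) (comp_invK Q' P x) (cell_trans_pre β P x).
- move=> I J K M P Q R x.
  change (tc (associator_cell P Q R) x ∘ (comp_inv R (Q • P) x ∘ fmap ⟦R⟧ (comp_inv Q P x)) =
    comp_inv (R • Q) P x ∘ (comp_inv R Q (⟦P⟧ x) ∘ idm (⟦R⟧ (⟦Q⟧ (⟦P⟧ x))))).
  rewrite associator_cellE -!compA (comp_pre1 _ (comp_strongK R (Q • P) x)) comp1m.
  by rewrite -fmap_comp (comp_strongK Q P x) fmap_id.
- move=> I J P x.
  change (tc (left_unitor_cell P) x ∘ (comp_inv (poly_id J) P x ∘ unit_inv J (⟦P⟧ x)) =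
    idm (⟦P⟧ x)).
  rewrite cell_ofE.
  change (idm (⟦P⟧ x) ∘ (unit_strong PB T box J (⟦P⟧ x) ∘ comp_strong PB T box (poly_id J) P x) ∘
    (comp_inv (poly_id J) P x ∘ unit_inv J (⟦P⟧ x)) = idm (⟦P⟧ x)).
  rewrite comp1m -compA (comp_pre1 _ (comp_strongK (poly_id J) P x)) comp1m.
  exact: unit_strongK.
- move=> I J P x.
  change (tc (right_unitor_cell P) x ∘ (comp_inv P (poly_id I) x ∘ fmap ⟦P⟧ (unit_inv I x)) =
    idm (⟦P⟧ x)).
  rewrite cell_ofE.
  change (idm (⟦P⟧ x) ∘ (fmap ⟦P⟧ (unit_strong PB T box I x) ∘ comp_strong PB T box P (poly_id I) x) ∘
    (comp_inv P (poly_id I) x ∘ fmap ⟦P⟧ (unit_inv I x)) = idm (⟦P⟧ x)).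
  rewrite comp1m -compA (comp_pre1 _ (comp_strongK P (poly_id I) x)) comp1m.
  by rewrite -fmap_comp unit_strongK fmap_id.
Defined.

End Biequivalence.

Theorem theorem5p2p8 (C : Category) (L : LocallySubcartesian C)
    (PB : Pullbacks C) (T : Terminal C) (closed : right_closed L)
    (box : forall (X Y : C) (f : X ~> Y), RightAdjoint (nabla L f)) :
  exists (Hid : forall I : C,
            is_subcartesian_polynomial box (id_bunched PB T L I))
         (Hcomp : forall (I J K : C) (G : BunchedFunctor PB T L J K)
              (F : BunchedFunctor PB T L I J),
            is_subcartesian_polynomial box G -> is_subcartesian_polynomial box F ->
            is_subcartesian_polynomial box (comp_bunched G F))
         (B : Bicategory (poly_cells PB box))
         (F : Pseudofunctor B (polyfun_bicategory Hid Hcomp)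
                (F0 := fun I : C => I) (poly_functor1 PB T box)),
    is_poly_bicategory B /\
    is_canonical_pseudofunctor F /\
    is_biequivalence F /\
    forall (I J : C) (P Q : Poly I J) (α : PolyCell L P Q),
      is_subcartesian_cell α <-> is_cartesian_trans (ps2 F α).
Proof.
exists (identity_polynomial PB T box), (@composite_polynomial C PB T L box),
  (poly_bicategory PB T box),
  (corestricted_pseudofunctor (poly_pseudofunctor PB T box) (identity_polynomial PB T box)
     (@composite_polynomial C PB T L box) (@poly_functor_polynomial C PB T L box)).
split; last split; last split.
- split; last split; last split.
  + move=> I J P; split=> //; exists (idm _); split; last by rewrite !compm1.
    by exists (idm _); rewrite compm1.
  + move=> I J P Q R β α; split=> //; exists (idm _); split; last by rewrite !compm1.
    by exists (idm _); rewrite compm1.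
  + by move=> I J K Q P P' α; exact: post_cell_whiskering.
  + by move=> I J K Q Q' α P; exact: pre_cell_whiskering.
(* The 2-cell action and the inverse comparisons were taken to be the canonical maps, so the three
   equations hold by computation. *)
- by [].
- split.
    (* Source and target have the same 0-cells, so identities serve as the equivalence. *)
    move=> I; exists I, (@id1 (polyfun_cells _ _) I), (@id1 (polyfun_cells _ _) I).
    have iso : isomorphic1 (polyfun_bicategory (identity_polynomial PB T box)
      (@composite_polynomial C PB T L box)) (id1 I ⊙ id1 I) (id1 I).
      exists (left_unitor (polyfun_bicategory _ _) (id1 I)), (left_unitor_inv (polyfun_bicategory _ _) (id1 I)).
      by split; [apply: left_unitorK | apply: left_unitor_invK].
    by split.
  move=> I J; split; last split.
  + move=> [G [P [θ Hθ]]]; exists P.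
    have [ζ Hζ] := strong_trans_inverse Hθ.
    by exists ζ, θ; split=> a; have [] := Hζ a.
  + move=> P Q θ; exists (cell_of θ) => a; exact: cell_ofE.
  + by move=> P Q α β /cell_trans_eq.
- move=> I J P Q α; split.
    exact: cartesian_of_subcartesian.
  exact: subcartesian_of_cartesian.
Qed.
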